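(* Let $X$ be a smooth projective curve over $\mathbb{C}$ with canonical bundle $K$, let $v=(\alpha_1,\dots,\alpha_n)_{\mathfrak{S}_n}\in\mathrm{V}^{\mathrm{nod}}$ and let $(E,\varphi)\in h^{-1}(v)$. For any ordering $J=(\alpha_{j_1},\dots,\alpha_{j_n})$ of the set $\{\alpha_1,\dots,\alpha_n\}$, one can choose canonically a filtration by Higgs subbundles $$(E_J)_\bullet:\quad 0\subsetneq(E_1,\varphi_1)\subsetneq\dots\subsetneq(E_n,\varphi_n)=(E,\varphi)$$ such that the Higgs field induced by $\varphi$ on $E_i/E_{i-1}$ is $\alpha_{j_i}$. Furthermore, if the spectral datum associated to $(E,\varphi)$ is a line bundle $L\in\mathrm{Jac}^{\delta}(\overline{X}_v)$ over the spectral curve, then $$E_i/E_{i-1}\cong(\alpha_{j_i}^*\iota_{j_i}^*L)\otimes K^{i-n}.$$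
   Context: $\mathrm{M}_n$ is the moduli space of semistable Higgs bundles $(E,\varphi)$, $\varphi\in H^0(X,\mathrm{End}(E)\otimes K)$, of rank $n$ and degree $0$ on $X$ (genus $g$), and $h:\mathrm{M}_n\to\mathrm{H}=\bigoplus_{i=1}^nH^0(X,K^i)$ is the Hitchin map (coefficients of the characteristic polynomial). Let $\pi:|K|\to X$ be the total space of $K$ and $\lambda$ the tautological section of $\pi^*K$. For $b\in\mathrm{H}$ the spectral curve $\overline{X}_b\subset|K|$ is the zero locus of $\lambda^n+\pi^*b_1\lambda^{n-1}+\dots+\pi^*b_n$. Put $\delta=n(n-1)(g-1)$. The spectral correspondence identifies $h^{-1}(b)$ with the moduli space of semistable torsion-free rank one sheaves $\mathcal{F}$ of degree $\delta$ on $\overline{X}_b$ via $E=\pi_*\mathcal{F}$, with $\varphi$ induced by multiplication by $\lambda$; $\mathcal{F}$ is called the spectral datum of $(E,\varphi)$. $\mathrm{Jac}^\delta(\overline{X}_b)$ denotes the line bundles of degree $\delta$. $\mathrm{V}=\mathrm{Sym}^n(H^0(X,K))$ is embedded in $\mathrm{H}$ by sending $(\alpha_1,\dots,\alpha_n)_{\mathfrak{S}_n}$ to the coefficients of $\prod_i(\lambda-\alpha_i)$. If the $\alpha_i$ are distinct then $\overline{X}_v=\bigcup_iX_i$ with $X_i=\alpha_i(X)\cong X$; set $D_{ij}=X_i\cap X_j$. $\mathrm{V}^{\mathrm{nod}}$ is the set of $v\in\mathrm{V}$ with distinct $\alpha_i$ such that no $D_{ij}$ ($i\ne j$) has a multiple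 point and $D_{ij}\cap D_{ik}=\emptyset$ for distinct $i,j,k$. The map $\iota_j:X_j\hookrightarrow\overline{X}_v$ is the inclusion, and $\alpha_j:X\to X_j$ is regarded as an isomorphism. *)

(* Defs.v *)
From HB Require Import structures.
From mathcomp Require Import all_boot all_order all_fingroup all_algebra.
From mathcomp Require Import boolp classical_sets reals.
From mathcomp Require Import complex mpoly.

Set Implicit Arguments.
Unset Strict Implicit.
Unset Printing Implicit Defensive.

Import GRing.Theory.
Local Open Scope classical_set_scope.
Local Open Scope ring_scope.

(* Algebraic geometry is set up in the classical language of varieties over a
   field [C], meant to be algebraically closed: closed points, Zariski topology,
   regular functions as [C]-valued functions; and vector bundles are algebraic
   families of vector spaces with a distinguished class of regular sections. *)

(* [regf x f] : the function [f] is regular at [x].  Only the germ of [f] at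
   [x] matters in the spaces below, so a function regular on an open set is
   represented by any of its extensions to the whole space. *)
Record fspace (C : fieldType) := Space {
  pt :> Type;
  opn : set (set pt);
  regf : pt -> (pt -> C) -> Prop }.
Arguments opn {C} f _.
Arguments regf {C f} _ _.

Section Spaces.
Variable C : fieldType.
Implicit Types X Y S : fspace C.

Definition near X (x : X) (P : X -> Prop) : Prop :=
  exists U : set X, [/\ opn X U, U x & forall y, U y -> P y].

Definition subspace S (A : set S) : fspace C :=
  {| pt := {p : S | A p};
     opn := fun W => exists2 W' : set S, opn S W' &
              forall p : {p : S | A p}, W p <-> W' (sval p);
     regf := fun p f => exists2 g : S -> C, regf (sval p) g &
              near (sval p)
                (fun q => forall Aq : A q, f (exist _ q Aq) = g q) |}.

Definition closed_set X (Z : set X) : Prop := opn X (~` Z).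

Definition irreducible_closed X (Z : set X) : Prop :=
  [/\ closed_set Z, Z !=set0 &
      forall A B : set X, closed_set A -> closed_set B ->
        Z `<=` A `|` B -> Z `<=` A \/ Z `<=` B].

Definition strict_chain X (d : nat) (Z : nat -> set X) : Prop :=
  (forall i, (i <= d)%N -> irreducible_closed (Z i)) /\
  (forall i, (i < d)%N -> Z i `<=` Z i.+1 /\ Z i <> Z i.+1).

Definition krull_dim X (d : nat) : Prop :=
  (exists Z : nat -> set X, strict_chain d Z) /\
  (forall Z : nat -> set X, ~ strict_chain d.+1 Z).

(* [h x] is a choice of homogeneous coordinates of the point [x]. *)
Definition projective_embedding X (N : nat) (h : X -> 'I_N.+1 -> C) : Prop :=
  [/\ forall x, exists i, h x i != 0,
      forall x y (c : C), (forall i, h x i = c * h y i) -> x = y,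
      exists2 I : set {mpoly C[N.+1]},
        (forall p, I p -> exists d, p \is d.-homog) &
        forall w : 'I_N.+1 -> C, (exists i, w i != 0) ->
          ((forall p, I p -> p.@[w] = 0) <->
           exists (x : X) (c : C), forall i, w i = c * h x i),
      forall U : set X, opn X U <->
        exists2 I : set {mpoly C[N.+1]},
          (forall p, I p -> exists d, p \is d.-homog) &
          forall x, ~ U x <-> (forall p, I p -> p.@[h x] = 0) &
      forall x f, regf x f <->
        exists (d : nat) (p q : {mpoly C[N.+1]}),
          [/\ p \is d.-homog, q \is d.-homog &
              near x (fun y => q.@[h y] != 0 /\ f y = p.@[h y] / q.@[h y])]].

(* [t] generates the maximal ideal of the local ring at [x]. *)
Definition uniformizer X (x : X) (t : X -> C) : Prop :=
  [/\ regf x t, t x = 0 &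
      forall f, regf x f -> f x = 0 ->
        exists2 g, regf x g & near x (fun y => f y = g y * t y)].

(* A local ring of dimension 1 is regular when its maximal ideal is generated
   by one element. *)
Definition smooth_projective_curve X : Prop :=
  [/\ exists (N : nat) (h : X -> 'I_N.+1 -> C), projective_embedding h,
      irreducible_closed [set: X],
      krull_dim X 1 &
      forall x : X, exists t, uniformizer x t].

(* Order at [x] of a function regular and non-zero on a punctured
   neighbourhood of [x], possibly with a pole at [x]. *)
Definition order_at X (x : X) (f : X -> C) (k : int) : Prop :=
  exists t u : X -> C,
    [/\ uniformizer x t, regf x u, u x != 0 &
        near x (fun y => y <> x -> f y = u y * t y ^ k)].

(* [regs x s] : the section [s] is regular at [x]. *)
Record vfamily X := Family {
  fib :> X -> vectType C;
  regs : forall x : X, (forall y, fib y) -> Prop }.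
Arguments Family {X} _ _.
Arguments regs {X} v _ _.

Definition vsection X (E : vfamily X) := forall x, E x.

Definition global_section X (E : vfamily X) (s : vsection E) : Prop :=
  forall x, regs E x s.

Definition local_frame X (E : vfamily X) n (x : X) (e : 'I_n -> vsection E) :=
  near x (fun y =>
    basis_of {:E y} [tuple e i y | i < n] /\
    forall s : vsection E, regs E y s <->
      exists2 a : 'I_n -> X -> C, (forall i, regf y (a i)) &
        near y (fun z => s z = \sum_(i < n) a i z *: e i z)).

Definition vector_bundle X (n : nat) (E : vfamily X) : Prop :=
  forall x, exists e : 'I_n -> vsection E, local_frame x e.

Definition trivial_line X : vfamily X :=
  Family (fun _ => (C^o : vectType C)) (fun x f => regf x f).

Definition bhom X (E F : vfamily X) : vfamily X :=
  Family (fun x => ('Hom(E x, F x) : vectType C))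
    (fun x A => forall s : vsection E, regs E x s ->
                  regs F x (fun y => (A y : 'Hom(E y, F y)) (s y))).

Definition bdual X (E : vfamily X) := bhom E (trivial_line X).
Definition bend X (E : vfamily X) := bhom E E.

(* V (x) W is realised as Hom(W^*, V). *)
Definition btens X (E F : vfamily X) := bhom (bdual F) E.

Definition tensv (V W : vectType C) (v : V) (w : W) : 'Hom('Hom(W, C^o), V) :=
  linfun (fun mu : 'Hom(W, C^o) => (mu w : C) *: v).

Fixpoint btpow X (E : vfamily X) (m : nat) : vfamily X :=
  if m is m'.+1 then btens (btpow E m') E else trivial_line X.

Definition bzpow X (E : vfamily X) (m : int) : vfamily X :=
  match m with
  | Posz k => btpow E k
  | Negz k => bdual (btpow E k.+1)
  end.

Fixpoint vpow X (E : vfamily X) (x : X) (w : E x) (m : nat) : btpow E m x :=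
  match m return btpow E m x with
  | m'.+1 => tensv (vpow w m') w
  | 0 => (1 : C)
  end.

Definition pullback X Y (f : Y -> X) (E : vfamily X) : vfamily Y :=
  Family (fun y => E (f y))
    (fun y s => exists (m : nat) (a : 'I_m -> Y -> C) (l : 'I_m -> vsection E),
      [/\ forall k, regf y (a k), forall k, regs E (f y) (l k) &
          near y (fun z => s z = \sum_(k < m) a k z *: l k (f z))]).

Definition bundle_iso X (E F : vfamily X) (f : forall x, 'Hom(E x, F x)) :=
  (forall x, bijective (f x)) /\
  (forall x (s : vsection E), regs E x s <-> regs F x (fun y => f y (s y))).

Definition isomorphic X (E F : vfamily X) : Prop :=
  exists f : forall x, 'Hom(E x, F x), bundle_iso f.

Definition subspaces X (E : vfamily X) := forall x, {vspace E x}.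

Definition is_subbundle X (E : vfamily X) (r : nat) (F : subspaces E) : Prop :=
  forall x, exists e : 'I_r -> vsection E,
    near x (fun y => (forall i, regs E y (e i)) /\
                     basis_of (F y) [tuple e i y | i < r]).

Definition subbundle X (E : vfamily X) (F : subspaces E) : vfamily X :=
  Family (fun x => (subvs_of (F x) : vectType C))
    (fun x s => regs E x (fun y => vsval (s y))).

(* For F <= F', the quotient F'/F; the fibre (F' x)/(F x) is modelled on the
   complement [F' x :\: F x] of [F x] in [F' x], [gr_proj] being the quotient
   map (projection along [F x]).  Regular sections of F'/F are locally the
   classes of regular sections of F'. *)
Definition gr_proj X (E : vfamily X) (F F' : subspaces E) (x : X) (e : E x) :
    subvs_of (F' x :\: F x)%VS :=
  vsproj (F' x :\: F x)%VS (addv_pi1 (F' x) (F x) e).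

Definition gr X (E : vfamily X) (F F' : subspaces E) : vfamily X :=
  Family (fun x => (subvs_of (F' x :\: F x)%VS : vectType C))
    (fun x s => exists2 l : vsection E, regs E x l &
       near x (fun y => l y \in F' y /\ s y = gr_proj F F' (l y))).

(* Order at [x] of the rational section s_1 /\ ... /\ s_n of det E, read in a
   local frame of E at [x]. *)
Definition det_order X (E : vfamily X) n (s : 'I_n -> vsection E) (x : X)
    (k : int) : Prop :=
  exists (e : 'I_n -> vsection E) (A : X -> 'M[C]_n),
    [/\ local_frame x e,
        near x (fun y => y <> x -> forall i,
                  s i y = \sum_(j < n) A y i j *: e j y) &
        order_at x (fun y => \det (A y)) k].

(* deg E is the degree of the divisor sum_j k_j p_j of a non-zero rational
   section s_1 /\ ... /\ s_n of det E. *)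
Definition bundle_degree X (n : nat) (E : vfamily X) (d : int) : Prop :=
  exists (s : 'I_n -> vsection E) (m : nat) (p : 'I_m -> X) (k : 'I_m -> int),
    [/\ injective p,
        forall j, det_order s (p j) (k j),
        forall x, (forall j, x <> p j) -> det_order s x 0 &
        d = \sum_(j < m) k j].

Definition in_max_ideal_sq X (x : X) (f : X -> C) : Prop :=
  exists (m : nat) (g h : 'I_m -> X -> C),
    [/\ forall k, regf x (g k) /\ g k x = 0,
        forall k, regf x (h k) /\ h k x = 0 &
        near x (fun y => f y = \sum_(k < m) g k y * h k y)].

(* K is the cotangent line bundle of the curve: [d f x] is the differential at
   [x] of the germ of [f], it identifies m_x/m_x^2 with the fibre [K x], and
   the regular sections are locally the sums of a_k d f_k. *)
Definition canonical_bundle X (K : vfamily X) : Prop :=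
  vector_bundle 1 K /\
  exists d : (X -> C) -> vsection K,
    [/\ [/\ forall x f g, regf x f -> regf x g ->
              near x (fun y => f y = g y) -> d f x = d g x,
            forall (c : C) x, d (fun=> c) x = 0,
            forall x f g, regf x f -> regf x g ->
              d (fun y => f y + g y) x = d f x + d g x &
            forall x f g, regf x f -> regf x g ->
              d (fun y => f y * g y) x = f x *: d g x + g x *: d f x],
        forall x (w : K x), exists2 f, regf x f & d f x = w,
        forall x f, regf x f -> f x = 0 -> d f x = 0 -> in_max_ideal_sq x f &
        forall x (s : vsection K), regs K x s <->
          exists (m : nat) (a f : 'I_m -> X -> C),
            [/\ forall k, regf x (a k), forall k, regf x (f k) &
                near x (fun y => s y = \sum_(k < m) a k y *: d (f k) y)]].

(* g = dim H^0(X, K) *)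
Definition genus X (K : vfamily X) (g : nat) : Prop :=
  exists w : 'I_g -> vsection K,
    (forall i, global_section (w i)) /\
    forall s : vsection K, global_section s ->
      exists! c : {ffun 'I_g -> C}, forall x, s x = \sum_(i < g) c i *: w i x.

Definition higgs_field X (K E : vfamily X) := vsection (btens (bend E) K).

Definition apply_higgs X (K E : vfamily X) (phi : higgs_field K E) (x : X)
    (mu : 'Hom(K x, C^o)) (e : E x) : E x :=
  (((phi x : 'Hom('Hom(K x, C^o), 'End(E x))) mu) : 'End(E x)) e.

(* phi(F) is contained in F (x) K, i.e. all contractions of phi by covectors
   of K preserve F. *)
Definition higgs_invariant X (K E : vfamily X) (phi : higgs_field K E)
    (F : subspaces E) : Prop :=
  forall x (mu : 'Hom(K x, C^o)) (e : E x),
    e \in F x -> apply_higgs phi mu e \in F x.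

Definition higgs_subbundle X (K E : vfamily X) (phi : higgs_field K E)
    (F : subspaces E) : Prop :=
  (exists r, is_subbundle r F) /\ higgs_invariant phi F.

(* psi is the Higgs field induced by phi on the quotient F'/F. *)
Definition induced_higgs X (K E : vfamily X) (phi : higgs_field K E)
    (F F' : subspaces E) (psi : higgs_field K (gr F F')) : Prop :=
  forall x (mu : 'Hom(K x, C^o)) (e : E x), e \in F' x ->
    apply_higgs psi mu (gr_proj F F' e) = gr_proj F F' (apply_higgs phi mu e).

Definition scalar_higgs X (K E : vfamily X) (a : vsection K) :
    higgs_field K E :=
  fun x => tensv (\1%VF : 'End(E x)) (a x).

Definition higgs_iso X (K E E' : vfamily X) (phi : higgs_field K E)
    (phi' : higgs_field K E') (f : forall x, 'Hom(E x, E' x)) : Prop :=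
  bundle_iso f /\
  forall x (mu : 'Hom(K x, C^o)) (e : E x),
    f x (apply_higgs phi mu e) = apply_higgs phi' mu (f x e).

Definition semistable X (K : vfamily X) (n : nat) (E : vfamily X) (d : int)
    (phi : higgs_field K E) : Prop :=
  forall (r : nat) (F : subspaces E) (e : int),
    (0 < r)%N -> is_subbundle r F -> higgs_invariant phi F ->
    bundle_degree r (subbundle F) e -> e * n%:Z <= d * r%:Z.

(* Points (b_1, b_2, ...) of the Hitchin base; the entry of index 0 is the
   leading coefficient 1, and only the entries of index <= n are used. *)
Definition coefficients X (K : vfamily X) := forall i, vsection (btpow K i).

(* If phi = A (x) k at x, the coefficient of lambda^(n-i) in
   det(lambda - A k) is c_i k^i, where c_i is that of T^(n-i) in det(T - A). *)
Definition hitchin_map X (K : vfamily X) (n : nat) (E : vfamily X)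
    (phi : higgs_field K E) (b : coefficients K) : Prop :=
  forall x (e : n.-tuple (E x)) (k : K x) (A : 'End(E x)),
    basis_of {:E x} e -> phi x = tensv A k ->
    forall i, (i <= n)%N ->
      b i x = (char_poly (\matrix_(i, j) coord e i (A e`_j)))`_(n - i)
                *: vpow k i.

Definition in_hitchin_fibre X (K : vfamily X) (n : nat) (b : coefficients K)
    (E : vfamily X) (phi : higgs_field K E) : Prop :=
  [/\ vector_bundle n E, bundle_degree n E 0, global_section phi,
      semistable n 0 phi & hitchin_map n phi b].

(* Coefficients of prod_(a in s) (lambda - a). *)
Fixpoint prod_coefs X (K : vfamily X) (s : seq (vsection K)) : coefficients K :=
  fun i => match i return vsection (btpow K i) with
  | 0 => fun x => (1 : C)
  | j.+1 => if s is a :: s' then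
              fun x => prod_coefs s' j.+1 x - tensv (prod_coefs s' j x) (a x)
            else fun x => 0
  end.

Definition hitchin_point X (K : vfamily X) n (alpha : 'I_n -> vsection K) :=
  prod_coefs [seq alpha i | i <- enum 'I_n].

Definition in_Vnod X (K : vfamily X) n (alpha : 'I_n -> vsection K) : Prop :=
  [/\ forall i, global_section (alpha i),
      forall i j, i != j -> exists x, alpha i x <> alpha j x,
      (* D_ij, seen on X, is the divisor of zeros of alpha_i - alpha_j *)
      forall i j, i != j -> forall x k,
        @det_order X K 1 (fun=> (fun y => alpha i y - alpha j y)) x k ->
        k <= 1 &
      forall i j k, i != j -> i != k -> j != k ->
        forall x, ~ (alpha i x = alpha j x /\ alpha i x = alpha k x)].

(* Functions on K restricted to U that are polynomial on the fibres. *)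
Definition fibre_polynomial X (K : vfamily X) (U : set X)
    (P : {x : X & K x} -> C) : Prop :=
  exists (mu : vsection (bdual K)) (d : nat) (a : 'I_d -> X -> C),
    [/\ forall x, U x -> regs (bdual K) x mu,
        forall k x, U x -> regf x (a k) &
        forall x (w : K x), U x ->
          P (existT _ x w) =
          \sum_(k < d) a k x * (((mu x : 'Hom(K x, C^o)) w : C) ^+ k)].

Definition total_space X (K : vfamily X) : fspace C :=
  {| pt := {x : X & K x};
     opn := fun W => forall p, W p ->
       exists (U : set X) (Q : {x : X & K x} -> C),
         [/\ opn X U, U (projT1 p), fibre_polynomial U Q, Q p != 0 &
             forall q, U (projT1 q) -> Q q != 0 -> W q];
     regf := fun p f =>
       exists (U : set X) (P Q : {x : X & K x} -> C),
         [/\ opn X U /\ U (projT1 p), fibre_polynomial U P,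
             fibre_polynomial U Q, Q p != 0 &
             forall q, U (projT1 q) -> Q q != 0 -> f q = P q / Q q] |}.

(* Horner evaluation in K_x^m of lambda^m + b_1 lambda^(m-1) + ... + b_m at a
   point (x, w) of the total space. *)
Fixpoint spectral_eq X (K : vfamily X) (b : coefficients K) (x : X) (w : K x)
    (m : nat) : btpow K m x :=
  match m return btpow K m x with
  | m'.+1 => tensv (spectral_eq b w m') w + b m'.+1 x
  | 0 => b 0 x
  end.

(* The zero locus with its reduced structure, which is the scheme structure
   when b comes from pairwise distinct alpha_i. *)
Definition spectral_curve X (K : vfamily X) (n : nat) (b : coefficients K) :=
  @subspace (total_space K) (fun p => spectral_eq b (projT2 p) n = 0).

Definition component X (K : vfamily X) (a : vsection K) : fspace C :=
  @subspace (total_space K) (fun p => projT2 p = a (projT1 p)).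

Definition component_map X (K : vfamily X) (a : vsection K) (x : X) :
    component a :=
  exist (fun p : total_space K => projT2 p = a (projT1 p))
    (existT _ x (a x)) erefl.

Definition spectral_proj X (K : vfamily X) (n : nat) (b : coefficients K)
    (y : spectral_curve n b) : X := projT1 (sval y).

(* E = pi_* L with phi induced by multiplication by lambda: [Psi U] is the
   isomorphism from sections of E on U to sections of L on pi^{-1}(U).
   Contracting phi and lambda with a local section mu of K^*, compatibility
   says that phi(mu) corresponds to multiplication by mu(lambda). *)
Definition spectral_datum X (K : vfamily X) (n : nat) (b : coefficients K)
    (E : vfamily X) (phi : higgs_field K E)
    (L : vfamily (spectral_curve n b)) : Prop :=
  exists Psi : set X -> vsection E -> vsection L,
  [/\ forall U V (s : vsection E), opn X U -> opn X V -> V `<=` U ->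
        (forall x, U x -> regs E x s) ->
        forall y, V (spectral_proj y) -> Psi V s y = Psi U s y,
      forall U (s : vsection E), opn X U -> (forall x, U x -> regs E x s) ->
        forall y, U (spectral_proj y) -> regs L y (Psi U s),
      forall U (s s' : vsection E) (f : X -> C), opn X U ->
        (forall x, U x -> regs E x s) -> (forall x, U x -> regs E x s') ->
        (forall x, U x -> regf x f) ->
        forall y, U (spectral_proj y) ->
          Psi U (fun x => f x *: s x + s' x) y =
          f (spectral_proj y) *: Psi U s y + Psi U s' y,
      (forall U (s s' : vsection E), opn X U ->
         (forall x, U x -> regs E x s) -> (forall x, U x -> regs E x s') ->
         ((forall y, U (spectral_proj y) -> Psi U s y = Psi U s' y) <->
          (forall x, U x -> s x = s' x))) /\
      (forall U (l : vsection L), opn X U ->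
         (forall y, U (spectral_proj y) -> regs L y l) ->
         exists2 s : vsection E, (forall x, U x -> regs E x s) &
           forall y, U (spectral_proj y) -> Psi U s y = l y) &
      forall U (s : vsection E) (mu : vsection (bdual K)), opn X U ->
        (forall x, U x -> regs E x s) ->
        (forall x, U x -> regs (bdual K) x mu) ->
        forall y, U (spectral_proj y) ->
          Psi U (fun x => apply_higgs phi (mu x) (s x)) y =
          ((mu (spectral_proj y) : 'Hom(K (spectral_proj y), C^o))
             (projT2 (sval y)) : C) *: Psi U s y].

Section Tensor.
Variables V W : vectType C.
Implicit Types (v : V) (w : W) (mu : 'Hom(W, C^o)).

Lemma tensvE v w mu : tensv v w mu = (mu w : C) *: v.
Proof.
rewrite /tensv; set f := (f in linfun f).
have flin : linear f.
  by move=> a u1 u2; rewrite /f lfunE /= lfunE /= scalerDl scalerA.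
pose m := GRing.isLinear.Build _ _ _ _ f flin.
pose F : {linear 'Hom(W, C^o) -> V} := HB.pack f m.
by rewrite (lfunE F).
Qed.

Lemma tensvBl v1 v2 w : tensv (v1 - v2) w = tensv v1 w - tensv v2 w.
Proof. by apply/lfunP=> mu; rewrite !lfun_simp !tensvE scalerBr. Qed.

Lemma tensvDl v1 v2 w : tensv (v1 + v2) w = tensv v1 w + tensv v2 w.
Proof. by apply/lfunP=> mu; rewrite !lfun_simp !tensvE scalerDr. Qed.

Lemma tensvBr v w1 w2 : tensv v (w1 - w2) = tensv v w1 - tensv v w2.
Proof. by apply/lfunP=> mu; rewrite !lfun_simp !tensvE linearB scalerBl. Qed.

Lemma tensv0l w : tensv (0 : V) w = 0.
Proof. by apply/lfunP=> mu; rewrite tensvE scaler0 zero_lfunE. Qed.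

Lemma tensv0r v : tensv v (0 : W) = 0.
Proof. by apply/lfunP=> mu; rewrite tensvE linear0 scale0r zero_lfunE. Qed.

End Tensor.

Lemma tensvAC (V W : vectType C) (v : V) (w1 w2 : W) :
  \dim {:W} = 1 -> tensv (tensv v w1) w2 = tensv (tensv v w2) w1.
Proof.
move=> dW; apply/lfunP=> mu; rewrite !tensvE.
apply/lfunP=> nu; rewrite !scale_lfunE !tensvE !scalerA; congr (_ *: _).
have w0P w : exists c, w = c *: vpick {:W}.
  apply/vlineP; have sub : (<[vpick {:W}]> <= {:W})%VS by exact: subvf.
  have /eqP -> : (<[vpick {:W}]>%VS == {:W}%VS).
    by rewrite eqEdim subvf dW dim_vline lt0b vpick0 -dimv_eq0 dW.
  exact: memvf.
have [c1 ->] := w0P w1; have [c2 ->] := w0P w2.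
rewrite !linearZ /=; set a := mu _; set b := nu _.
change (c2 * a * (c1 * b) = c1 * a * (c2 * b) :> C).
by rewrite mulrACA [c2 * c1]mulrC mulrACA.
Qed.

Lemma vector_bundle_dim X (n : nat) (E : vfamily X) (x : X) :
  vector_bundle n E -> \dim {:E x} = n.
Proof.
move=> /(_ x)[e [U [_ Ux /(_ x Ux)[eb _]]]].
by case/andP: eb => /eqP <- /eqnP ->; apply: size_tuple.
Qed.

Section Roots.
Variables (X : fspace C) (K : vfamily X).
Hypothesis HK : vector_bundle 1 K.

Lemma prod_coefs_oversize (s : seq (vsection K)) (i : nat) x :
  (size s < i)%N -> prod_coefs s i x = 0.
Proof.
elim: s i => [|a s IHs] [|i] //= lt_s_i.
by rewrite !IHs ?tensv0l ?subr0 // ltnW.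
Qed.

Lemma spectral_eq_cons (a : vsection K) (s : seq (vsection K)) x (w : K x) m :
  spectral_eq (prod_coefs (a :: s)) w m.+1 =
  spectral_eq (prod_coefs s) w m.+1
    - tensv (spectral_eq (prod_coefs s) w m) (a x).
Proof.
have coef0 (s' : seq (vsection K)) : prod_coefs s' 0 x = (1 : C) by case: s'.
have eqS (b : coefficients K) k :
    spectral_eq b w k.+1 = tensv (spectral_eq b w k) w + b k.+1 x by [].
elim: m => [|m IHm]; first by rewrite /= !coef0 addrA.
rewrite eqS IHm tensvBl (tensvAC _ _ _ (vector_bundle_dim x HK)).
rewrite (eqS _ m.+1) (eqS _ m).
have -> : prod_coefs (a :: s) m.+2 x =
    prod_coefs s m.+2 x - tensv (prod_coefs s m.+1 x) (a x) by [].
by rewrite [X in _ = _ - X]tensvDl opprD addrACA.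
Qed.

Lemma spectral_eq_prod (a : vsection K) (s : seq (vsection K)) x (w : K x) :
  spectral_eq (prod_coefs (a :: s)) w (size s).+1 =
  tensv (spectral_eq (prod_coefs s) w (size s)) (w - a x).
Proof.
rewrite spectral_eq_cons tensvBr; congr (_ - _).
by rewrite /= (prod_coefs_oversize _ (ltnSn _)) addr0.
Qed.

Lemma spectral_eq_root (s : seq (vsection K)) x (k : nat) (d : vsection K) :
  (k < size s)%N ->
  spectral_eq (prod_coefs s) (nth d s k x) (size s) = 0.
Proof.
elim: s k => [|a s IHs] [|k] // lt_k.
  by rewrite [size _]/= spectral_eq_prod subrr tensv0r.
by rewrite [size _]/= spectral_eq_prod IHs // tensv0l.
Qed.

Variables (n : nat) (alpha : 'I_n -> vsection K) (j : 'I_n).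

Lemma component_sub (p : total_space K) :
  projT2 p = alpha j (projT1 p) ->
  spectral_eq (hitchin_point alpha) (projT2 p) n = 0.
Proof.
move=> ->; rewrite /hitchin_point.
have sz : size [seq alpha i | i <- enum 'I_n] = n.
  by rewrite size_map size_enum_ord.
have := @spectral_eq_root [seq alpha i | i <- enum 'I_n] (projT1 p) j (alpha j).
by rewrite sz (nth_map j) ?size_enum_ord // nth_ord_enum; apply.
Qed.

Definition component_incl (p : component (alpha j)) :
    spectral_curve n (hitchin_point alpha) :=
  exist _ (sval p) (component_sub (svalP p)).

(* alpha_j^* iota_j^* L *)
Definition restriction (L : vfamily (spectral_curve n (hitchin_point alpha))) :
    vfamily X :=
  pullback (@component_map X K (alpha j)) (pullback component_incl L).

End Roots.

(* Line bundles of degree d on the spectral curve; the degree on this reduced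
   reducible curve is the sum of the degrees on the components. *)
Definition in_Jac X (K : vfamily X) (HK : vector_bundle 1 K) n
    (alpha : 'I_n -> vsection K) (d : int)
    (L : vfamily (spectral_curve n (hitchin_point alpha))) : Prop :=
  vector_bundle 1 L /\
  exists2 e : 'I_n -> int,
    forall j, bundle_degree 1 (restriction HK j L) (e j) & d = \sum_(j < n) e j.

Definition filtration_type X (E : vfamily X) := nat -> subspaces E.

(* Only the steps F 0, ..., F n are meaningful. *)
Definition higgs_filtration X (K E : vfamily X) (n : nat)
    (phi : higgs_field K E) (F : filtration_type E) : Prop :=
  [/\ forall x, F 0%N x = 0%VS,
      forall x, F n x = {:E x}%VS,
      forall i, (i <= n)%N -> higgs_subbundle phi (F i) &
      forall i, (i < n)%N ->
        (forall x, (F i x <= F i.+1 x)%VS) /\ exists x, F i x <> F i.+1 x].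

End Spaces.

(* Main.v *)
Require Import Defs.
From HB Require Import structures.
From mathcomp Require Import all_boot all_order all_fingroup all_algebra.
From mathcomp Require Import boolp classical_sets reals.
From mathcomp Require Import complex mpoly.

Set Implicit Arguments.
Unset Strict Implicit.
Unset Printing Implicit Defensive.

Import Order.TTheory GRing.Theory.
Local Open Scope ring_scope.

(* Fix [J].  The step [E_i] is the kernel of the product of the
   [phi - alpha_(J k)], [k < i]; on a curve such a kernel is a subbundle.
   Concretely, the local ring at [x] is a discrete valuation ring, so over it an
   eigenvector of the matrix of [phi] can be made primitive and completed to a
   basis, and by induction [phi] is upper triangular near [x] in some frame
   [e_1, ..., e_n], with diagonal [alpha_(J 1), ..., alpha_(J n)]; since the
   [alpha_j] are generically distinct, [e_1, ..., e_i] span [E_i].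
   If [E] is the direct image of a line bundle [L], sections of [E_i] are the
   sections of [L] vanishing on the components [X_(J k)], [k > i].  Restricted
   to [X_(J i)] they are exactly the multiples of the product of the
   [alpha_(J i) - alpha_(J k)], [k > i], a section of [K ^ (n - i)]; dividing by
   it identifies [E_i / E_(i-1)] with the twist of the restriction of [L] by
   [K ^ (i - n)]. *)

(** * Noetherianity of polynomial rings *)

(** Canonical means that the steps depend on [(E, phi)] only and are matched by isomorphisms of
    Higgs bundles, so no frame may enter their definition. Where several [alpha_j] agree, the
    pointwise kernel of the product can be too large; the fibre of a step therefore consists of the
    values of local sections killed by the product near the point, and frames only serve to show
    that these values form a subbundle. Smoothness is given as principality of the maximal ideal. A
    valuation ring also requires that no non-zero function be divisible by all powers of the
    uniformizer; this comes from noetherianity, reduced to monomials by Dickson's lemma.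
    Divisibility by the product of the differences on a branch comes from writing functions on the
    total space as quotients of polynomials in lambda: vanishing on the other branches through a
    point yields roots of the numerator. The isomorphism of graded pieces is described by a
    condition free of choices, satisfied by exactly one linear map at each point, so that local
    isomorphisms glue. Powers of [K] are handled by contracting with a covector [mu] and following
    the homogeneity in [mu]. *)

Lemma nondecreasing_subsequence (f : nat -> nat) :
  exists2 s : nat -> nat, (forall i, (s i < s i.+1)%N) &
    forall i, (f (s i) <= f (s i.+1))%N.
Proof.
(* Choose repeatedly an index where [f] is minimal over the remaining tail. *)
have tail_min m : exists k, (m <= k)%N /\ forall l, (m <= l)%N -> (f k <= f l)%N.
  have exv : exists v, `[< exists2 k, (m <= k)%N & f k = v >].
    by exists (f m); apply/asboolP; exists m.
  have [v /asboolP[k le_mk <-] vmin] := ex_minnP exv.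
  by exists k; split=> // l le_ml; apply: vmin; apply/asboolP; exists l.
have [c cP] := choice tail_min.
pose s := fix s i := if i is i'.+1 then c (s i').+1 else c 0%N.
exists s => i; first by have [] := cP (s i).+1.
have lt_s : (s i < s i.+1)%N by have [] := cP (s i).+1.
case: i lt_s => [|i] lt_s; first by have [_ min0] := cP 0%N; apply: min0.
have [le1 min1] := cP (s i).+1; apply: min1.
exact: leq_trans le1 (ltnW lt_s).
Qed.

Lemma increasing_homo (s : nat -> nat) :
  (forall i, (s i < s i.+1)%N) -> forall i j, (i < j)%N -> (s i < s j)%N.
Proof. by move=> s1; apply: (homo_ltn ltn_trans). Qed.

(** Dickson's lemma: subsequences are extracted one variable at a time, and each extraction
    preserves the monotonicity already obtained for the earlier exponents. The first two terms of
    the last subsequence are the required pair. *)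
Lemma dickson n (m : nat -> 'X_{1..n}) :
  exists i j, (i < j)%N /\ (m i <= m j)%MM.
Proof.
suff H (r : seq 'I_n) : exists2 s : nat -> nat, (forall i, (s i < s i.+1)%N) &
    forall k, k \in r -> forall i, (m (s i) k <= m (s i.+1) k)%N.
  have [s s1 sm] := H (enum 'I_n); exists (s 0%N), (s 1%N); split=> //.
  by apply/mnm_lepP => k; apply: sm; rewrite mem_enum.
elim: r => [|k0 r [s s1 sm]]; first by exists id.
have [t t1 tm] := nondecreasing_subsequence (fun i => m (s i) k0).
exists (s \o t) => [i|k]; first by apply: increasing_homo s1 _ _ (t1 i).
rewrite inE => /predU1P[->|kr] i /=; first exact: tm.
apply: (@homo_leq _ (fun i => m (s i) k) (fun a b => (a <= b)%N)) (ltnW (t1 i)).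
- exact: leqnn.
- exact: leq_trans.
- by move=> l; apply: sm.
Qed.

(** If all the inclusions were strict, choose [p k] in [I k.+1] outside [I k] with minimal leading
    monomial. For some [i < j] the leading monomial of [p i] divides that of [p j]; subtracting the
    multiple [r] of [p i] with the leading term of [p j] leaves zero or an element of smaller
    leading monomial, which lies in [I j] by minimality. Hence [p j] lies in [I j], a
    contradiction. *)
Lemma mpoly_acc (C : fieldType) n (I : nat -> {mpoly C[n]} -> Prop) :
  (forall k p, I k p -> I k.+1 p) -> (forall k, I k 0) ->
  (forall k p q, I k p -> I k q -> I k (p + q)) ->
  (forall k p q, I k q -> I k (p * q)) ->
  exists k, forall p, I k.+1 p -> I k p.
Proof.
move=> IS I0 addI IM; apply: contrapT => noacc.
have ex_min k : exists p, [/\ I k.+1 p, ~ I k p &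
    forall q, I k.+1 q -> (mlead q < mlead p)%O -> I k q].
  have [p Ip nIp] : exists2 p, I k.+1 p & ~ I k p.
    apply: contrapT => nop; apply: noacc; exists k => p Ip.
    by apply: contrapT => nIp; apply: nop; exists p.
  move: {-2}p (erefl (mlead p)) Ip nIp.
  elim/(well_founded_ind (@ltom_wf n)): (mlead p) => m IH {}p mp Ip nIp.
  have [[q [Iq lt_qp nIq]]|noq] := pselect (exists q,
      [/\ I k.+1 q, (mlead q < mlead p)%O & ~ I k q]).
    by rewrite mp in lt_qp; exact: (IH _ lt_qp q).
  exists p; split=> // q Iq lt_qp; apply: contrapT => nIq.
  by apply: noq; exists q.
have [p pP] := choice ex_min.
have Imono k l q : (k <= l)%N -> I k q -> I l q.
  by move=> /subnK<-; elim: (l - k)%N => // d IHd Iq; rewrite addSn; apply/IS/IHd.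
have [i [j [lt_ij le_m]]] := dickson (fun k => mlead (p k)).
have [Ipi nIpi _] := pP i; have [Ipj nIpj pj_min] := pP j.
have nz k : p k != 0.
  by apply/eqP => p0; have [_ nIpk _] := pP k; apply: nIpk; rewrite p0.
pose r := (mleadc (p j) / mleadc (p i)) *: 'X_[(mlead (p j) - mlead (p i))%MM] * p i.
have lc k : mleadc (p k) != 0 by rewrite mleadc_eq0.
have nzr : (mleadc (p j) / mleadc (p i)) *: 'X_[(mlead (p j) - mlead (p i))%MM] != 0
    :> {mpoly C[n]}.
  by rewrite -mleadc_eq0 mleadcZE mleadXm mcoeffX eqxx mulr1 mulf_neq0 ?invr_neq0.
have lead_r : mlead r = mlead (p j).
  by rewrite mleadM // mleadZ ?mulf_neq0 ?invr_neq0 // mleadXm submK.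
have Ir : I j r by apply/IM/(Imono i.+1).
apply: nIpj; rewrite -(subrK r (p j)); apply: (addI) => //.
have [->//|nzq] := eqVneq (p j - r) 0.
have Iq : I j.+1 (p j - r).
  by apply: addI Ipj _; rewrite -mulN1r; apply/IM/IS.
apply: pj_min => //.
rewrite lt_neqAle; apply/andP; split; last first.
  by apply: le_trans (mleadB_le _ _) _; rewrite lead_r joinxx.
apply: contra_neq nzq => eq_lead; apply/eqP; rewrite -mleadc_eq0 eq_lead mcoeffB.
have -> : r@_(mlead (p j)) = mleadc r by rewrite lead_r.
by rewrite /r mleadM // mleadcM mleadcZE mleadXm mcoeffX eqxx mulr1 divfK // subrr.
Qed.

(** * Zariski neighbourhoods and regular functions *)

Section Near.
Local Open Scope classical_set_scope.
Variables (C : fieldType) (X : fspace C).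
Implicit Types (x y : X) (P Q : X -> Prop).

Lemma near_mono x P Q : (forall y, P y -> Q y) -> near x P -> near x Q.
Proof. by move=> PQ [U [oU Ux UP]]; exists U; split=> // y /UP/PQ. Qed.

Lemma near_self x P : near x P -> P x.
Proof. by move=> [U [_ Ux]]; apply. Qed.

Lemma near_near x P : near x P -> near x (fun y => near y P).
Proof. by move=> [U [oU Ux UP]]; exists U; split=> // y Uy; exists U. Qed.

Lemma near_open (U : set X) x : opn X U -> U x -> near x U.
Proof. by move=> oU Ux; exists U. Qed.

End Near.

Section RegularFunctions.
Local Open Scope classical_set_scope.
Variables (C : fieldType) (X : fspace C).
Hypothesis HX : smooth_projective_curve X.
Implicit Types (x y : X) (P Q : X -> Prop) (f g : X -> C).

Lemma open_setT : opn X setT.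
Proof.
have [[N [h [_ _ _ ho _]]] _ _ _] := HX; apply/ho.
exists [set 1] => [p ->|x]; first by exists 0%N; apply: dhomog1.
split=> [nT|/(_ 1 erefl)/eqP]; first by case: nT.
by rewrite meval1 oner_eq0.
Qed.

Lemma open_setI (U V : set X) : opn X U -> opn X V -> opn X (U `&` V).
Proof.
have [[N [h [_ _ _ ho _]]] _ _ _] := HX.
move=> /ho[I Ih IP] /ho[J Jh JP]; apply/ho.
exists [set p * q | p in I & q in J] => [_ [p Ip [q Jq] <-]|x].
  have [[d pd] [e qe]] := (Ih p Ip, Jh q Jq).
  by exists (d + e)%N; apply: dhomogM.
split=> [nUV _ [p Ip [q Jq] <-]|vUV [Ux Vx]].
  rewrite mevalM; have [Ux|/IP/(_ p Ip) ->] := pselect (U x); last by rewrite mul0r.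
  have [Vx|/JP/(_ q Jq) ->] := pselect (V x); last by rewrite mulr0.
  by case: nUV.
have [p Ip p0] : exists2 p, I p & p.@[h x] != 0.
  apply: contrapT => nop; suff : ~ U x by [].
  by apply/IP => p Ip; apply/eqP; apply: contrapT => /negP ?; apply: nop; exists p.
have [q Jq q0] : exists2 q, J q & q.@[h x] != 0.
  apply: contrapT => nop; suff : ~ V x by [].
  by apply/JP => q Jq; apply/eqP; apply: contrapT => /negP ?; apply: nop; exists q.
have /eqP : (p * q).@[h x] = 0 by apply: vUV; exists p => //; exists q.
by rewrite mevalM mulf_eq0 (negPf p0) (negPf q0).
Qed.

(** The complement is cut out by all the homogeneous polynomials whose non-vanishing locus lies in
    [U]. *)
Lemma open_near (U : set X) : (forall x, U x -> near x U) -> opn X U.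
Proof.
have [[N [h [_ _ _ ho _]]] _ _ _] := HX.
move=> nU; apply/ho.
exists [set p | (exists d, p \is d.-homog) /\ forall y, p.@[h y] != 0 -> U y].
  by move=> p [].
move=> x; split=> [nUx p [_ pU]|vp Ux].
  by apply/eqP; apply: contrapT => /negP/pU.
have [V [/ho[I Ih IV] Vx VU]] := nU x Ux.
suff : ~ V x by [].
apply/IV => p Ip; apply: vp; split=> [|y py]; first exact: Ih.
apply: VU; apply: contrapT => /IV/(_ p Ip)/eqP; exact/negP.
Qed.

Lemma near_true x P : (forall y, P y) -> near x P.
Proof. by move=> HP; exists setT; split=> //; apply: open_setT. Qed.

Lemma near_and x P Q : near x P -> near x Q -> near x (fun y => P y /\ Q y).
Proof.
move=> [U [oU Ux UP]] [V [oV Vx VQ]]; exists (U `&` V); split=> //.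
  exact: open_setI.
by move=> y [/UP ? /VQ].
Qed.

Lemma near_and_mono x P Q (S : X -> Prop) :
  (forall y, P y -> Q y -> S y) -> near x P -> near x Q -> near x S.
Proof.
by move=> PQS nP nQ; apply: near_mono (near_and nP nQ) => y []; apply: PQS.
Qed.

Lemma near_all (T : finType) x (P : T -> X -> Prop) :
  (forall i, near x (P i)) -> near x (fun y => forall i, P i y).
Proof.
move=> nP; suff H (r : seq T) : near x (fun y => forall i, i \in r -> P i y).
  by apply: near_mono (H (enum T)) => y Py i; apply: Py; rewrite mem_enum.
elim: r => [|i r IHr]; first exact: near_true.
apply: near_and_mono (nP i) IHr => y Pi Pr j.
by rewrite inE => /predU1P[->|/Pr].
Qed.

Lemma regular_near_eq x f g :
  regf x f -> near x (fun y => f y = g y) -> regf x g.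
Proof.
have [[N [h [_ _ _ _ hr]]] _ _ _] := HX.
move=> /hr[d [p [q [pd qd E]]]] fg; apply/hr; exists d, p, q; split=> //.
by apply: near_and_mono E fg => y [q0 ->] <-.
Qed.

Lemma regular_near x f : regf x f -> near x (fun y => regf y f).
Proof.
have [[N [h [_ _ _ _ hr]]] _ _ _] := HX.
move=> /hr[d [p [q [pd qd E]]]]; apply: near_mono (near_near E) => y Ey.
by apply/hr; exists d, p, q.
Qed.

Lemma regular_cst x (c : C) : regf x (fun=> c).
Proof.
have [[N [h [_ _ _ _ hr]]] _ _ _] := HX; apply/hr.
exists 0%N, c%:MP, 1; split.
- by rewrite -[c%:MP]mulr1 mul_mpolyC dhomogZ ?dhomog1.
- exact: dhomog1.
- by apply: near_true => y; rewrite meval1 mevalC divr1 oner_eq0.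
Qed.

Lemma regularD x f g : regf x f -> regf x g -> regf x (fun y => f y + g y).
Proof.
have [[N [h [_ _ _ _ hr]]] _ _ _] := HX.
move=> /hr[d [p [q [pd qd E]]]] /hr[d' [p' [q' [pd' qd' E']]]]; apply/hr.
exists (d + d')%N, (p * q' + p' * q), (q * q'); split.
- by apply: rpredD; [|rewrite addnC]; apply: dhomogM.
- exact: dhomogM.
- apply: near_and_mono E E' => y [q0 ->] [q0' ->].
  by rewrite mevalD !mevalM addf_div ?mulf_neq0 // [p'.@[_] * _]mulrC.
Qed.

Lemma regularM x f g : regf x f -> regf x g -> regf x (fun y => f y * g y).
Proof.
have [[N [h [_ _ _ _ hr]]] _ _ _] := HX.
move=> /hr[d [p [q [pd qd E]]]] /hr[d' [p' [q' [pd' qd' E']]]]; apply/hr.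
exists (d + d')%N, (p * p'), (q * q'); split; try exact: dhomogM.
apply: near_and_mono E E' => y [q0 ->] [q0' ->].
by rewrite !mevalM mulf_neq0 // mulf_div.
Qed.

Lemma regularN x f : regf x f -> regf x (fun y => - f y).
Proof.
move=> rf; apply: regular_near_eq (regularM (regular_cst x (-1)) rf) _.
by apply: near_true => y; rewrite mulN1r.
Qed.

Lemma regularB x f g : regf x f -> regf x g -> regf x (fun y => f y - g y).
Proof. by move=> rf rg; apply: regularD => //; apply: regularN. Qed.

Lemma regular_sum x (T : Type) (r : seq T) (F : T -> X -> C) :
  (forall i, regf x (F i)) -> regf x (fun y => \sum_(i <- r) F i y).
Proof.
move=> rF; elim: r => [|i r IHr].
  apply: regular_near_eq (regular_cst x 0) _.
  by apply: near_true => y; rewrite big_nil.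
apply: regular_near_eq (regularD (rF i) IHr) _.
by apply: near_true => y; rewrite big_cons.
Qed.

Lemma regular_prod x (T : Type) (r : seq T) (P : pred T) (F : T -> X -> C) :
  (forall i, regf x (F i)) -> regf x (fun y => \prod_(i <- r | P i) F i y).
Proof.
move=> rF; elim: r => [|i r IHr].
  apply: regular_near_eq (regular_cst x 1) _.
  by apply: near_true => y; rewrite big_nil.
have [Pi|nPi] := boolP (P i).
  apply: regular_near_eq (regularM (rF i) IHr) _.
  by apply: near_true => y; rewrite big_cons Pi.
apply: regular_near_eq IHr _.
by apply: near_true => y; rewrite big_cons (negPf nPi).
Qed.

Lemma regularX x f k : regf x f -> regf x (fun y => f y ^+ k).
Proof.
move=> rf; elim: k => [|k IHk]; first exact: regular_cst.
by apply: regular_near_eq (regularM rf IHk) _; apply: near_true => y; rewrite exprS.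
Qed.

Lemma near_neq0 x f : regf x f -> f x != 0 -> near x (fun y => f y != 0).
Proof.
have [[N [h [_ _ _ ho hr]]] _ _ _] := HX.
move=> /hr[d [p [q [pd qd E]]]] f0.
have np : near x (fun y => p.@[h y] != 0).
  exists [set y | p.@[h y] != 0]; split=> //=.
    apply/ho; exists [set p] => [_ ->|y]; first by exists d.
    split=> [/negP/negPn/eqP py _ -> //|/(_ p erefl) /= ->].
    by rewrite eqxx.
  by apply: contra_neq f0 => p0; have [_ ->] := near_self E; rewrite p0 mul0r.
by apply: near_and_mono E np => y [q0 ->] p0; rewrite mulf_neq0 ?invr_eq0.
Qed.

Lemma regularV x f : regf x f -> f x != 0 -> regf x (fun y => (f y)^-1).
Proof.
move=> rf f0; have nf := near_neq0 rf f0.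
have [[N [h [_ _ _ _ hr]]] _ _ _] := HX.
move: rf => /hr[d [p [q [pd qd E]]]]; apply/hr; exists d, q, p; split=> //.
apply: near_and_mono E nf => y [q0 ->]; rewrite mulf_eq0 negb_or => /andP[p0 _].
by rewrite invf_div.
Qed.

Lemma open_meet (U V : set X) x y :
  opn X U -> opn X V -> U x -> V y -> exists z, U z /\ V z.
Proof.
have [_ [_ _ irr] _ _] := HX; move=> oU oV Ux Vy; apply: contrapT => noz.
have clC (W : set X) : opn X W -> closed_set (~` W).
  by move=> oW; rewrite /closed_set setCK.
have [||z _|/(_ x I)|/(_ y I)] // := irr (~` U) (~` V); try exact: clC.
have [Uz|] := pselect (U z); last by left.
by right=> Vz; apply: noz; exists z.
Qed.

(** This makes the local ring a domain: otherwise the loci where [f] and [g] are non-zero in a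
    common neighbourhood are non-empty and open, and meet by irreducibility. *)
Lemma near_mul_eq0 x f g : regf x f -> regf x g ->
  near x (fun y => f y * g y = 0) ->
  near x (fun y => f y = 0) \/ near x (fun y => g y = 0).
Proof.
move=> rf rg fg0; apply: contrapT => nn.
have [[U [oU Ux UP]] [V [oV Vx VP]]] := (regular_near rf, regular_near rg).
have [W [oW Wx WP]] := fg0.
pose D f := [set y | (U `&` V `&` W) y /\ f y != 0].
have oUVW : opn X (U `&` V `&` W) by do !apply: open_setI.
have oD f' : (forall y, (U `&` V `&` W) y -> regf y f') -> opn X (D f').
  move=> rf'; apply: open_near => y [Uy fy0].
  apply: near_and_mono (near_open oUVW Uy) (near_neq0 (rf' y Uy) fy0).
  by move=> z Uz fz; split.
have neD f' : ~ near x (fun y => f' y = 0) -> exists y, D f' y.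
  move=> nf; apply: contrapT => noy; apply: nf; exists (U `&` V `&` W); split=> //.
  by move=> y Uy; apply/eqP; apply: contrapT => /negP f0; apply: noy; exists y.
have [y Dy] : exists y, D f y by apply: neD => fe; apply: nn; left.
have [z Dz] : exists y, D g y by apply: neD => ge; apply: nn; right.
have oDf : opn X (D f) by apply: oD => t [[/UP]].
have oDg : opn X (D g) by apply: oD => t [[_ /VP]].
have [t [[[_ Wt] ft] [_ gt]]] := open_meet oDf oDg Dy Dz.
by have /eqP := WP t Wt; rewrite mulf_eq0 (negPf ft) (negPf gt).
Qed.

End RegularFunctions.

(** * Triangularization over a valuation ring *)

Section Triangularization.
Variable R : idomainType.

(** The form in which a discrete valuation ring with uniformizer [t] enters the linear algebra. *)
Definition powers_generate (t : R) :=
  forall f : R, f != 0 -> exists k u, u \is a GRing.unit /\ f = u * t ^+ k.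

Lemma char_poly_conj n (G A B : 'M[R]_n) :
  G \in unitmx -> G *m A = B *m G -> char_poly A = char_poly B.
Proof.
move=> Gu GA; have GX : map_mx polyC G *m char_poly_mx A =
    char_poly_mx B *m map_mx polyC G.
  by rewrite mulmxBr mulmxBl -!map_mxM GA scalar_mxC.
have nzG : \det (map_mx polyC G) != 0.
  rewrite det_map_mx polyC_eq0; apply: contraTneq Gu => G0.
  by rewrite unitmxE G0 unitr0.
by apply: (mulfI nzG); rewrite -det_mulmx GX det_mulmx mulrC.
Qed.

Lemma char_poly_lblock n1 n2 (A : 'M[R]_n1) (C : 'M[R]_(n2, n1)) (D : 'M[R]_n2) :
  char_poly (block_mx A 0 C D) = char_poly A * char_poly D.
Proof.
rewrite /char_poly /char_poly_mx map_block_mx scalar_mx_block opp_block_mx.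
by rewrite add_block_mx map_mx0 subr0 det_lblock.
Qed.

(** The factor [c] is the lowest power of [t] occurring in a non-zero entry; after division by it,
    that entry is a unit. *)
Lemma primitive_multiple (t : R) n (v : 'rV[R]_n) :
  powers_generate t -> v != 0 ->
  exists c w j, [/\ c != 0, v = c *: w & w 0 j \is a GRing.unit].
Proof.
move=> tP nzv.
have [i0 vi0] : exists i, v 0 i != 0.
  apply/existsP; apply: contraNT nzv => /existsPn v0.
  by apply/eqP/rowP => i; rewrite mxE; apply/eqP/negPn/v0.
pose has_order i k := exists2 u, u \is a GRing.unit & v 0 i = u * t ^+ k.
have exk : exists k, `[< exists i, has_order i k >].
  by have [k [u [uu vk]]] := tP _ vi0; exists k; apply/asboolP; exists i0, u.
have [k /asboolP[j [u uu vj]] kmin] := ex_minnP exk.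
have exw i : exists x, v 0 i = t ^+ k * x.
  have [->|/tP[l [u' [uu' vi]]]] := eqVneq (v 0 i) 0; first by exists 0; rewrite mulr0.
  have le_kl : (k <= l)%N by apply: kmin; apply/asboolP; exists i, u'.
  by exists (u' * t ^+ (l - k)); rewrite vi mulrCA -exprD subnKC.
have [w wP] := choice exw.
have nzt : t ^+ k != 0.
  have vj0 : v 0 j != 0 -> t ^+ k != 0 by rewrite vj mulf_eq0 negb_or => /andP[].
  apply: contraNneq vi0 => t0; by rewrite wP t0 mul0r.
exists (t ^+ k), (\row_i w i), j; split=> //.
  by apply/rowP => i; rewrite !mxE wP.
by rewrite mxE; suff -> : w j = u by []; apply: (mulfI nzt); rewrite -wP vj mulrC.
Qed.

(** Vectors are rows, hence [T] is lower triangular. The root [a 0] yields the eigenvector, and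
    cancelling its factor leaves the characteristic polynomial of the complementary block, to which
    induction applies. *)
Lemma triangularization (t : R) n (A : 'M[R]_n) (a : 'I_n -> R) :
  powers_generate t -> char_poly A = \prod_(i < n) ('X - (a i)%:P) ->
  exists G T : 'M[R]_n, [/\ G \in unitmx, G *m A = T *m G,
    forall i, T i i = a i & forall i j : 'I_n, (i < j)%N -> T i j = 0].
Proof.
move=> tP; elim: n => [|n IHn] in A a *.
  by move=> _; exists 1%:M, A; rewrite unitmx1 mul1mx mulmx1; split=> // - [].
move=> chA.
have [v [j [vA vj]]] : exists (v : 'rV[R]_n.+1) j, v *m A = a 0 *: v /\ v 0 j \is a GRing.unit.
  have /det0P[v nzv vA] : \det ((a 0)%:M - A) == 0.
    have -> : \det ((a 0)%:M - A) = (char_poly A).[a 0].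
      rewrite /char_poly -[_.[_]]/(horner_eval _ _) -det_map_mx; congr (\det _).
      apply/matrixP => i k; rewrite !mxE /= /horner_eval.
      by rewrite hornerD hornerN hornerC hornerMn hornerX.
    by rewrite chA horner_prod (bigD1 0) //= hornerXsubC subrr mul0r.
  have [c [w [j [nzc vw wj]]]] := primitive_multiple tP nzv.
  exists w, j; split=> //; apply/rowP => i; apply: (mulfI nzc).
  have : c *: (w *m A) = c *: (a 0 *: w).
    rewrite scalemxAl -vw scalerA mulrC -scalerA -vw.
    by apply/eqP; rewrite eq_sym -subr_eq0 -mul_mx_scalar -mulmxBr vA.
  by move/rowP/(_ i); rewrite !mxE.
(* Exchanging the columns [0] and [j] brings the unit entry of [v] to the corner of a block
   triangular matrix; undoing the exchange gives an invertible [G0] with first row [v]. *)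
pose P : 'M[R]_(1 + n) := tperm_mx 0 j.
pose v' : 'M[R]_(1, 1 + n) := xcol 0 j v.
pose G0 : 'M[R]_(1 + n) := block_mx (lsubmx v') (rsubmx v') 0 1%:M *m P.
pose e : 'M[R]_(1, 1 + n) := row_mx 1%:M 0.
have eG0 : e *m G0 = v.
  rewrite mulmxA mul_row_block !mul1mx !mul0mx !addr0 hsubmxK /v' xcolE -mulmxA.
  by rewrite -perm_mxM tperm2 perm_mx1 mulmx1.
have G0u : G0 \in unitmx.
  rewrite unitmx_mul unitmx_perm andbT unitmxE det_ublock det1 mulr1 det_mx11.
  by rewrite !mxE lshift0 tpermL.
pose B : 'M[R]_(1 + n) := G0 *m A *m invmx G0.
have eB : e *m B = a 0 *: e.
  by rewrite /B mulmxA [e *m (_ *m A)]mulmxA eG0 vA -scalemxAl -eG0 mulmxK.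
have BE : B = block_mx (a 0)%:M 0 (dlsubmx B) (drsubmx B).
  have : usubmx B = row_mx (a 0)%:M 0.
    rewrite -[LHS]mul1mx -[LHS]addr0 -(mul0mx _ (dsubmx B)) -mul_row_col vsubmxK.
    by rewrite eB scale_row_mx scaler0 scale_scalar_mx mulr1.
  by rewrite -{2}[B]vsubmxK => ->; rewrite -[dsubmx B]hsubmxK -block_mxEv.
have GB : G0 *m A = B *m G0 by rewrite mulmxKV.
have chD : char_poly (drsubmx B) = \prod_(i < n) ('X - (a (lift 0 i))%:P).
  have := char_poly_conj G0u GB; rewrite chA {1}BE char_poly_lblock big_ord_recl.
  have -> : char_poly ((a 0)%:M : 'M[R]_1) = 'X - (a 0)%:P :> {poly R}.
    by rewrite /char_poly det_mx11 !mxE mulr1n.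
  by move/(mulfI (monic_neq0 (monicXsubC _))) => ->.
have [G1 [T1 [G1u GT1 T1d T1t]]] := IHn _ _ chD.
pose G : 'M[R]_(1 + n) := block_mx 1%:M 0 0 G1.
pose T : 'M[R]_(1 + n) := block_mx (a 0)%:M 0 (G1 *m dlsubmx B) T1.
have Gu : G \in unitmx by rewrite unitmxE det_lblock det1 mul1r -unitmxE.
have GBT : G *m B = T *m G.
  rewrite {1}BE /G /T !mulmx_block.
  by rewrite !mul1mx !mulmx1 !mul0mx !mulmx0 !addr0 !add0r GT1.
have Tul k k' : T (lshift n k) (lshift n k') = a 0.
  by rewrite block_mxEul !ord1 mxE eqxx.
have Tur k k' : T (lshift n k) (rshift 1 k') = 0 by rewrite block_mxEur mxE.
have Tdr k k' : T (rshift 1 k) (rshift 1 k') = T1 k k' by rewrite block_mxEdr.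
exists (G *m G0), T; split.
- rewrite unitmx_mul G0u andbT; exact: Gu.
- by rewrite -mulmxA GB mulmxA [RHS]mulmxA; congr (_ *m _); apply: GBT.
- move=> i; case: (split_ordP (i : 'I_(1 + n))) => k ->.
    by rewrite (Tul k k) ord1 lshift0.
  by rewrite (Tdr k k) T1d; congr a; apply: val_inj.
- move=> i k; case: (split_ordP (i : 'I_(1 + n))) => i' ->;
    case: (split_ordP (k : 'I_(1 + n))) => k' -> lt_ik.
  + by rewrite !ord1 ltnn in lt_ik.
  + exact: Tur.
  + by move: lt_ik; rewrite /= ord1.
  + by rewrite (Tdr i' k') T1t.
Qed.

End Triangularization.

(** * The local ring at a point *)

Section Germs.
Variables (C : fieldType) (X : fspace C).
Hypothesis HX : smooth_projective_curve X.
Variable x : X.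
Implicit Types f g : X -> C.

(** A chosen representative, depending only on the class of [f]: equality of germs becomes equality
    of functions, and germs form a type without a quotient. *)
Definition germ_repr f : X -> C := xget (fun=> 0) (fun g => near x (fun y => f y = g y)).

Lemma germ_reprP f : near x (fun y => f y = germ_repr f y).
Proof.
have /xgetPex : exists g, near x (fun y => f y = g y).
  by exists f; apply: near_true.
exact.
Qed.

Lemma germ_repr_eq f g : near x (fun y => f y = g y) -> germ_repr f = germ_repr g.
Proof.
move=> fg; congr (xget _ _); apply/funext => h; apply/propext.
by split=> nh; apply: (near_and_mono HX) fg nh => y ->.
Qed.

(* The unused argument makes the instances below depend on the type only. *)
Record germ_at (H : smooth_projective_curve X) := Germ {
  germ_val :> X -> C;
  germ_regular : regf x germ_val;
  germ_valK : germ_repr germ_val = germ_val }.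

Local Notation germ := (germ_at HX).

Lemma germ_eq (a b : germ) : near x (fun y => a y = b y) -> a = b.
Proof.
case: a b => [f rf fK] [g rg gK] /= /germ_repr_eq; rewrite fK gK => fg.
by case: _ / fg in rg gK *; congr (Germ HX); apply: Prop_irrelevance.
Qed.

Lemma germ_of_regular f (rf : regf x f) : regf x (germ_repr f).
Proof. by apply: (regular_near_eq HX) rf (germ_reprP f). Qed.

Lemma germ_of_reprK f : germ_repr (germ_repr f) = germ_repr f.
Proof. by apply/esym/germ_repr_eq/germ_reprP. Qed.

Definition germ_of f (rf : regf x f) : germ :=
  Germ HX (germ_of_regular rf) (germ_of_reprK f).

Lemma near_germ_of f (rf : regf x f) : near x (fun y => germ_of rf y = f y).
Proof. by apply: near_mono (germ_reprP f) => y ->. Qed.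

Definition germ0 := germ_of (regular_cst HX x 0).
Definition germ1 := germ_of (regular_cst HX x 1).
Definition germ_opp (a : germ) := germ_of (regularN HX (germ_regular a)).
Definition germ_add (a b : germ) :=
  germ_of (regularD HX (germ_regular a) (germ_regular b)).
Definition germ_mul (a b : germ) :=
  germ_of (regularM HX (germ_regular a) (germ_regular b)).
Definition germ_unit (a : germ) := a x != 0.
Definition germ_inv (a : germ) : germ :=
  match pselect (a x != 0) with
  | left ax => germ_of (regularV HX (germ_regular a) ax)
  | right _ => a
  end.

HB.instance Definition _ := gen_eqMixin germ.
HB.instance Definition _ := gen_choiceMixin germ.

Let nadd a b : near x (fun y => germ_add a b y = a y + b y).
Proof. exact: near_germ_of. Qed.
Let nmul a b : near x (fun y => germ_mul a b y = a y * b y).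
Proof. exact: near_germ_of. Qed.
Let nopp a : near x (fun y => germ_opp a y = - a y).
Proof. exact: near_germ_of. Qed.
Let n0 : near x (fun y => germ0 y = 0).
Proof. exact: near_germ_of. Qed.
Let n1 : near x (fun y => germ1 y = 1).
Proof. exact: near_germ_of. Qed.

Lemma germ_addA : associative germ_add.
Proof.
move=> a b c; apply: germ_eq.
apply: (near_and_mono HX) (near_and HX (nadd a (germ_add b c)) (nadd b c))
  (near_and HX (nadd (germ_add a b) c) (nadd a b)) => y [-> ->] [-> ->].
exact: addrA.
Qed.

Lemma germ_addC : commutative germ_add.
Proof.
move=> a b; apply: germ_eq; apply: (near_and_mono HX) (nadd a b) (nadd b a).
by move=> y -> ->; apply: addrC.
Qed.

Lemma germ_add0 : left_id germ0 germ_add.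
Proof.
move=> a; apply: germ_eq; apply: (near_and_mono HX) (nadd germ0 a) n0.
by move=> y -> ->; apply: add0r.
Qed.

Lemma germ_addN : left_inverse germ0 germ_opp germ_add.
Proof.
move=> a; apply: germ_eq.
apply: (near_and_mono HX) (near_and HX (nadd (germ_opp a) a) (nopp a)) n0.
by move=> y [-> ->] ->; apply: addNr.
Qed.

HB.instance Definition _ :=
  GRing.isZmodule.Build germ germ_addA germ_addC germ_add0 germ_addN.

Lemma germ_mulA : associative germ_mul.
Proof.
move=> a b c; apply: germ_eq.
apply: (near_and_mono HX) (near_and HX (nmul a (germ_mul b c)) (nmul b c))
  (near_and HX (nmul (germ_mul a b) c) (nmul a b)) => y [-> ->] [-> ->].
exact: mulrA.
Qed.

Lemma germ_mulC : commutative germ_mul.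
Proof.
move=> a b; apply: germ_eq; apply: (near_and_mono HX) (nmul a b) (nmul b a).
by move=> y -> ->; apply: mulrC.
Qed.

Lemma germ_mul1 : left_id germ1 germ_mul.
Proof.
move=> a; apply: germ_eq; apply: (near_and_mono HX) (nmul germ1 a) n1.
by move=> y -> ->; apply: mul1r.
Qed.

Lemma germ_mulDl : left_distributive germ_mul germ_add.
Proof.
move=> a b c; apply: germ_eq.
apply: (near_and_mono HX) (near_and HX (nmul (germ_add a b) c) (nadd a b))
  (near_and HX (nadd (germ_mul a c) (germ_mul b c))
     (near_and HX (nmul a c) (nmul b c))) => y [-> ->] [-> [-> ->]].
exact: mulrDl.
Qed.

Lemma germ_neq1_0 : germ1 != 0.
Proof.
apply/eqP => e10; have := near_self n1; rewrite e10 (near_self n0).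
by move/eqP; rewrite eq_sym oner_eq0.
Qed.

HB.instance Definition _ := GRing.Zmodule_isComNzRing.Build germ
  germ_mulA germ_mulC germ_mul1 germ_mulDl germ_neq1_0.

Lemma germ_mulV : {in germ_unit, left_inverse 1 germ_inv *%R}.
Proof.
move=> a; rewrite unfold_in /germ_unit => ax; rewrite /germ_inv.
case: pselect => // ax'; set b := germ_of _; apply: germ_eq.
have nb : near x (fun y => b y = (a y)^-1) by apply: near_germ_of.
have na := near_neq0 HX (germ_regular a) ax.
apply: (near_and_mono HX) (near_and HX (nmul b a) nb) (near_and HX n1 na).
by move=> y [-> ->] [-> ay]; rewrite mulVf.
Qed.

Lemma germ_unitPl (a b : germ) : b * a = 1 -> germ_unit a.
Proof.
move=> ba; have := near_self (nmul b a); rewrite -[germ_mul b a]/(b * a) ba.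
rewrite (near_self n1) => e; rewrite /germ_unit.
by apply: contra_eq_neq e => ->; rewrite mulr0 oner_eq0.
Qed.

Lemma germ_inv_out : {in [predC germ_unit], germ_inv =1 id}.
Proof.
move=> a; rewrite inE /= unfold_in /germ_unit => na; rewrite /germ_inv.
by case: pselect => // ax; rewrite ax in na.
Qed.

HB.instance Definition _ := GRing.ComNzRing_hasMulInverse.Build germ
  germ_mulV germ_unitPl germ_inv_out.

Lemma germ_integral (a b : germ) : a * b = 0 -> (a == 0) || (b == 0).
Proof.
move=> ab.
have : near x (fun y => a y * b y = 0).
  apply: (near_and_mono HX) (nmul a b) n0 => y <-.
  by rewrite -[germ_mul a b]/(a * b) ab.
case/(near_mul_eq0 HX (germ_regular a) (germ_regular b)) => e0; apply/orP.
  by left; apply/eqP/germ_eq; apply: (near_and_mono HX) e0 n0 => y -> ->.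
by right; apply/eqP/germ_eq; apply: (near_and_mono HX) e0 n0 => y -> ->.
Qed.

HB.instance Definition _ := GRing.ComUnitRing_isIntegral.Build germ germ_integral.

Lemma near_germD (a b : germ) : near x (fun y => (a + b) y = a y + b y).
Proof. exact: nadd. Qed.

Lemma near_germM (a b : germ) : near x (fun y => (a * b) y = a y * b y).
Proof. exact: nmul. Qed.

Lemma near_germN (a : germ) : near x (fun y => (- a) y = - a y).
Proof. exact: nopp. Qed.

Lemma near_germ0 : near x (fun y => (0 : germ) y = 0).
Proof. exact: n0. Qed.

Lemma near_germ1 : near x (fun y => (1 : germ) y = 1).
Proof. exact: n1. Qed.

Lemma near_germB (a b : germ) : near x (fun y => (a - b) y = a y - b y).
Proof.
by apply: (near_and_mono HX) (near_germD a (- b)) (near_germN b) => y -> ->.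
Qed.

Lemma near_germ_sum (T : Type) (r : seq T) (F : T -> germ) :
  near x (fun y => (\sum_(i <- r) F i) y = \sum_(i <- r) F i y).
Proof.
elim: r => [|i r IHr].
  by rewrite big_nil; apply: near_mono near_germ0 => y ->; rewrite big_nil.
rewrite big_cons; apply: (near_and_mono HX) (near_germD (F i) (\sum_(j <- r) F j)) IHr.
by move=> y -> ->; rewrite big_cons.
Qed.

Lemma near_germ_prod (T : Type) (r : seq T) (F : T -> germ) :
  near x (fun y => (\prod_(i <- r) F i) y = \prod_(i <- r) F i y).
Proof.
elim: r => [|i r IHr].
  by rewrite big_nil; apply: near_mono near_germ1 => y ->; rewrite big_nil.
rewrite big_cons; apply: (near_and_mono HX) (near_germM (F i) (\prod_(j <- r) F j)) IHr.
by move=> y -> ->; rewrite big_cons.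
Qed.

Lemma near_germX (a : germ) k : near x (fun y => (a ^+ k) y = a y ^+ k).
Proof.
elim: k => [|k IHk]; first exact: near_germ1.
rewrite exprS; apply: (near_and_mono HX) (near_germM a (a ^+ k)) IHk.
by move=> y -> ->; rewrite exprS.
Qed.

Lemma germ_unitE (a : germ) : (a \is a GRing.unit) = (a x != 0).
Proof. by []. Qed.

(* The neighbourhood may depend on the coefficient. *)
Definition represents (p : {poly germ}) (P : X -> {poly C}) :=
  forall i, near x (fun y => p`_i y = (P y)`_i).

Lemma represents_inj p q P : represents p P -> represents q P -> p = q.
Proof.
move=> pP qP; apply/polyP => i; apply: germ_eq.
by apply: (near_and_mono HX) (pP i) (qP i) => y -> ->.
Qed.

Lemma represents_polyC (a : germ) : represents a%:P (fun y => (a y)%:P).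
Proof.
move=> i; rewrite coefC; case: eqP => [->|/eqP/negPf i0].
  by apply: (near_true HX) => y; rewrite coefC eqxx.
by apply: near_mono near_germ0 => y; rewrite coefC i0.
Qed.

Lemma represents0 : represents 0 (fun=> 0).
Proof. by move=> i; rewrite coef0; apply: near_mono near_germ0 => y ->; rewrite coef0. Qed.

Lemma represents1 : represents 1 (fun=> 1).
Proof.
move=> i; apply: (near_and_mono HX) (represents_polyC 1 i) near_germ1 => y.
by rewrite polyC1 => -> ->; rewrite polyC1.
Qed.

Lemma representsX : represents 'X (fun=> 'X).
Proof.
move=> i; rewrite coefX; case: eqP => [->|/eqP/negPf i1].
  by apply: near_mono near_germ1 => y ->; rewrite coefX eqxx.
by apply: near_mono near_germ0 => y ->; rewrite coefX i1.
Qed.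

Lemma representsD p q P Q : represents p P -> represents q Q ->
  represents (p + q) (fun y => P y + Q y).
Proof.
move=> pP qQ i; rewrite coefD.
apply: (near_and_mono HX) (near_germD p`_i q`_i)
  (near_and HX (pP i) (qQ i)).
by move=> y -> [-> ->]; rewrite coefD.
Qed.

Lemma representsN p P : represents p P -> represents (- p) (fun y => - P y).
Proof.
move=> pP i; rewrite coefN; apply: (near_and_mono HX) (near_germN p`_i) (pP i).
by move=> y -> ->; rewrite coefN.
Qed.

Lemma representsM p q P Q : represents p P -> represents q Q ->
  represents (p * q) (fun y => P y * Q y).
Proof.
move=> pP qQ i; rewrite coefM.
have nP : near x (fun y => forall j : 'I_i.+1, (p`_j * q`_(i - j)) y =
    (P y)`_j * (Q y)`_(i - j)).
  apply: (near_all HX) => j; apply: (near_and_mono HX) (near_germM p`_j q`_(i - j))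
    (near_and HX (pP j) (qQ (i - j)%N)).
  by move=> y -> [-> ->].
apply: (near_and_mono HX) (near_germ_sum (index_enum _) (fun j : 'I_i.+1 => p`_j * q`_(i - j))) nP.
move=> y -> Py; by rewrite coefM; apply: eq_bigr.
Qed.

Lemma represents_sum (T : Type) (r : seq T) (p : T -> {poly germ}) P :
  (forall i, represents (p i) (P i)) ->
  represents (\sum_(i <- r) p i) (fun y => \sum_(i <- r) P i y).
Proof.
move=> pP; elim: r => [|j r IHr] i.
  by rewrite big_nil; apply: near_mono (represents0 i) => y ->; rewrite big_nil.
rewrite big_cons; apply: near_mono (representsD (pP j) IHr i) => y ->.
by rewrite big_cons.
Qed.

Lemma represents_prod (T : Type) (r : seq T) (p : T -> {poly germ}) P :
  (forall i, represents (p i) (P i)) ->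
  represents (\prod_(i <- r) p i) (fun y => \prod_(i <- r) P i y).
Proof.
move=> pP; elim: r => [|j r IHr] i.
  by rewrite big_nil; apply: near_mono (represents1 i) => y ->; rewrite big_nil.
rewrite big_cons; apply: near_mono (representsM (pP j) IHr i) => y ->.
by rewrite big_cons.
Qed.

Lemma represents_XsubC (a : germ) : represents ('X - a%:P) (fun y => 'X - (a y)%:P).
Proof. exact: representsD representsX (representsN (represents_polyC a)). Qed.

Definition germ_mx m n (y : X) (A : 'M[germ]_(m, n)) : 'M[C]_(m, n) :=
  map_mx (fun a : germ => a y) A.

(** Evaluation of representatives at a point [y] other than [x] is not a ring morphism, since sums
    and products agree only on neighbourhoods depending on the germs. The determinant is therefore
    expanded and followed term by term. *)
Lemma represents_char_poly n (A : 'M[germ]_n) :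
  represents (char_poly A) (fun y => char_poly (germ_mx y A)).
Proof.
apply: represents_sum => s; apply: representsM.
  case: (odd_perm s); last by rewrite expr0; apply: represents1.
  by rewrite expr1; apply: representsN represents1.
apply: represents_prod => i; rewrite !mxE.
have repX : represents ('X *+ (i == s i)) (fun=> 'X *+ (i == s i)).
  by case: (i == s i); [apply: representsX | apply: represents0].
move=> k; apply: near_mono (representsD repX (representsN (represents_polyC (A i (s i)))) k).
by move=> y ->; rewrite !mxE.
Qed.

Lemma near_germ_mxM m n p (A : 'M[germ]_(m, n)) (B : 'M[germ]_(n, p)) :
  near x (fun y => germ_mx y (A *m B) = germ_mx y A *m germ_mx y B).
Proof.
have nAB : near x (fun y => forall ij, germ_mx y (A *m B) ij.1 ij.2 =
    (germ_mx y A *m germ_mx y B) ij.1 ij.2).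
  apply: (near_all HX) => -[i j] /=.
  have nM : near x (fun y => forall k, (A i k * B k j) y = A i k y * B k j y).
    by apply: (near_all HX) => k; apply: near_germM.
  apply: (near_and_mono HX) 
    (near_germ_sum (index_enum _) (fun k => A i k * B k j)) nM => y sE My.
  by rewrite [LHS]mxE !mxE sE; apply: eq_bigr => k _; rewrite My !mxE.
by apply: near_mono nAB => y Ey; apply/matrixP => i j; apply: (Ey (i, j)).
Qed.

Lemma near_germ_mx1 n : near x (fun y => germ_mx y (1%:M : 'M[germ]_n) = 1%:M).
Proof.
apply: (near_and_mono HX) near_germ0 near_germ1 => y e0 e1.
by apply/matrixP => i j; rewrite !mxE; case: (i == j).
Qed.

End Germs.

(** * The local ring at a point is a valuation ring *)

Lemma meval_homog (C : fieldType) n d (p : {mpoly C[n]}) (c : C) (v : 'I_n -> C) :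
  p \is d.-homog -> p.@[fun i => c * v i] = c ^+ d * p.@[v].
Proof.
move=> /dhomogP pd; rewrite !mevalE mulr_sumr; apply: eq_big_seq => m /pd /= <-.
rewrite mulrCA; congr (_ * _); rewrite mdegE -[RHS]/(_ ^+ (\sum_i m i) * _).
rewrite (big_morph _ (exprD c) (expr0 c)) -big_split /=.
by apply: eq_bigr => i _; rewrite exprMn.
Qed.

Section Valuation.
Variables (C : fieldType) (X : fspace C).
Hypothesis HX : smooth_projective_curve X.
Variable x : X.
Local Notation germ := (germ_at x HX).

(* Otherwise some [f != 0] is divisible by all powers of the uniformizer [t],
   say [f = g k * t ^+ k].  Polynomials in local affine coordinates whose germ is
   a multiple of [g k] form an increasing sequence of ideals; once it
   stabilises, [g k.+1] is a multiple of [g k = g k.+1 * t], so it vanishes. *)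
Lemma germ_powers_generate : exists t : germ, powers_generate t.
Proof.
have [[N [h [hnz _ _ ho hr]]] _ _ /(_ x)[t0 [rt0 t00 t0gen]]] := HX.
pose t : germ := germ_of HX rt0.
have nt : near x (fun y => t y = t0 y) by apply: near_germ_of.
have divt (a : germ) : exists b : germ, a x = 0 -> a = b * t.
  have [a0|na] := pselect (a x = 0); last by exists 0.
  have [g rg ag] := t0gen a (germ_regular a) a0.
  exists (germ_of HX rg) => _; apply: germ_eq.
  apply: (near_and_mono HX) (near_and HX ag nt)
    (near_and HX (near_germM (germ_of HX rg) t) (near_germ_of HX rg)).
  by move=> y [-> e] [-> ->]; rewrite e.
have [c cP] := choice divt.
exists t => f nzf; apply: contrapT => norepr.
pose g k : germ := iter k c f.
have fg k : f = g k * t ^+ k /\ g k x = 0.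
  (* A quotient of [f] by a power of [t] that does not vanish at [x] would be a unit and give the
     excluded factorization; so division by [t] never stops. *)
  have zero a l : f = a * t ^+ l -> a x = 0.
    move=> fa; apply/eqP; apply: contrapT => /negP ax; apply: norepr.
    by exists l, a; rewrite germ_unitE.
  elim: k => [|k [fk gk]]; first by split; [|apply: (zero _ 0%N)]; rewrite expr0 mulr1.
  have fk1 : f = g k.+1 * t ^+ k.+1 by rewrite exprS mulrA -cP.
  by split=> //; apply: zero fk1.
have gS k : g k = g k.+1 * t by apply/cP; have [] := fg k.
have [i0 hi0] := hnz x.
(* Affine coordinates in the chart where the homogeneous coordinate [i0] does not vanish. *)
pose u i y := (h y i0)^-1 * h y i.
have homogX i : ('X_i : {mpoly C[N.+1]}) \is 1.-homog by rewrite dhomogX /= mdeg1.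
have near_i0 : near x (fun y => h y i0 != 0).
  exists (fun y => h y i0 != 0); split=> //; apply/ho.
  exists (fun p => p = 'X_i0) => [_ ->|y]; first by exists 1%N.
  split=> [/negP/negPn/eqP e _ ->|/(_ _ erefl)]; rewrite mevalXU // => ->.
  by rewrite eqxx.
have ru i : regf x (u i).
  apply/hr; exists 1%N, 'X_i, 'X_i0; split=> //.
  by apply: near_mono near_i0 => y y0; rewrite !mevalXU mulrC.
have rp (p : {mpoly C[N.+1]}) : regf x (fun y => p.@[u ^~ y]).
  under eq_fun => y do rewrite mevalE.
  apply: (regular_sum HX) => m; apply: (regularM HX); first exact: regular_cst.
  by apply: (regular_prod HX) => i; apply: regularX.
pose gp (p : {mpoly C[N.+1]}) : germ := germ_of HX (rp p).
have gpP p : near x (fun y => gp p y = p.@[u ^~ y]) by apply: near_germ_of.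
have gpD p q : gp (p + q) = gp p + gp q.
  apply: germ_eq; apply: (near_and_mono HX) (near_germD (gp p) (gp q))
    (near_and HX (gpP (p + q)) (near_and HX (gpP p) (gpP q))).
  by move=> y -> [-> [-> ->]]; rewrite mevalD.
have gpM p q : gp (p * q) = gp p * gp q.
  apply: germ_eq; apply: (near_and_mono HX) (near_germM (gp p) (gp q))
    (near_and HX (gpP (p * q)) (near_and HX (gpP p) (gpP q))).
  by move=> y -> [-> [-> ->]]; rewrite mevalM.
pose I k p := exists a, gp p = a * g k.
have [k Ik] : exists k, forall p, I k.+1 p -> I k p.
  apply: mpoly_acc => k.
  - by move=> p [a pa]; exists (a * t); rewrite pa (gS k) -mulrA [t * _]mulrC.
  - exists 0; rewrite mul0r; apply: germ_eq.
    apply: (near_and_mono HX) (gpP 0) (near_germ0 HX x) => y -> ->.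
    by rewrite meval0.
  - by move=> p q [a pa] [b qb]; exists (a + b); rewrite gpD pa qb mulrDl.
  - by move=> p q [a qa]; exists (gp p * a); rewrite gpM qa mulrA.
(* Near [x], [g k.+1] is a quotient of forms of the same degree. Passing to affine coordinates
   scales both by the same factor, so [p] belongs to [I k.+1], and [gp q] is a unit. *)
have [d [p [q [pd qd gpq]]]] := (hr _ _).1 (germ_regular (g k.+1)).
have scale (r : {mpoly C[N.+1]}) : r \is d.-homog ->
    forall y, r.@[u ^~ y] = (h y i0)^-1 ^+ d * r.@[h y].
  by move=> rd y; apply: meval_homog.
have gpq' : gp p = gp q * g k.+1.
  apply: germ_eq; apply: (near_and_mono HX) (near_germM (gp q) (g k.+1))
    (near_and HX gpq (near_and HX (gpP p) (gpP q))).
  move=> y -> [[q0 ->] [-> ->]]; rewrite !scale // -mulrA; congr (_ * _).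
  by rewrite mulrC divfK.
have uq : gp q \is a GRing.unit.
  rewrite germ_unitE (near_self (gpP q)) scale // mulf_neq0 ?expf_neq0 ?invr_eq0 //.
  by have [] := near_self gpq.
have [a gpa] : I k p by apply: Ik; exists (gp q).
(* The first factor takes the value 1 at [x] because [t] vanishes there, so it is non-zero, as is
   [g k.+1]: this contradicts integrality. *)
have : (1 - (gp q)^-1 * a * t) * g k.+1 = 0.
  rewrite mulrBl mul1r -!mulrA [t * _]mulrC -gS -gpa gpq' mulKr // subrr //.
have nzg : g k.+1 != 0.
  by apply: contraNneq nzf => g0; have [-> _] := fg k.+1; rewrite g0 mul0r.
move/eqP; rewrite mulf_eq0 (negPf nzg) orbF => /eqP e0.
have := near_self (near_germB 1 ((gp q)^-1 * a * t)); rewrite e0.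
rewrite (near_self (near_germ0 HX x)) (near_self (near_germ1 HX x)).
rewrite (near_self (near_germM _ t)) (near_self nt) t00 mulr0 subr0.
by move/eqP; rewrite eq_sym oner_eq0.
Qed.

End Valuation.

(** * Frames of line bundles *)

Arguments regs {C X} v x _.

Definition spans1 (C : fieldType) (V : vectType C) (m : V) :=
  m != 0 /\ forall v : V, exists c : C, v = c *: m.

Section Hom1.
Variables (C : fieldType) (V W : vectType C).
Implicit Types (m v : V) (n : W).

(* Only meaningful when [m] spans [V]. *)
Definition hom1 m n : 'Hom(V, W) := linfun (fun v => coord [tuple m] 0 v *: n).

Lemma hom1E m n (c : C) : m != 0 -> hom1 m n (c *: m) = c *: n.
Proof.
move=> nzm; rewrite /hom1; set f := (f in linfun f).
have flin : linear f by move=> b u1 u2; rewrite /f linearP /= scalerDl scalerA.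
pose l := GRing.isLinear.Build _ _ _ _ f flin.
pose F : {linear V -> W} := HB.pack f l.
rewrite (lfunE F) /= /f linearZ /= -scalerA.
have fm : free [tuple m] by rewrite seq1_free.
by rewrite -{2}[m]/([tuple m]`_0) (coord_free 0 0 fm) eqxx scale1r.
Qed.

Lemma hom1_eq m (f g : 'Hom(V, W)) : spans1 m -> f m = g m -> f = g.
Proof. by move=> [_ sm] fg; apply/lfunP => v; have [c ->] := sm v; rewrite !linearZ /= fg. Qed.

Lemma hom1_gen m n : m != 0 -> hom1 m n m = n.
Proof. by move=> nzm; rewrite -{2}[m]scale1r hom1E // scale1r. Qed.

Lemma spans1_hom m n : spans1 m -> spans1 n -> spans1 (hom1 m n).
Proof.
move=> sm [nzn sn]; have [nzm _] := sm; split.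
  by apply: contra_neq nzn => h0; rewrite -(hom1_gen n nzm) h0 lfunE.
move=> f; have [c fm] := sn (f m); exists c.
by apply: (hom1_eq sm); rewrite fm lfunE /= hom1_gen.
Qed.

End Hom1.

(** A tensor product is a space of maps from a dual, and [v] (x) [w] sends the covector dual to [w]
    to [v]. Frames of tensor products thus reduce to frames of Hom bundles. *)
Lemma tensv_hom1 (C : fieldType) (V W : vectType C) (v : V) (w : W) :
  spans1 w -> tensv v w = hom1 (hom1 w (1 : C^o)) v.
Proof.
move=> sw; have [nzw _] := sw; have s1 : spans1 (1 : C^o).
  by split=> [|c]; [apply: oner_neq0 | exists c; rewrite /= [RHS]mulr1].
have sh := spans1_hom sw s1; apply: (hom1_eq sh).
by rewrite hom1_gen ?tensvE ?hom1_gen ?scale1r //; have [] := sh.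
Qed.

Section LineFrames.
Variable C : fieldType.

(** Stated over an arbitrary space because it is also used for [L] on the spectral curve, to which
    the facts about smooth curves do not apply. *)
Definition line_frame (X : fspace C) (E : vfamily X) (x : X) (m : vsection E) :=
  near x (fun y => spans1 (m y) /\ forall s : vsection E,
    regs E y s <-> exists2 a : X -> C, regf y a & near y (fun z => s z = a z *: m z)).

Lemma line_frame_near (X : fspace C) (E : vfamily X) (x : X) (m : vsection E) :
  line_frame x m -> near x (fun y => line_frame y m).
Proof. exact: near_near. Qed.

Lemma line_frame_regs (X : fspace C) (E : vfamily X) (x : X) (m s : vsection E) :
  line_frame x m ->
  regs E x s <-> exists2 a : X -> C, regf x a & near x (fun z => s z = a z *: m z).
Proof. by move=> /near_self[]. Qed.

Lemma line_frame_spans (X : fspace C) (E : vfamily X) (x : X) (m : vsection E) :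
  line_frame x m -> spans1 (m x).
Proof. by move=> /near_self[]. Qed.

Lemma local_frame1 (X : fspace C) (E : vfamily X) (x : X) (e : 'I_1 -> vsection E) :
  local_frame x e -> line_frame x (e 0).
Proof.
apply: near_mono => y [be ry].
have te : [tuple e i y | i < 1] = [tuple e 0 y].
  by apply: eq_from_tnth => i; rewrite !tnth_mktuple !(tnth_nth 0) ord1.
rewrite te in be; split; last first.
  move=> s; split=> [/ry[a ra sa]|[a ra sa]].
    by exists (a 0) => //; apply: near_mono sa => z ->; rewrite big_ord1.
  by apply/ry; exists (fun=> a) => //; apply: near_mono sa => z ->; rewrite big_ord1.
have fe := basis_free be; split; first by rewrite seq1_free in fe.
move=> v; exists (coord [tuple e 0 y] 0 v).
by rewrite {1}(coord_basis be (memvf v)) big_ord1.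
Qed.

Variable X : fspace C.
Hypothesis HX : smooth_projective_curve X.
Implicit Types (E F : vfamily X) (x : X).

Lemma line_frame_eq E x (m m' : vsection E) :
  line_frame x m -> near x (fun y => m y = m' y) -> line_frame x m'.
Proof.
move=> fm /near_near mm'; apply: (near_and_mono HX) fm mm' => y [sy ry] my.
split=> [|s]; first by rewrite -(near_self my).
by split=> [/ry[a ra sa]|[a ra sa]]; [|apply/ry]; exists a => //;
  apply: (near_and_mono HX) sa my => z -> ->.
Qed.

Lemma line_frame_scale E x (c : X -> C) (m : vsection E) :
  regf x c -> c x != 0 -> line_frame x m -> line_frame x (fun y => c y *: m y).
Proof.
move=> rc cx fm; have nc := near_near (near_neq0 HX rc cx).
apply: (near_and_mono HX) (near_and HX (regular_near HX rc) nc) fm.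
move=> y [rcy ncy] [[nzm sm] ry]; have cy := near_self ncy; split=> [|s].
  split=> [|v]; first by rewrite scaler_eq0 negb_or cy.
  by have [b ->] := sm v; exists (b / c y); rewrite scalerA divfK.
split=> [/ry[a ra sa]|[a ra sa]]; last first.
  apply/ry; exists (fun z => a z * c z); first exact: regularM.
  by apply: near_mono sa => z ->; rewrite scalerA.
exists (fun z => a z / c z); first by apply: (regularM HX) => //; apply: regularV.
by apply: (near_and_mono HX) sa ncy => z -> cz; rewrite scalerA divfK.
Qed.

Lemma line_frame_regular E x (m : vsection E) : line_frame x m -> regs E x m.
Proof.
move=> fm; apply/(line_frame_regs _ fm); exists (fun=> 1); first exact: regular_cst.
by apply: (near_true HX) => y; rewrite scale1r.
Qed.

Lemma line_frame_hom E F x (m : vsection E) (n : vsection F) :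
  line_frame x m -> line_frame x n ->
  line_frame x ((fun y => hom1 (m y) (n y)) : vsection (bhom E F)).
Proof.
move=> fm fn.
apply: (near_and_mono HX) (line_frame_near fm) (line_frame_near fn) => y fmy fny.
have sm := line_frame_spans fmy; have sn := line_frame_spans fny.
split=> [|A]; first exact: spans1_hom.
split=> [rA|[a ra Aa] s /(line_frame_regs _ fmy)[b rb sb]].
  have /(line_frame_regs _ fny)[a ra Aa] := rA m (line_frame_regular fmy).
  exists a => //; apply: (near_and_mono HX) Aa fmy => z Az [smz _].
  by apply: (hom1_eq smz); rewrite Az lfunE /= hom1_gen //; case: smz.
apply/(line_frame_regs _ fny); exists (fun z => b z * a z); first exact: regularM.
apply: (near_and_mono HX) (near_and HX Aa sb) fmy => z [-> ->] [[nzm _] _].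
by rewrite lfunE /= linearZ /= hom1_gen // !scalerA mulrC.
Qed.

Lemma line_frame_trivial x : line_frame x ((fun=> 1) : vsection (trivial_line X)).
Proof.
apply: (near_true HX) => y; split.
  by split=> [|c]; [apply: oner_neq0 | exists c; rewrite /= [RHS]mulr1].
move=> s; split=> [rs|[a ra sa]].
  by exists s => //; apply: (near_true HX) => z; rewrite [RHS]mulr1.
by apply: (regular_near_eq HX) ra _; apply: near_mono sa => z ->; rewrite [RHS]mulr1.
Qed.

Lemma line_frame_tens E F x (m : vsection E) (n : vsection F) :
  line_frame x m -> line_frame x n ->
  line_frame x ((fun y => tensv (m y) (n y)) : vsection (btens E F)).
Proof.
move=> fm fn; have fd := line_frame_hom fn (line_frame_trivial x).
apply: line_frame_eq (line_frame_hom fd fm) _.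
by apply: near_mono fn => y [sn _]; rewrite tensv_hom1.
Qed.

Lemma line_frame_pow E x (k : vsection E) d :
  line_frame x k -> line_frame x ((fun y => vpow (k y) d) : vsection (btpow E d)).
Proof.
move=> fk; elim: d => [|d IHd] /=; first exact: line_frame_trivial.
exact: (line_frame_tens IHd fk).
Qed.

(** The power [mu ^ d] as a functional on the tensor power: every factor is contracted with [mu]. *)
Fixpoint covec_pow E x (mu : 'Hom(E x, C^o)) d : 'Hom(btpow E d x, C^o) :=
  match d return 'Hom(btpow E d x, C^o) with
  | d'.+1 => linfun (fun T : 'Hom('Hom(E x, C^o), btpow E d' x) =>
               covec_pow mu d' (T mu))
  | 0 => \1%VF
  end.

Lemma covec_powS E x (mu : 'Hom(E x, C^o)) d
    (T : 'Hom('Hom(E x, C^o), btpow E d x)) :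
  covec_pow mu d.+1 T = covec_pow mu d (T mu).
Proof.
rewrite [covec_pow mu d.+1]/=; set f := (f in linfun f).
have flin : linear f by move=> b u1 u2; rewrite /f lfunE /= lfunE /= linearP.
pose l := GRing.isLinear.Build _ _ _ _ f flin.
pose F : {linear _ -> _} := HB.pack f l.
by rewrite (lfunE F).
Qed.

Lemma covec_powZ E x (c : C) (mu : 'Hom(E x, C^o)) d :
  covec_pow (c *: mu) d = c ^+ d *: covec_pow mu d.
Proof.
elim: d => [|d IHd]; first by rewrite expr0 scale1r.
apply/lfunP => T; rewrite covec_powS IHd linearZ !lfunE /= covec_powS.
by rewrite linearZ /= scalerA -exprSr.
Qed.

Lemma covec_pow_vpow E x (mu : 'Hom(E x, C^o)) (w : E x) d :
  covec_pow mu d (vpow w d) = (mu w : C) ^+ d.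
Proof.
elim: d => [|d IHd]; first by rewrite lfunE.
by rewrite covec_powS /= tensvE linearZ /= IHd exprS.
Qed.

Lemma line_frame_covec_pow E x (k : vsection E) d :
  line_frame x k ->
  line_frame x ((fun y => covec_pow (hom1 (k y) (1 : C^o)) d) : vsection (bdual (btpow E d))).
Proof.
move=> fk; have fp := line_frame_pow d fk.
apply: line_frame_eq (line_frame_hom fp (line_frame_trivial x)) _.
apply: (near_and_mono HX) fk fp => y [[nzk _] _] [sp _]; apply: (hom1_eq sp).
rewrite hom1_gen; last by case: sp.
by rewrite covec_pow_vpow hom1_gen // expr1n.
Qed.

(* [kap mu] plays the role of [mu ^ d] in [K ^ (- d)]. *)
Lemma negative_power_frame (K : vfamily X) (d : nat) :
  exists kap : forall x, 'Hom(K x, C^o) -> bzpow K (- d%:Z) x,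
    (forall x (c : C) mu, kap x (c *: mu) = c ^+ d *: kap x mu) /\
    forall x (k : vsection K), line_frame x k ->
      line_frame x ((fun y => kap y (hom1 (k y) (1 : C^o))) : vsection (bzpow K (- d%:Z))).
Proof.
(* For [d = 0] the exponent is non-negative and [bzpow] is the trivial line bundle, not the dual of
   a tensor power. *)
case: d => [|d].
  rewrite oppr0; exists (fun x mu => (1 : C)); split=> [x c mu|x k fk].
    by rewrite expr0 scale1r.
  exact: line_frame_trivial.
rewrite -NegzE; exists (fun x mu => covec_pow mu d.+1); split=> [x c mu|x k fk].
  exact: covec_powZ.
exact: line_frame_covec_pow.
Qed.

End LineFrames.

(** * Endomorphisms triangular in a basis *)

Section Flags.
Variables (C : fieldType) (V : vectType C) (n : nat) (e : n.-tuple V).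
Hypothesis be : basis_of {:V} e.
Implicit Types (v : V) (c : C).

Definition flag m : {vspace V} := <<take m e>>%VS.

Lemma flag_gen (i : 'I_n) m : (i < m)%N -> e`_i \in flag m.
Proof.
move=> lt_im; rewrite memv_span // -(nth_take _ lt_im) mem_nth //.
by rewrite size_take_min size_tuple leq_min lt_im ltn_ord.
Qed.

Lemma flagP v m :
  reflect (forall j : 'I_n, (m <= j)%N -> coord e j v = 0) (v \in flag m).
Proof.
apply: (iffP idP) => [vf j le_mj|v0].
  rewrite (coord_span (X := in_tuple (take m e)) vf) linear_sum big1 // => i _.
  have lt_im : (i < m)%N.
    by apply: leq_trans (ltn_ord i) _; rewrite size_take_min geq_minl.
  have lt_in : (i < n)%N := ltn_trans lt_im (leq_ltn_trans le_mj (ltn_ord j)).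
  rewrite linearZ /= nth_take // -[(i : nat)]/(nat_of_ord (Ordinal lt_in)).
  rewrite (coord_free _ _ (basis_free be)) -val_eqE /=.
  by rewrite ltn_eqF ?mulr0 // (leq_trans lt_im).
rewrite (coord_basis be (memvf v)); apply: memv_suml => i _.
have [lt_im|/v0->] := ltnP i m; last by rewrite scale0r mem0v.
by rewrite memvZ // flag_gen.
Qed.

Lemma flag_mono m m' : (m <= m')%N -> (flag m <= flag m')%VS.
Proof.
move=> le_mm; apply/subvP => v /flagP v0; apply/flagP => j le_mj.
by apply: v0; apply: leq_trans le_mj.
Qed.

Lemma flag0 : flag 0 = 0%VS.
Proof. by rewrite /flag take0 span_nil. Qed.

Lemma flag_full : flag n = {:V}%VS.
Proof. by rewrite /flag take_oversize ?size_tuple // (span_basis be). Qed.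

Lemma flag_basis m (le_mn : (m <= n)%N) :
  basis_of (flag m) [tuple tnth e (widen_ord le_mn i) | i < m].
Proof.
suff -> : [tuple tnth e (widen_ord le_mn i) | i < m] = take m e :> seq V.
  rewrite /basis_of eqxx /=; have := basis_free be.
  by rewrite -{1}(cat_take_drop m e) => /catl_free.
apply: (@eq_from_nth _ 0); first by rewrite size_tuple size_takel ?size_tuple.
rewrite size_tuple => i lt_im; rewrite nth_take //.
by rewrite (nth_map (Ordinal lt_im)) ?size_enum_ord // (tnth_nth 0) /= nth_enum_ord.
Qed.

Lemma dim_flag m : (m <= n)%N -> \dim (flag m) = m.
Proof. by move=> le_mn; have /vector.size_basis := flag_basis le_mn. Qed.

(** The product of the [N - c], the last entry of [l] acting first. On a prefix of the diagonal each
    factor then lowers the flag by one step. *)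
Definition shift (N : 'End(V)) (l : seq C) v := foldr (fun c w => N w - c *: w) v l.

Variables (N : 'End(V)) (a : 'I_n -> C).

Definition triangular_on :=
  forall i : 'I_n, N e`_i - a i *: e`_i \in flag i.

Hypothesis tri : triangular_on.

Lemma triangular_step (i : 'I_n) v : v \in flag i.+1 -> N v - a i *: v \in flag i.
Proof.
move=> /flagP v0; rewrite (coord_basis be (memvf v)) linear_sum /= scaler_sumr -sumrB.
apply: memv_suml => k _; rewrite linearZ /= scalerA [_ * coord _ _ _]mulrC -scalerA -scalerBr.
have [lt_ik|le_ki] := ltnP i k; first by rewrite v0 // scale0r mem0v.
apply: memvZ; have [->|ne_ki] := eqVneq k i; first exact: tri.
have lt_ki : (k < i)%N by rewrite ltn_neqAle le_ki andbT.
rewrite -[N _](subrK (a k *: e`_k)) -addrA -scalerBl rpredD //.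
  exact: subvP (flag_mono (ltnW lt_ki)) _ (tri k).
by rewrite memvZ // flag_gen.
Qed.

Lemma flag_stable m c v : v \in flag m -> N v - c *: v \in flag m.
Proof.
move=> /flagP v0; rewrite (coord_basis be (memvf v)) linear_sum /= scaler_sumr -sumrB.
apply: memv_suml => k _; rewrite linearZ /= scalerA [_ * coord _ _ _]mulrC -scalerA -scalerBr.
have [le_mk|lt_km] := leqP m k; first by rewrite v0 // scale0r mem0v.
rewrite memvZ // rpredB ?memvZ ?flag_gen //.
rewrite -[N _](subrK (a k *: e`_k)) rpredD ?memvZ ?flag_gen //.
exact: subvP (flag_mono (ltnW lt_km)) _ (tri k).
Qed.

Lemma shift_flag l m v : v \in flag m -> shift N l v \in flag m.
Proof. by move=> vm; elim: l => //= c l IHl; apply: flag_stable. Qed.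

Definition prefix i := [seq a k | k <- take i (enum 'I_n)].

Lemma prefixS (i : 'I_n) : prefix i.+1 = rcons (prefix i) (a i).
Proof.
by rewrite /prefix (take_nth i) ?size_enum_ord // map_rcons nth_ord_enum.
Qed.

Lemma shift_prefix0 m v : (m <= n)%N -> v \in flag m -> shift N (prefix m) v = 0.
Proof.
elim: m v => [|m IHm] v lt_mn vm.
  by rewrite flag0 memv0 in vm; rewrite /prefix take0 /= (eqP vm).
rewrite (prefixS (Ordinal lt_mn)) /shift foldr_rcons; apply: IHm; first exact: ltnW.
exact: (@triangular_step (Ordinal lt_mn)).
Qed.

(** On the quotient of [flag j.+1] by [flag j], the endomorphism [N] is multiplication by [a j]. *)
Lemma coord_shift (j : 'I_n) l v : v \in flag j.+1 ->
  coord e j (shift N l v) = (\prod_(c <- l) (a j - c)) * coord e j v.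
Proof.
move=> vj; elim: l => [|c l IHl]; first by rewrite big_nil mul1r.
rewrite big_cons -mulrA -IHl /=; set w := shift N l v.
have wj : w \in flag j.+1 by apply: shift_flag.
have /flagP/(_ j (leqnn j)) := triangular_step wj.
rewrite !linearB !linearZ /= => /eqP; rewrite subr_eq0 => /eqP ->.
by rewrite -mulrBl.
Qed.

(** Descending induction on the flag containing [v]: its top coordinate, of index [j] at least [m],
    is multiplied by the product of the [a j - a k], [k < m], which is non-zero. Only the
    eigenvalues on either side of [m] need to be separated. *)
Lemma shift_prefix_inj m v :
  (forall j k : 'I_n, (k < m)%N -> (m <= j)%N -> a j != a k) ->
  shift N (prefix m) v = 0 -> v \in flag m.
Proof.
move=> adist v0; suff H d : v \in flag (m + d) -> v \in flag m.
  by apply: (H n); apply/flagP => j; rewrite leqNgt ltn_addl.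
elim: d => [|d IHd]; rewrite ?addn0 // addnS => vf; apply: IHd.
have [lt_n|le_n] := ltnP (m + d) n; last first.
  by apply/flagP => j; rewrite leqNgt (leq_trans (ltn_ord j)).
pose j := Ordinal lt_n; apply/flagP => k le_k.
have [->|ne_kj] := eqVneq k j; last first.
  by apply: (flagP _ _ vf); rewrite ltn_neqAle le_k andbT eq_sym -val_eqE in ne_kj *.
have := @coord_shift j (prefix m) v vf; rewrite v0 linear0 => /esym/eqP.
rewrite mulf_eq0 => /orP[|/eqP//]; rewrite big_map prodf_seq_eq0.
move=> /hasP[i ik /= aij]; have lt_im : (i < m)%N.
  by move: ik; rewrite in_take ?mem_enum // index_enum_ord.
by move: aij; rewrite subr_eq0 (negPf (adist j i lt_im _)) // leq_addr.
Qed.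

End Flags.

(** * The Higgs field in a local frame *)

Section Frames.
Variables (C : fieldType) (X : fspace C).
Hypothesis HX : smooth_projective_curve X.
Implicit Types (x : X) (E : vfamily X).

Lemma local_frame_regs E n x (e : 'I_n -> vsection E) (s : vsection E) :
  local_frame x e -> regs E x s <->
  exists2 a : 'I_n -> X -> C, (forall i, regf x (a i)) &
    near x (fun z => s z = \sum_(i < n) a i z *: e i z).
Proof. by move=> /near_self[]. Qed.

Lemma local_frame_near E n x (e : 'I_n -> vsection E) :
  local_frame x e -> near x (fun y => local_frame y e).
Proof. exact: near_near. Qed.

Lemma local_frame_regular E n x (e : 'I_n -> vsection E) i :
  local_frame x e -> regs E x (e i).
Proof.
move=> fe; apply/(local_frame_regs _ fe).
exists (fun j _ => (j == i)%:R) => [j|]; first exact: regular_cst.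
apply: (near_true HX) => y; rewrite (bigD1 i) //= eqxx scale1r big1 ?addr0 //.
by move=> j /negPf->; rewrite scale0r.
Qed.

Lemma regs_near_eq E n x (s s' : vsection E) : vector_bundle n E ->
  regs E x s -> near x (fun y => s y = s' y) -> regs E x s'.
Proof.
move=> /(_ x)[e fe] /(local_frame_regs _ fe)[a ra sa] ss'.
apply/(local_frame_regs _ fe); exists a => //.
by apply: (near_and_mono HX) sa ss' => y <-.
Qed.

Lemma sum_change_frame (V : vectType C) m n (b : 'I_m -> C) (G : 'I_m -> 'I_n -> C)
    (e : 'I_n -> V) :
  \sum_i b i *: (\sum_j G i j *: e j) = \sum_j (\sum_i b i * G i j) *: e j.
Proof.
under eq_bigr do rewrite scaler_sumr.
rewrite exchange_big; apply: eq_bigr => j _; rewrite scaler_suml.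
by apply: eq_bigr => i _; rewrite scalerA.
Qed.

(** Invertibility over the local ring suffices: near [x] the inverse matrix of germs is the inverse
    at every point, and its entries are regular there. *)
Lemma change_frame E n x (e : 'I_n -> vsection E) (G : 'M[germ_at x HX]_n) :
  local_frame x e -> G \in unitmx ->
  local_frame x ((fun i y => \sum_j G i j y *: e j y) : 'I_n -> vsection E).
Proof.
move=> fe Gu; pose H := invmx G.
have nreg (M : 'M[germ_at x HX]_n) : near x (fun y => forall ij, regf y (M ij.1 ij.2)).
  by apply: (near_all HX) => ij; apply: (regular_near HX); apply: germ_regular.
have GH : near x (fun y => germ_mx y G *m germ_mx y H = 1%:M).
  apply: (near_and_mono HX) (near_germ_mxM G H) (near_germ_mx1 HX x n) => y <-.
  by rewrite mulmxV.
apply: (near_and_mono HX) (near_and HX (near_near fe) (near_near GH))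
  (near_and HX (nreg G) (nreg H)) => y [fey nGH] [rG rH].
have inv z : germ_mx z G *m germ_mx z H = 1%:M -> forall i,
    e i z = \sum_j germ_mx z H i j *: (\sum_k germ_mx z G j k *: e k z).
  move=> /mulmx1C HG i; rewrite (sum_change_frame (germ_mx z H i)).
  transitivity (\sum_j (1%:M : 'M[C]_n) i j *: e j z).
    rewrite (bigD1 i) //= mxE eqxx scale1r big1 ?addr0 // => j /negPf ji.
    by rewrite mxE eq_sym ji scale0r.
  by rewrite -HG; apply: eq_bigr => j _; rewrite mxE.
have [be ry] := near_self fey; split; last first.
  move=> s; split=> [/ry[a ra sa]|[a ra sa]].
    exists (fun j z => \sum_i a i z * H i j z) => [j|].
      by apply: (regular_sum HX) => i; apply: regularM => //; apply: (rH (i, j)).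
    apply: (near_and_mono HX) sa nGH => z -> /inv ez.
    rewrite -(sum_change_frame (a^~ z)); apply: eq_bigr => i _; congr (_ *: _).
    rewrite {1}ez; apply: eq_bigr => j _; rewrite mxE; congr (_ *: _).
    by apply: eq_bigr => k _; rewrite mxE.
  apply/ry; exists (fun j z => \sum_i a i z * G i j z) => [j|].
    by apply: (regular_sum HX) => i; apply: regularM => //; apply: (rG (i, j)).
  by apply: near_mono sa => z ->; rewrite -(sum_change_frame (a^~ z)).
rewrite basisEdim size_tuple (vector.size_basis be) leqnn andbT.
rewrite -(span_basis be); apply/span_subvP => _ /mapP[i _ ->].
rewrite (inv _ (near_self nGH)); apply: memv_suml => j _; rewrite memvZ //.
apply: memv_span; apply/mapP; exists j; rewrite ?mem_enum //.
by apply: eq_bigr => k _; rewrite mxE.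
Qed.

Lemma tensvZl (V W : vectType C) (c : C) (v : V) (w : W) :
  tensv (c *: v) w = c *: tensv v w.
Proof. by apply/lfunP => mu; rewrite tensvE lfunE /= tensvE !scalerA mulrC. Qed.

Lemma tensvZr (V W : vectType C) (c : C) (v : V) (w : W) :
  tensv v (c *: w) = c *: tensv v w.
Proof. by apply/lfunP => mu; rewrite tensvE lfunE /= tensvE linearZ /= scalerA. Qed.

Lemma coef_lead_prod_XsubC (cs : seq C) :
  (\prod_(c <- cs) ('X - c%:P))`_(size cs) = 1.
Proof.
have /monicP := monic_prod_XsubC cs predT id; rewrite /lead_coef.
by rewrite size_prod_XsubC.
Qed.

(** In the basis [k] of the fibre, the recursion defining [prod_coefs] is multiplication of a
    polynomial by ['X - c a]. *)
Lemma prod_coefsE (K : vfamily X) (s : seq (vsection K)) x (k : K x)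
    (c : vsection K -> C) i :
  (forall a, a x = c a *: k) -> (i <= size s)%N ->
  prod_coefs s i x = (\prod_(a <- s) ('X - (c a)%:P))`_(size s - i) *: vpow k i.
Proof.
move=> cP; elim: s i => [|a s IHs] [|i] //= le_i.
- by rewrite big_nil coef1 scale1r.
- have := coef_lead_prod_XsubC (map c (a :: s)); rewrite size_map big_map => ->.
  by rewrite scale1r.
rewrite (IHs i) // cP tensvZl tensvZr scalerA big_cons mulrBl coefB coefXM coefCM subSS.
have [lt_i|le_s] := ltnP i (size s).
  rewrite (IHs i.+1) // -scalerBl subn_eq0 leqNgt lt_i /=; congr (_ *: _).
  by rewrite subnS [_ * c a]mulrC.
(* In the constant coefficient only the product term survives, as [prod_coefs s] vanishes beyond
   [size s]. *)
have -> : i = size s by apply/eqP; rewrite eqn_leq le_s andbT.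
have -> : prod_coefs s (size s).+1 x = 0 by apply: prod_coefs_oversize.
by rewrite subnn eqxx !sub0r scaleNr [c a * _]mulrC.
Qed.

End Frames.

(** * Frames triangular for a given ordering *)

Lemma char_poly_trmx (R : comNzRingType) n (A : 'M[R]_n) : char_poly A^T = char_poly A.
Proof.
rewrite /char_poly -det_tr; congr (\det _).
by apply/matrixP => i j; rewrite !mxE eq_sym.
Qed.

Lemma hom1_coord (C : fieldType) (V : vectType C) (k : V) (c : C) :
  k != 0 -> hom1 k (1 : C^o) (c *: k) = c.
Proof. by move=> nzk; rewrite hom1E //; apply: mulr1. Qed.

Section Higgs.
Variables (C : fieldType) (X : fspace C).
Hypothesis HX : smooth_projective_curve X.
Variable K : vfamily X.
Hypothesis HK : vector_bundle 1 K.
Variables (n : nat) (alpha : 'I_n -> vsection K).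
Hypothesis alpha_global : forall i, global_section (alpha i).

Lemma canonical_frame (x : X) : exists k : vsection K, line_frame x k.
Proof. by have [e /local_frame1 fe] := HK x; exists (e 0). Qed.

Lemma covector_frame x (k : vsection K) : line_frame x k ->
  line_frame x ((fun y => hom1 (k y) (1 : C^o)) : vsection (bdual K)).
Proof. by move=> fk; apply: (line_frame_hom HX fk (line_frame_trivial HX x)). Qed.

Lemma alpha_germs (x : X) (k : vsection K) : line_frame x k ->
  exists a : 'I_n -> germ_at x HX, near x (fun y => forall j, alpha j y = a j y *: k y).
Proof.
move=> fk; have ex j : exists a : germ_at x HX, near x (fun y => alpha j y = a y *: k y).
  have /(line_frame_regs _ fk)[b rb ab] := alpha_global j x.
  exists (germ_of HX rb); apply: (near_and_mono HX) ab (near_germ_of HX rb).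
  by move=> y -> ->.
by have [a aP] := choice ex; exists a; apply: (near_all HX).
Qed.

Variables (E : vfamily X) (phi : higgs_field K E).
Hypothesis HE : in_hitchin_fibre n (hitchin_point alpha) phi.

Lemma higgs_bundle : vector_bundle n E. Proof. by have [] := HE. Qed.

Lemma higgs_regular x (mu : vsection (bdual K)) (s : vsection E) :
  regs (bdual K) x mu -> regs E x s -> regs E x (fun y => apply_higgs phi (mu y) (s y)).
Proof. by move=> rmu rs; have [_ _ phig _ _] := HE; apply: (phig x mu rmu s rs). Qed.

Lemma higgs_matrix x (e : 'I_n -> vsection E) (k : vsection K) :
  local_frame x e -> line_frame x k ->
  exists A : 'M[germ_at x HX]_n, near x (fun y => forall i,
    apply_higgs phi (hom1 (k y) (1 : C^o)) (e i y) = \sum_j A i j y *: e j y).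
Proof.
move=> fe fk; have ex i : exists A : 'I_n -> germ_at x HX, near x (fun y =>
    apply_higgs phi (hom1 (k y) (1 : C^o)) (e i y) = \sum_j A j y *: e j y).
  have rmu := line_frame_regular HX (covector_frame fk).
  have /(local_frame_regs _ fe)[b rb eb] :=
    higgs_regular rmu (local_frame_regular HX i fe).
  exists (fun j => germ_of HX (rb j)).
  have nb : near x (fun y => forall j, germ_of HX (rb j) y = b j y).
    by apply: (near_all HX) => j; apply: near_germ_of.
  apply: (near_and_mono HX) eb nb => y -> by_.
  by apply: eq_bigr => j _; rewrite by_.
have [A AP] := choice ex; exists (\matrix_(i, j) A i j).
apply: (near_all HX) => i; apply: near_mono (AP i) => y ->.
by apply: eq_bigr => j _; rewrite mxE.
Qed.

(** The Hitchin map gives this equality at each point of a neighbourhood, after division by the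
    non-zero powers of [k y]; it passes to germs because a polynomial over the local ring is
    determined by the polynomials it represents. *)
Lemma higgs_char_poly x (e : 'I_n -> vsection E) (k : vsection K)
    (A : 'M[germ_at x HX]_n) (a : 'I_n -> germ_at x HX) :
  local_frame x e -> line_frame x k ->
  near x (fun y => forall i,
    apply_higgs phi (hom1 (k y) (1 : C^o)) (e i y) = \sum_j A i j y *: e j y) ->
  near x (fun y => forall j, alpha j y = a j y *: k y) ->
  char_poly A = \prod_i ('X - (a i)%:P).
Proof.
move=> fe fk AP aP; apply: represents_inj (represents_char_poly A) _ => i.
have repP := represents_prod (index_enum _) (fun j => represents_XsubC (a j)) i.
apply: (near_and_mono HX) (near_and HX repP fe)
  (near_and HX (near_and HX AP aP) (near_and HX fk (line_frame_pow HX n fk))).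
move=> y [-> [be _]] [[Ay ay] [[sk _] _]].
suff <- : char_poly (germ_mx y A) = \prod_j ('X - (a j y)%:P) by [].
pose N : 'End(E y) := phi y (hom1 (k y) (1 : C^o)).
have phiE : phi y = tensv N (k y).
  have [nzk _] := sk; apply: (hom1_eq (m := hom1 (k y) (1 : C^o))).
    apply: spans1_hom => //; split; first exact: oner_neq0.
    by move=> c; exists c; rewrite /= [RHS]mulr1.
  by rewrite tensvE hom1_gen // scale1r.
have [_ _ _ _ hitchin] := HE.
have {}hitchin := hitchin y [tuple e i y | i < n] (k y) N be phiE.
(* [hitchin_map] puts the images of basis vectors in columns, whereas [A] has them in rows. *)
have mxE : \matrix_(i, j) coord [tuple e i y | i < n] i (N [tuple e i y | i < n]`_j)
    = (germ_mx y A)^T.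
  apply/matrixP => i' j; rewrite !mxE -tnth_nth tnth_mktuple [N _]Ay.
  transitivity (coord [tuple e i y | i < n] i'
      (\sum_l A j l y *: [tuple e i y | i < n]`_l)).
    by congr (coord _ _ _); apply: eq_bigr => l _; rewrite -tnth_nth tnth_mktuple.
  by rewrite coord_sum_free // (basis_free be).
rewrite mxE char_poly_trmx in hitchin.
have prodE : \prod_(b <- [seq alpha i | i <- enum 'I_n])
    ('X - (hom1 (k y) (1 : C^o) (b y) : C)%:P) = \prod_i ('X - (a i y)%:P).
  rewrite big_map big_enum /=; apply: eq_bigr => j _.
  by rewrite ay hom1_coord //; have [] := sk.
have szA : size [seq alpha i | i <- enum 'I_n] = n by rewrite size_map size_enum_ord.
have nzpow m : vpow (k y) m != 0.
  apply/eqP => v0; have := covec_pow_vpow (hom1 (k y) (1 : C^o)) (k y) m.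
  have [nzk _] := sk; rewrite v0 linear0 hom1_gen // expr1n => /esym/eqP.
  by apply/negP; apply: oner_neq0.
apply/polyP => l; have [le_l|lt_l] := leqP l n; last first.
  rewrite !nth_default ?size_char_poly //.
  by rewrite -big_enum size_prod_XsubC size_enum_ord.
have := hitchin (n - l)%N (leq_subr _ _); rewrite subKn //.
rewrite /hitchin_point (prod_coefsE (k := k y) (c := fun b => hom1 (k y) (1 : C^o) (b y))) ?szA ?leq_subr //.
  rewrite prodE subKn // => /eqP; rewrite -subr_eq0 -scalerBl scaler_eq0.
  by rewrite (negPf (nzpow _)) orbF subr_eq0 => /eqP.
by move=> b; have [c ->] := sk.2 (b y); rewrite hom1_coord //; have [] := sk.
Qed.

(** One frame serves all covectors: [K y] is a line, so every [mu] is a multiple of the covector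
    dual to [k y]. *)
Lemma adapted_frame (J : 'S_n) (x : X) :
  exists e : 'I_n -> vsection E, local_frame x e /\
    near x (fun y => forall mu : 'Hom(K y, C^o),
      triangular_on [tuple e i y | i < n] (phi y mu) (fun i => mu (alpha (J i) y))).
Proof.
have [e fe] := higgs_bundle x; have [k fk] := canonical_frame x.
have [A AP] := higgs_matrix fe fk; have [a aP] := alpha_germs fk.
have [t tP] := germ_powers_generate HX x.
(* The roots can be put on the diagonal in any order; this is where the ordering [J] is imposed. *)
have chA : char_poly A = \prod_i ('X - (a (J i))%:P).
  by rewrite (higgs_char_poly fe fk AP aP) (reindex_inj (@perm_inj _ J)).
have [G [T [Gu GA Td Tt]]] := triangularization tP chA.
exists (fun i y => \sum_j G i j y *: e j y); split; first exact: change_frame.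
apply: (near_and_mono HX) (near_and HX AP aP) (near_and HX fk (near_and HX (near_germ0 HX x)
  (near_and HX (near_germ_mxM G A) (near_germ_mxM T G)))).
move=> y [Ay ay] [[sk _] [y0 [GAy TGy]]] mu i.
pose e' := [tuple \sum_j G i j y *: e j y | i < n].
have e'E (j : 'I_n) : e'`_j = \sum_l G j l y *: e l y by rewrite -tnth_nth tnth_mktuple.
have key : phi y (hom1 (k y) (1 : C^o)) e'`_i = \sum_j T i j y *: e'`_j.
  rewrite e'E linear_sum.
  transitivity (\sum_j germ_mx y G i j *: (\sum_l germ_mx y A j l *: e l y)).
    apply: eq_bigr => j _; rewrite linearZ mxE /=; congr (_ *: _).
    by rewrite [LHS]Ay; apply: eq_bigr => l _; rewrite mxE.
  rewrite (sum_change_frame (germ_mx y G i)).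
  transitivity (\sum_j germ_mx y T i j *: (\sum_l germ_mx y G j l *: e l y)).
    rewrite (sum_change_frame (germ_mx y T i)); apply: eq_bigr => l _.
    congr (_ *: _); rewrite -[LHS]/(\sum_j _ i j * _ j l).
    have := congr1 (fun M : 'M_n => M i l) GAy; rewrite GA TGy.
    by rewrite [X in X = _ -> _]mxE [X in _ = X -> _]mxE => ->.
  apply: eq_bigr => j _; rewrite mxE e'E; congr (_ *: _).
  by apply: eq_bigr => l _; rewrite mxE.
have [c ->] : exists c, mu = c *: hom1 (k y) (1 : C^o).
  have [nzk _] := sk; exists (mu (k y)); apply: (hom1_eq sk).
  by rewrite lfunE /= hom1_gen // [RHS]mulr1.
have -> : phi y (c *: hom1 (k y) (1 : C^o)) e'`_i =
    c *: \sum_j T i j y *: e'`_j by rewrite linearZ lfunE /= key.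
have -> : (c *: hom1 (k y) (1 : C^o)) (alpha (J i) y) = c * T i i y.
  by rewrite lfunE /= ay hom1_coord ?Td //; have [] := sk.
rewrite -scalerA -scalerBr memvZ // (bigD1 i) //= addrAC subrr add0r.
apply: memv_suml => j ne_ji; have [lt_ji|lt_ij|/val_inj e_ij] := ltngtP j i.
- apply: memvZ. exact: (@flag_gen _ _ _ e' j i lt_ji).
- by rewrite Tt // y0 scale0r mem0v.
- by rewrite e_ij eqxx in ne_ji.
Qed.

End Higgs.

(** * The filtration *)

Section Filtration.
Variables (C : fieldType) (X : fspace C).
Hypothesis HX : smooth_projective_curve X.
Variable K : vfamily X.
Hypothesis HK : vector_bundle 1 K.

Section Def.
Variables (E : vfamily X) (phi : higgs_field K E).

(* [v] extends to a section of [E] near [x] killed by the product of the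
   [phi - b], [b] in [l]; contracting with a covector [mu] avoids powers of K. *)
Definition killed_value (l : seq (vsection K)) (x : X) (v : E x) :=
  exists s : vsection E, [/\ regs E x s, s x = v &
    near x (fun y => forall mu : 'Hom(K y, C^o),
      shift (phi y mu) [seq (mu (b y) : C) | b <- l] (s y) = 0)].

(** That the killed values form a subspace is only known once a local frame is available. Until then
    [xget], with default [0], names the subspace with these elements, which is unique if it
    exists. *)
Definition kernel_space (l : seq (vsection K)) : subspaces E := fun x =>
  xget 0%VS (fun V : {vspace E x} => forall v, v \in V <-> killed_value l v).

Lemma kernel_spaceE l x (V : {vspace E x}) :
  (forall v, v \in V <-> killed_value l v) -> kernel_space l x = V.
Proof.
move=> VP; have exV : exists W : {vspace E x},
  forall v, v \in W <-> killed_value l v by exists V.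
have kP := xgetPex 0%VS exV.
by apply/vspaceP => v; apply/idP/idP => [/kP/VP|/VP/kP].
Qed.

End Def.

Variables (n : nat) (alpha : 'I_n -> vsection K).
Hypothesis alpha_global : forall i, global_section (alpha i).
Hypothesis alpha_distinct : forall i j, i != j -> exists x, alpha i x <> alpha j x.

(** The locus where the two sections differ is open and non-empty, so by irreducibility it meets
    every neighbourhood of [x]. *)
Lemma alpha_generic (i j : 'I_n) (x : X) :
  i != j -> ~ near x (fun y => alpha i y = alpha j y).
Proof.
move=> /alpha_distinct[z ne_z] [U [oU Ux UP]].
have oV : opn X (fun y => alpha i y <> alpha j y).
  apply: (open_near HX) => y ne_y; have [k fk] := canonical_frame HK y.
  have [a aP] := alpha_germs HX alpha_global fk.
  have nzk := (line_frame_spans fk).1.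
  have ay : a i y - a j y != 0.
    rewrite subr_eq0; apply/eqP => ay; apply: ne_y.
    by rewrite !(near_self aP) ay.
  have rij := regularB HX (germ_regular (a i)) (germ_regular (a j)).
  apply: (near_and_mono HX) (near_neq0 HX rij ay) (near_and HX aP fk).
  move=> w; rewrite subr_eq0 => /eqP ne_w [aw [[nzw _] _]].
  rewrite !aw => /eqP; rewrite -subr_eq0 -scalerBl scaler_eq0 (negPf nzw) orbF subr_eq0.
  by move/eqP.
by have [y [/UP ey]] := open_meet HX oU oV Ux ne_z; apply.
Qed.

Definition order_prefix (J : 'S_n) i := [seq alpha (J k) | k <- take i (enum 'I_n)].

Variables (E : vfamily X) (phi : higgs_field K E).
Hypothesis HE : in_hitchin_fibre n (hitchin_point alpha) phi.

Definition frame_at (e : 'I_n -> vsection E) (y : X) : n.-tuple (E y) :=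
  [tuple e i y | i < n].

Lemma frame_atE (e : 'I_n -> vsection E) (y : X) (i : 'I_n) : (frame_at e y)`_i = e i y.
Proof. by rewrite -tnth_nth tnth_mktuple. Qed.

Lemma coord_frame (e : 'I_n -> vsection E) (y : X) (c : 'I_n -> C) j :
  basis_of {:E y} (frame_at e y) -> coord (frame_at e y) j (\sum_i c i *: e i y) = c j.
Proof.
move=> be; under eq_bigr do rewrite -frame_atE.
by rewrite coord_sum_free // (basis_free be).
Qed.

(** At points where the early eigenvalues are separated from the late ones, a killed section has no
    coordinate of index at least [i]. These points form the non-vanishing locus of a non-zero germ,
    so such a coordinate vanishes near [y], and in particular at [y], even if eigenvalues collide
    there. *)
Lemma killed_value_flag (J : 'S_n) (e : 'I_n -> vsection E) (y : X) i :
  (i <= n)%N -> local_frame y e ->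
  near y (fun z => forall mu : 'Hom(K z, C^o),
    triangular_on (frame_at e z) (phi z mu) (fun j => mu (alpha (J j) z))) ->
  forall v, v \in flag (frame_at e y) i <-> killed_value phi (order_prefix J i) v.
Proof.
move=> le_in fe tri v; have be := (near_self fe).1.
have prefixE z (mu : 'Hom(K z, C^o)) : [seq (mu (b z) : C) | b <- order_prefix J i] =
    prefix (fun j => mu (alpha (J j) z)) i by rewrite -map_comp.
split=> [vf|[s [rs <- sk]]].
  (* The vector is extended with constant coordinates in the frame, which keeps it in the flag. *)
  exists (fun z => \sum_j coord (frame_at e y) j v *: e j z); split.
  - apply/(local_frame_regs _ fe); exists (fun j _ => coord (frame_at e y) j v).
      by move=> j; apply: regular_cst.
    exact: near_true.
  - rewrite {2}(coord_basis be (memvf v)); apply: eq_bigr => j _.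
    by rewrite frame_atE.
  - apply: (near_and_mono HX) tri fe => z triz [bez _] mu.
    rewrite prefixE; apply: (shift_prefix0 bez (triz mu) le_in).
    apply/(flagP bez) => j le_ij; rewrite coord_frame //.
    exact: (flagP be _ _ vf).
have /(local_frame_regs _ fe)[c rc sc] := rs.
apply/(flagP be) => j le_ij; rewrite (near_self sc) coord_frame //.
have [k fk] := canonical_frame HK y.
have [a aP] := alpha_germs HX alpha_global fk.
pose r := [seq p : 'I_n * 'I_n <- index_enum _ | (i <= p.1)%N && (p.2 < i)%N].
(* The product of all differences between a late and an early eigenvalue: it may vanish at [y] but
   is non-zero as a germ. *)
pose D := \prod_(p <- r) (a (J p.1) - a (J p.2)).
have nzD : D != 0.
  rewrite prodf_seq_neq0; apply/allP => -[j1 j2].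
  rewrite mem_filter /= => /andP[/andP[le1 lt2] _].
  rewrite subr_eq0; apply/eqP => a12.
  apply: (@alpha_generic (J j1) (J j2) y).
    by apply: contraTneq lt2 => /perm_inj<-; rewrite -leqNgt.
  by apply: near_mono aP => z az; rewrite !az a12.
pose cj := germ_of HX (rc j).
have ncj : near y (fun z => cj z = c j z) by apply: near_germ_of.
suff : cj * D = 0.
  move/eqP; rewrite mulf_eq0 (negPf nzD) orbF => /eqP cj0.
  by rewrite -(near_self ncj) cj0 (near_self (near_germ0 HX y)).
have nfac : near y (fun z => forall p : 'I_n * 'I_n,
    (a (J p.1) - a (J p.2)) z = a (J p.1) z - a (J p.2) z).
  by apply: (near_all HX) => p; apply: near_germB.
apply: germ_eq; apply: (near_and_mono HX)
  (near_and HX (near_and HX (near_germM cj D) (near_germ0 HX y)) (near_and HX ncj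
    (near_germ_prod r (fun p => a (J p.1) - a (J p.2)))))
  (near_and HX (near_and HX (near_and HX tri fe) (near_and HX sc sk))
    (near_and HX (near_and HX aP fk) nfac)).
move=> z [[-> ->] [-> Dz]] [[[triz [bez _]] [scz skz]] [[az [[nzk _] _]] facz]].
have [->|nzDz] := eqVneq (D z) 0; first by rewrite mulr0.
suff -> : c j z = 0 by rewrite mul0r.
rewrite -(coord_frame (c ^~ z) j bez) -scz.
apply: (flagP bez _ _ _) le_ij; pose mu := hom1 (k z) (1 : C^o).
apply: (shift_prefix_inj bez (triz mu)); last by have := skz mu; rewrite prefixE.
move=> j1 j2 lt2 le1; rewrite !az !hom1_coord // -subr_eq0 -(facz (j1, j2)).
move: nzDz; rewrite Dz prodf_seq_neq0 => /allP/(_ (j1, j2)) /=; apply.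
by rewrite mem_filter /= le1 lt2 mem_index_enum.
Qed.

Lemma filtration_frame (J : 'S_n) (x : X) :
  exists e : 'I_n -> vsection E, [/\ local_frame x e,
    near x (fun y => forall mu : 'Hom(K y, C^o),
      triangular_on (frame_at e y) (phi y mu) (fun i => mu (alpha (J i) y))) &
    near x (fun y => forall i : 'I_n.+1,
      kernel_space phi (order_prefix J i) y = flag (frame_at e y) i)].
Proof.
have [e [fe tri]] := adapted_frame HX HK alpha_global HE J x; exists e; split=> //.
apply: (near_all HX) => i.
apply: (near_and_mono HX) (local_frame_near fe) (near_near tri) => y fey triy.
by apply: kernel_spaceE; apply: killed_value_flag => //; rewrite -ltnS.
Qed.

Lemma kernel_space_subbundle (J : 'S_n) i :
  (i <= n)%N -> is_subbundle i (kernel_space phi (order_prefix J i)).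
Proof.
move=> le_in x; have [e [fe _ Fe]] := filtration_frame J x.
exists (fun j => e (widen_ord le_in j)).
apply: (near_and_mono HX) (local_frame_near fe) Fe => y fey Fy; split.
  by move=> j; apply: (local_frame_regular HX).
rewrite (Fy (Ordinal (le_in : i < n.+1)%N)).
apply: etrans (flag_basis (near_self fey).1 le_in); congr (basis_of _ (tval _)).
by apply: eq_from_tnth => j; rewrite !tnth_mktuple.
Qed.

Lemma higgs_filtration_kernel (J : 'S_n) :
  higgs_filtration n phi (fun i => kernel_space phi (order_prefix J i)).
Proof.
split=> [x|x|i le_in|i lt_in].
- by have [e [fe _ /near_self/(_ ord0) /= ->]] := filtration_frame J x; apply: flag0.
- have [e [fe _ /near_self/(_ ord_max) /= ->]] := filtration_frame J x.
  by apply: flag_full; apply: (near_self fe).1.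
- split; first by exists i; apply: kernel_space_subbundle.
  move=> x mu v; have [e [fe tri Fe]] := filtration_frame J x.
  rewrite (near_self Fe (Ordinal (le_in : i < n.+1)%N)) /= => vf.
  have := flag_stable (near_self fe).1 (near_self tri mu) 0 vf.
  by rewrite scale0r subr0.
- have FS x : exists2 e : 'I_n -> vsection E, local_frame x e &
      kernel_space phi (order_prefix J i) x = flag (frame_at e x) i /\
      kernel_space phi (order_prefix J i.+1) x = flag (frame_at e x) i.+1.
    have [e [fe _ Fe]] := filtration_frame J x; exists e => //.
    have := near_self Fe (Ordinal (ltnW lt_in : i < n.+1)%N).
    by have := near_self Fe (Ordinal (lt_in : i.+1 < n.+1)%N).
  split=> [x|].
    have [e fe [-> ->]] := FS x.
    by apply: flag_mono => //; apply: (near_self fe).1.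
  have [_ [_ [x _] _] _ _] := HX; exists x; have [e fe [-> ->]] := FS x.
  move/(congr1 (fun V : {vspace E x} => \dim V)).
  rewrite !(dim_flag (near_self fe).1) // 1?ltnW // => /eqP.
  by rewrite eqn_leq ltnn andbF.
Qed.

End Filtration.

(** * Quotients of consecutive steps, and invariance under isomorphism *)

Section Graded.
Variables (C : fieldType) (X : fspace C).
Hypothesis HX : smooth_projective_curve X.

Section GrProj.
Variables (E : vfamily X) (F F' : subspaces E) (x : X).
Implicit Types v : E x.

Lemma gr_projD v w : gr_proj F F' (v + w) = gr_proj F F' v + gr_proj F F' w.
Proof. by rewrite /gr_proj !linearD. Qed.

Lemma gr_projZ (c : C) v : gr_proj F F' (c *: v) = c *: gr_proj F F' v.
Proof. by rewrite /gr_proj !linearZ. Qed.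

Lemma addv_pi1_eq0 (V : vectType C) (U W : {vspace V}) (v : V) :
  v \in (U + W)%VS -> (addv_pi1 U W v == 0) = (v \in W).
Proof.
move=> vUW; have pE := addv_pi1_pi2 vUW; apply/idP/idP => [/eqP p0|vW].
  by rewrite -pE p0 add0r memv_pi.
by move: pE; rewrite (addv_pi2_id U vW) => /(canRL (addrK v)) ->; rewrite subrr.
Qed.

Lemma gr_proj_eq0 v : v \in F' x -> (gr_proj F F' v == 0) = (v \in F x).
Proof.
move=> vF'; have vFF : v \in (F' x + F x)%VS by rewrite (subvP (addvSl _ _)).
rewrite -(addv_pi1_eq0 vFF) /gr_proj; apply/eqP/eqP => [p0|->]; last exact: linear0.
have pF : addv_pi1 (F' x) (F x) v \in (F' x :\: F x)%VS by apply: memv_pi.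
by rewrite -(vsprojK pF) p0 linear0.
Qed.

Lemma gr_proj0 v : v \in F x -> gr_proj F F' v = 0.
Proof.
move=> vF; have vFF : v \in (F' x + F x)%VS by rewrite (subvP (addvSr _ _)).
by have := addv_pi1_eq0 vFF; rewrite vF => /eqP p0; rewrite /gr_proj p0 linear0.
Qed.

Lemma gr_proj_eq v w : v - w \in F x -> gr_proj F F' v = gr_proj F F' w.
Proof.
by move=> vw; rewrite -[v](subrK w) gr_projD (gr_proj0 vw) add0r.
Qed.

Lemma gr_proj_val (u : subvs_of (F' x :\: F x)%VS) : gr_proj F F' (vsval u) = u.
Proof.
rewrite /gr_proj /addv_pi1 daddv_pi_id ?capv_diff ?subvsP //.
exact: vsvalK.
Qed.

End GrProj.

Lemma flag_split (V : vectType C) n (e : n.-tuple V) (i : 'I_n) v :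
  basis_of {:V} e -> v \in flag e i.+1 -> v - coord e i v *: e`_i \in flag e i.
Proof.
move=> be /(flagP be) v0; apply/(flagP be) => j le_ij.
rewrite linearB linearZ /= (coord_free _ _ (basis_free be)).
have [->|ne_ij] := eqVneq i j; first by rewrite mulr1 subrr.
by rewrite mulr0 subr0 v0 // ltn_neqAle le_ij andbT; rewrite -val_eqE in ne_ij.
Qed.

Lemma gr_line_frame (E : vfamily X) (n : nat) (F F' : subspaces E) x
    (e : 'I_n -> vsection E) (i : 'I_n) :
  local_frame x e ->
  near x (fun y => F y = flag (frame_at e y) i /\ F' y = flag (frame_at e y) i.+1) ->
  line_frame x ((fun y => gr_proj F F' (e i y)) : vsection (gr F F')).
Proof.
move=> fe FE; apply: (near_and_mono HX) (local_frame_near fe) (near_near FE).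
move=> y fey FEy; have [be _] := near_self fey; have [Fy F'y] := near_self FEy.
have eF' z : basis_of {:E z} (frame_at e z) -> F' z = flag (frame_at e z) i.+1 ->
    e i z \in F' z by move=> bz ->; rewrite -frame_atE flag_gen.
have split_gr z (v : E z) : basis_of {:E z} (frame_at e z) ->
    F z = flag (frame_at e z) i /\ F' z = flag (frame_at e z) i.+1 ->
    v \in F' z -> gr_proj F F' v = coord (frame_at e z) i v *: gr_proj F F' (e i z).
  move=> bz [Fz F'z] vF'; rewrite -gr_projZ; apply: gr_proj_eq.
  by rewrite Fz -frame_atE; apply: flag_split => //; rewrite -F'z.
split; first split.
- rewrite gr_proj_eq0 ?eF' // Fy; apply/negP => /(flagP be)/(_ i (leqnn i)).
  rewrite -frame_atE (coord_free _ _ (basis_free be)) eqxx => /eqP.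
  by rewrite oner_eq0.
- move=> u; exists (coord (frame_at e y) i (vsval u)).
  rewrite -{1}[u]gr_proj_val split_gr //.
  exact: subvP (diffvSl _ _) _ (subvsP u).
move=> s; split=> [[l rl ls]|[a ra sa]].
  have /(local_frame_regs _ fey)[c rc lc] := rl; exists (c i) => //.
  apply: (near_and_mono HX) (near_and HX ls lc) (near_and HX fey FEy).
  move=> z [[lF' ->] lcz] [[bz _] FEz].
  by rewrite split_gr // {1}lcz coord_frame.
exists (fun z => a z *: e i z).
  apply/(local_frame_regs _ fey); exists (fun j z => if j == i then a z else 0).
    by move=> j; case: (j == i) => //; apply: regular_cst.
  apply: (near_true HX) => z; rewrite (bigD1 i) //= eqxx big1 ?addr0 //.
  by move=> j /negPf->; rewrite scale0r.
apply: (near_and_mono HX) sa (near_and HX fey FEy) => z -> [[bz _] [_ F'z]].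
by rewrite memvZ ?eF' // gr_projZ.
Qed.

Variable K : vfamily X.
Hypothesis HK : vector_bundle 1 K.
Variables (n : nat) (alpha : 'I_n -> vsection K).
Hypothesis alpha_global : forall i, global_section (alpha i).
Hypothesis alpha_distinct : forall i j, i != j -> exists x, alpha i x <> alpha j x.

Lemma kernel_space_mem (E : vfamily X) (phi : higgs_field K E) (J : 'S_n) i x (v : E x) :
  in_hitchin_fibre n (hitchin_point alpha) phi -> (i <= n)%N ->
  v \in kernel_space phi (order_prefix alpha J i) x <->
  killed_value phi (order_prefix alpha J i) v.
Proof.
move=> HE le_in; have [e [fe tri Fe]] := filtration_frame HX HK alpha_global alpha_distinct HE J x.
rewrite (near_self Fe (Ordinal (le_in : i < n.+1)%N)).
exact: (killed_value_flag HX HK alpha_global alpha_distinct le_in fe tri).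
Qed.

Lemma induced_higgs_kernel (E : vfamily X) (phi : higgs_field K E) (J : 'S_n) (i : 'I_n) :
  in_hitchin_fibre n (hitchin_point alpha) phi ->
  let F j := kernel_space phi (order_prefix alpha J j) in
  induced_higgs phi (scalar_higgs (gr (F i) (F i.+1)) (alpha (J i))).
Proof.
move=> HE F x mu v vF'.
have [e [fe tri Fe]] := filtration_frame HX HK alpha_global alpha_distinct HE J x.
have be := (near_self fe).1.
have FE : F i x = flag (frame_at e x) i.
  exact: (near_self Fe (widen_ord (leqnSn n) i)).
have F'E : F i.+1 x = flag (frame_at e x) i.+1.
  exact: (near_self Fe (lift ord0 i)).
rewrite /apply_higgs /scalar_higgs tensvE lfunE /= lfunE /= -gr_projZ.
apply/esym/gr_proj_eq; rewrite FE.
by apply: (triangular_step be (near_self tri mu)); rewrite -F'E.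
Qed.

Lemma shift_higgs_iso (E E' : vfamily X) (phi : higgs_field K E) (phi' : higgs_field K E')
    (f : forall x, 'Hom(E x, E' x)) x (mu : 'Hom(K x, C^o)) l (v : E x) :
  higgs_iso phi phi' f -> f x (shift (phi x mu) l v) = shift (phi' x mu) l (f x v).
Proof.
move=> [_ fphi]; elim: l => //= c l IHl.
by rewrite linearB linearZ /= -IHl; congr (_ - _); apply: fphi.
Qed.

(** A killed value is described by regular sections and the Higgs field alone, and [f] transports
    both. For the converse a section of [E'] is lifted point by point; the lift is regular because
    [f] detects regularity. *)
Lemma kernel_space_iso (E E' : vfamily X) (phi : higgs_field K E) (phi' : higgs_field K E')
    (f : forall x, 'Hom(E x, E' x)) (J : 'S_n) i x :
  in_hitchin_fibre n (hitchin_point alpha) phi ->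
  in_hitchin_fibre n (hitchin_point alpha) phi' ->
  higgs_iso phi phi' f -> (i <= n)%N ->
  (f x @: kernel_space phi (order_prefix alpha J i) x)%VS =
  kernel_space phi' (order_prefix alpha J i) x.
Proof.
move=> HE HE' Hf le_in; have [[fbij fregs] _] := Hf.
apply/vspaceP => v'; apply/idP/idP => [/memv_imgP[v vF ->]|].
  apply/(kernel_space_mem _ _ HE' le_in).
  have /(kernel_space_mem _ _ HE le_in)[s [rs sv sk]] := vF.
  exists (fun y => f y (s y)); split; [exact/fregs | by rewrite sv | ].
  by apply: near_mono sk => y sky mu; rewrite -(shift_higgs_iso _ _ _ Hf) sky linear0.
move/(kernel_space_mem _ _ HE' le_in) => [s' [rs' s'v sk']].
have ex y : exists v, f y v = s' y by have [g _ gK] := fbij y; exists (g (s' y)).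
pose s y := projT1 (cid (ex y)).
have fs y : f y (s y) = s' y by rewrite /s; case: cid.
apply/memv_imgP; exists (s x); last by rewrite fs s'v.
apply/(kernel_space_mem _ _ HE le_in); exists s; split=> //.
  apply/fregs; apply: (regs_near_eq HX (higgs_bundle HE') rs').
  by apply: (near_true HX) => y; rewrite fs.
apply: near_mono sk' => y sky mu; apply: (bij_inj (fbij y)).
by rewrite (shift_higgs_iso _ _ _ Hf) fs sky linear0.
Qed.

End Graded.

(** * The branches of the spectral curve *)

Lemma choice_exists2 (T U : Type) (P Q : T -> U -> Prop) :
  (forall t, exists2 u, P t u & Q t u) ->
  exists2 f : T -> U, forall t, P t (f t) & forall t, Q t (f t).
Proof.
by move=> ex; exists (fun t => projT1 (cid2 (ex t))) => t; case: cid2.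
Qed.

Section Branches.
Variables (C : fieldType) (X : fspace C).
Hypothesis HX : smooth_projective_curve X.
Variable K : vfamily X.

Lemma fibre_polynomial_cst (U : set X) (c : C) : fibre_polynomial U (fun _ : {x : X & K x} => c).
Proof.
exists (fun=> 0), 1%N, (fun _ _ => c); split=> [x _ s rs|i x _|x w _].
- apply: (regular_near_eq HX) (regular_cst HX x 0) _.
  by apply: (near_true HX) => y; rewrite lfunE.
- exact: regular_cst.
- by rewrite big_ord1 expr0 mulr1.
Qed.

Lemma total_regular_cst (p : total_space K) (c : C) : regf p (fun=> c).
Proof.
exists setT, (fun=> c), (fun=> 1); split.
- by split; first exact: open_setT.
- exact: fibre_polynomial_cst.
- exact: fibre_polynomial_cst.
- exact: oner_neq0.
- by move=> q _ _; rewrite divr1.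
Qed.

Lemma total_near_true (p : total_space K) (P : total_space K -> Prop) :
  (forall q, P q) -> near p P.
Proof.
move=> PT; exists setT; split=> // q _; exists setT, (fun=> 1); split=> //.
- exact: open_setT.
- exact: fibre_polynomial_cst.
- exact: oner_neq0.
Qed.

Section SectionPoints.
Variables (b : vsection K) (A : set (total_space K)).
Hypotheses (b_global : global_section b)
  (bA : forall z, A (existT (fun x => K x : Type) z (b z))).

Definition section_point (z : X) : subspace A := exist _ _ (bA z).

Lemma fibre_polynomial_regular (U : set X) P x :
  opn X U -> U x -> fibre_polynomial U P -> regf x (fun z => P (existT _ z (b z))).
Proof.
move=> oU Ux [mu [d [a [rmu ra PE]]]].
have rmub : regf x (fun z => (mu z (b z) : C)) := rmu x Ux b (b_global x).
apply: (@regular_near_eq _ _ HX _ (fun z => \sum_(k < d) a k z * (mu z (b z) : C) ^+ k)).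
  by apply: (regular_sum HX) => k; apply: regularM; [|apply: ra|apply: regularX].
by apply: near_mono (near_open oU Ux) => z Uz; rewrite PE.
Qed.

(** Continuity of the section [b]: basic open sets of the total space are non-vanishing loci of
    functions polynomial on the fibres, and these become regular along [b]. *)
Lemma total_near_section x (P : total_space K -> Prop) :
  near (existT _ x (b x) : total_space K) P -> near x (fun z => P (existT _ z (b z))).
Proof.
move=> [W [oW Wp WP]]; have [U [Q [oU Ux fQ Qp UW]]] := oW _ Wp.
have rQ := fibre_polynomial_regular oU Ux fQ.
apply: (near_and_mono HX) (near_open oU Ux) (near_neq0 HX rQ Qp) => z Uz Qz.
by apply/WP/UW.
Qed.

Lemma total_regular_section x (f : total_space K -> C) :
  regf (existT _ x (b x) : total_space K) f -> regf x (fun z => f (existT _ z (b z))).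
Proof.
move=> [U [P [Q [[oU Ux] fP fQ Qp fE]]]].
have rP := fibre_polynomial_regular oU Ux fP.
have rQ := fibre_polynomial_regular oU Ux fQ.
apply: (regular_near_eq HX) (regularM HX rP (regularV HX rQ Qp)) _.
apply: (near_and_mono HX) (near_open oU Ux) (near_neq0 HX rQ Qp) => z Uz Qz.
by rewrite fE.
Qed.

Lemma near_section x (P : subspace A -> Prop) :
  near (section_point x) P -> near x (fun z => P (section_point z)).
Proof.
move=> [W [[W' oW' WW'] Wx WP]].
have nW' : near (existT _ x (b x) : total_space K) W' 
    by exists W'; split=> //; apply: (WW' (section_point x)).1.
by apply: near_mono (total_near_section nW') => z W'z; apply/WP/(WW' (section_point z)).
Qed.

Lemma regular_section x (f : subspace A -> C) :
  regf (section_point x) f -> regf x (fun z => f (section_point z)).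
Proof.
move=> [g rg fg]; apply: (regular_near_eq HX) (total_regular_section rg) _.
by apply: near_mono (total_near_section fg) => z ->.
Qed.

End SectionPoints.

Lemma subspace_regular_cst (A : set (total_space K)) (q : subspace A) (c : C) :
  regf q (fun=> c).
Proof. by exists (fun=> c); [apply: total_regular_cst|apply: total_near_true]. Qed.

Lemma subspace_near_true (A : set (total_space K)) (q : subspace A)
  (P : subspace A -> Prop) : (forall r, P r) -> near q P.
Proof.
move=> PT; have [W [oW Wq _]] := @total_near_true (sval q) (fun=> True) (fun=> I).
by exists (fun r => W (sval r)); split=> //; exists W.
Qed.

Hypothesis HK : vector_bundle 1 K.
Variables (n : nat) (alpha : 'I_n -> vsection K).
Hypothesis alpha_global : forall i, global_section (alpha i).
Local Notation S := (spectral_curve n (hitchin_point alpha)).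

Definition branch (j : 'I_n) (z : X) : S := component_incl HK (component_map (alpha j) z).

Let component_set j : set (total_space K) := fun p => projT2 p = alpha j (projT1 p).

Lemma near_component j x (P : component (alpha j) -> Prop) :
  near (component_map (alpha j) x) P -> near x (fun z => P (component_map (alpha j) z)).
Proof. exact: (@near_section _ (component_set j) (alpha_global j) (fun z => erefl)). Qed.

Lemma regular_component j x (f : component (alpha j) -> C) :
  regf (component_map (alpha j) x) f -> regf x (fun z => f (component_map (alpha j) z)).
Proof. exact: (@regular_section _ (component_set j) (alpha_global j) (fun z => erefl)). Qed.

Lemma near_branch j x (P : S -> Prop) :
  near (branch j x) P -> near x (fun z => P (branch j z)).
Proof. exact: (near_section (alpha_global j)). Qed.

Lemma regular_branch j x (f : S -> C) :
  regf (branch j x) f -> regf x (fun z => f (branch j z)).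
Proof. exact: (regular_section (alpha_global j)). Qed.

Lemma branch_eq j j' z : alpha j z = alpha j' z -> branch j z = branch j' z.
Proof.
rewrite /branch /component_incl /=; set p := component_sub _ _; set p' := component_sub _ _.
move: p p'; rewrite /component_map /= => p p' e.
case: _ / e p' => p'; congr exist; exact: Prop_irrelevance.
Qed.

Lemma tensv_eq0 (V : vectType C) (x : X) (v : V) (w : K x) :
  tensv v w = 0 -> v = 0 \/ w = 0.
Proof.
have [k fk] := canonical_frame HK x; have [nzk sk] := line_frame_spans fk.
have [c ->] := sk w; move/(congr1 (fun T : 'Hom(_, _) => T (hom1 (k x) (1 : C^o)))).
rewrite tensvE hom1_coord // lfunE => /eqP; rewrite scaler_eq0 => /orP[] /eqP ->.
  by right; rewrite scale0r.
by left.
Qed.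

Lemma spectral_eq_root_inv (s : seq (vsection K)) x (w : K x) :
  spectral_eq (prod_coefs s) w (size s) = 0 ->
  exists2 k, (k < size s)%N & forall d, w = nth d s k x.
Proof.
elim: s => [|a s IHs]; first by move=> /eqP; rewrite (negPf (oner_neq0 _)).
rewrite [size _]/= (spectral_eq_prod HK) => /tensv_eq0[/IHs[k lt_k wk]|].
  by exists k.+1.
by move/eqP; rewrite subr_eq0 => /eqP ->; exists 0%N.
Qed.

Lemma spectral_root (x : X) (w : K x) :
  spectral_eq (hitchin_point alpha) w n = 0 -> exists j, w = alpha j x.
Proof.
have root m : m = size [seq alpha i | i <- enum 'I_n] ->
    spectral_eq (hitchin_point alpha) w m = 0 ->
    exists2 k, (k < m)%N & forall d, w = nth d [seq alpha i | i <- enum 'I_n] k x.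
  by move=> ->; apply: spectral_eq_root_inv.
case/root => [|k lt_kn wk]; first by rewrite size_map size_enum_ord.
exists (Ordinal lt_kn); rewrite (wk (alpha (Ordinal lt_kn))).
by rewrite (nth_map (Ordinal lt_kn)) ?size_enum_ord // (nth_ord_enum _ (Ordinal lt_kn)).
Qed.

Lemma branchP (q : S) : exists j, q = branch j (spectral_proj q).
Proof.
case: q => -[x w] pf; have [j e] := spectral_root pf; exists j.
rewrite /spectral_proj /= in e *; move: pf.
rewrite /branch /component_incl /=; set p := component_sub _ _; move: p => /=.
by case: _ / (esym e) => p pf; congr exist; apply: Prop_irrelevance.
Qed.

Lemma all_branches (P : S -> Prop) (q : S) :
  (forall j, P (branch j (spectral_proj q))) -> P q.
Proof. by move=> PB; have [j qj] := branchP q; rewrite qj; apply: PB. Qed.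

Variable L : vfamily S.

Lemma spectral_frame_regular (q : S) (eps : vsection L) :
  line_frame q eps -> regs L q eps.
Proof.
move=> fe; apply/(line_frame_regs _ fe); exists (fun=> 1).
  exact: subspace_regular_cst.
by apply: subspace_near_true => r; rewrite scale1r.
Qed.

(** A section of the double pullback is a combination, in two stages, of sections of [L]. Each of
    these is a multiple of [eps] near the point, and the coefficients stay regular when read on [X]
    through the branch. *)
Lemma restriction_frame j x (eps : vsection L) :
  line_frame (branch j x) eps ->
  line_frame x ((fun z => eps (branch j z)) : vsection (restriction HK j L)).
Proof.
move=> /line_frame_near/near_branch fe; apply: near_mono fe => z fe.
split; first exact: line_frame_spans fe.
move=> s; split=> [[m [a [l [ra rl sE]]]]|[a ra sE]].
  have ex k : exists2 d : X -> C, regf z d &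
      near z (fun w => l k (component_map (alpha j) w) = d w *: eps (branch j w)).
    have [m' [b [l' [rb rl' lE]]]] := rl k.
    have ex' t : exists2 c : S -> C, regf (branch j z) c &
        near (branch j z) (fun q => l' t q = c q *: eps q).
      by apply/(line_frame_regs _ fe)/rl'.
    have [c rc cE] := choice_exists2 ex'.
    exists (fun w => \sum_(t < m') b t (component_map (alpha j) w) * c t (branch j w)).
      apply: (regular_sum HX) => t; apply: (regularM HX).
        exact: regular_component (rb t).
      exact: regular_branch.
    have nl := near_component lE.
    have nc : near z (fun w => forall t, l' t (branch j w) = c t (branch j w) *: eps (branch j w)).
      by apply: (near_all HX) => t; apply: (near_branch (cE t)).
    apply: (near_and_mono HX) nl nc => w -> cw.
    by rewrite scaler_suml; apply: eq_bigr => t _; rewrite -scalerA -cw.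
  have [d rd dE] := choice_exists2 ex.
  exists (fun w => \sum_(k < m) a k w * d k w).
    by apply: (regular_sum HX) => k; apply: regularM.
  apply: (near_and_mono HX) sE (near_all HX dE) => w -> dw.
  by rewrite scaler_suml; apply: eq_bigr => k _; rewrite -scalerA -dw.
exists 1%N, (fun=> a), (fun=> (fun p => eps (component_incl HK p))); split=> //.
- move=> _; exists 1%N, (fun _ _ => 1), (fun=> eps); split=> [_|_|].
  + exact: subspace_regular_cst.
  + exact: spectral_frame_regular.
  + by apply: subspace_near_true => r; rewrite big_ord1 scale1r.
- by apply: near_mono sE => w ->; rewrite big_ord1.
Qed.

End Branches.

(** * Sections of the spectral datum *)

Section SpectralSections.
Variables (C : fieldType) (X : fspace C).
Hypothesis HX : smooth_projective_curve X.
Variable K : vfamily X.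
Hypothesis HK : vector_bundle 1 K.
Variables (n : nat) (alpha : 'I_n -> vsection K).
Hypothesis alpha_global : forall i, global_section (alpha i).
Local Notation S := (spectral_curve n (hitchin_point alpha)).
Local Notation branch := (branch HK alpha).

Variables (E : vfamily X) (phi : higgs_field K E).
Hypothesis HE : in_hitchin_fibre n (hitchin_point alpha) phi.
Variable L : vfamily S.
Hypothesis HL : spectral_datum phi L.
Implicit Types (s : vsection E) (x z : X) (q : S) (mu : vsection (bdual K)).

Lemma regs_near s x : regs E x s -> near x (fun y => regs E y s).
Proof.
have [e fe] := higgs_bundle HE x; move=> /(local_frame_regs _ fe)[a ra sa].
have na := near_all HX (fun i => regular_near HX (ra i)).
apply: (near_and_mono HX) (near_and HX na (near_near sa)) (local_frame_near fe).
by move=> y [ray say] fey; apply/(local_frame_regs _ fey); exists a.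
Qed.

Definition regular_locus s : set X := fun x => regs E x s.

Lemma open_regular_locus s : opn X (regular_locus s).
Proof. by apply: (open_near HX) => x /regs_near. Qed.

(** The spectral datum is a family of maps indexed by open sets. Using the largest open set where
    [s] is regular gives one section of [L], which near any such point agrees with all the others by
    compatibility with restriction. *)
Definition pushed s : vsection L := projT1 (cid HL) (regular_locus s) s.

Lemma pushedE (U : set X) s q : opn X U -> (forall x, U x -> regs E x s) ->
  U (spectral_proj q) -> projT1 (cid HL) U s q = pushed s q.
Proof.
rewrite /pushed; case: (cid HL) => Psi [compat _ _ _ _] /= oU rU Uq.
apply: compat => //; exact: open_regular_locus.
Qed.

Lemma pushed_regular s q : regs E (spectral_proj q) s -> regs L q (pushed s).
Proof.
rewrite /pushed; case: (cid HL) => Psi [_ reg _ _ _] /= rs.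
by apply: reg => //; apply: open_regular_locus.
Qed.

Lemma pushed_linear s s' (f : X -> C) q : regs E (spectral_proj q) s ->
  regs E (spectral_proj q) s' -> regf (spectral_proj q) f ->
  pushed (fun x => f x *: s x + s' x) q = f (spectral_proj q) *: pushed s q + pushed s' q.
Proof.
move=> rs rs' rf.
have [U [oU Uq UP]] := near_and HX (near_and HX (regs_near rs) (regs_near rs'))
  (regular_near HX rf).
have rU x : U x -> regs E x s by move/UP => [[]].
have rU' x : U x -> regs E x s' by move/UP => [[]].
have rfU x : U x -> regf x f by move/UP => [].
have rsum x : U x -> regs E x (fun x => f x *: s x + s' x).
  move=> Ux; have [e fe] := higgs_bundle HE x.
  have /(local_frame_regs _ fe)[a ra sa] := rU x Ux.
  have /(local_frame_regs _ fe)[a' ra' sa'] := rU' x Ux.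
  apply/(local_frame_regs _ fe); exists (fun i y => f y * a i y + a' i y) => [i|].
    by apply: (regularD HX) => //; apply: (regularM HX) => //; apply: rfU.
  apply: (near_and_mono HX) sa sa' => y -> ->.
  rewrite scaler_sumr -big_split; apply: eq_bigr => i _.
  by rewrite scalerDl scalerA.
rewrite -!(pushedE oU) //; case: (cid HL) => Psi [_ _ lin _ _] /=.
exact: lin.
Qed.

Lemma pushed_near_eq s s' q : regs E (spectral_proj q) s ->
  near (spectral_proj q) (fun y => s y = s' y) -> pushed s q = pushed s' q.
Proof.
move=> rs ss'; have rs' := regs_near_eq HX (higgs_bundle HE) rs ss'.
have [U [oU Uq UP]] := near_and HX (near_and HX (regs_near rs) (regs_near rs')) ss'.
have rU x : U x -> regs E x s by move/UP => [[]].
have rU' x : U x -> regs E x s' by move/UP => [[]].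
rewrite -!(pushedE oU) //; case: (cid HL) => Psi [_ _ _ [inj _] _] /=.
by apply: (inj U s s' oU rU rU').2 => // x /UP[].
Qed.

Lemma pushed_inj s s' x : regs E x s -> regs E x s' ->
  near x (fun z => forall j, pushed s (branch j z) = pushed s' (branch j z)) ->
  near x (fun z => s z = s' z).
Proof.
move=> rs rs' ss'.
have [U [oU Ux UP]] := near_and HX (near_and HX (regs_near rs) (regs_near rs')) ss'.
have rU y : U y -> regs E y s by move/UP => [[]].
have rU' y : U y -> regs E y s' by move/UP => [[]].
have eqU q : U (spectral_proj q) -> pushed s q = pushed s' q.
  by move=> /UP[_ eqb]; apply: (@all_branches _ _ _ HK n alpha (fun q => pushed s q = pushed s' q)).
exists U; split=> //; move: eqU.
have pE t : (forall y, U y -> regs E y t) -> forall q, U (spectral_proj q) ->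
  pushed t q = projT1 (cid HL) U t q by move=> rt q Uq; rewrite pushedE.
move: (pE s rU) (pE s' rU'); case: (cid HL) => Psi [_ _ _ [inj _] _] /= ps ps' eqU.
by apply: (inj U s s' oU rU rU').1 => q Uq; rewrite -ps // -ps' // eqU.
Qed.

Lemma pushed_surj (l : vsection L) x :
  near x (fun z => forall j, regs L (branch j z) l) ->
  exists2 s, regs E x s & near x (fun z => forall j, pushed s (branch j z) = l (branch j z)).
Proof.
move=> [U [oU Ux UP]].
have rl q : U (spectral_proj q) -> regs L q l.
  by move=> /UP rl; apply: (@all_branches _ _ _ HK n alpha (fun q => regs L q l)).
have [s [rs sl]] : exists s, (forall y, U y -> regs E y s) /\
    forall q, U (spectral_proj q) -> projT1 (cid HL) U s q = l q.
  by case: (cid HL) => Psi [_ _ _ [_ surj] _] /=; have [s] := surj U l oU rl; exists s.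
exists s; first exact: rs.
by exists U; split=> // z Uz j; rewrite -sl // (pushedE oU).
Qed.

Lemma pushed_higgs s mu q : regs E (spectral_proj q) s ->
  regs (bdual K) (spectral_proj q) mu ->
  near (spectral_proj q) (fun y => regs (bdual K) y mu) ->
  pushed (fun y => apply_higgs phi (mu y) (s y)) q =
  (mu (spectral_proj q) (projT2 (sval q)) : C) *: pushed s q.
Proof.
move=> rs rmu nmu; have [U [oU Uq UP]] := near_and HX (regs_near rs) nmu.
have rU y : U y -> regs E y s by move/UP => [].
have rmuU y : U y -> regs (bdual K) y mu by move/UP => [].
rewrite -!(pushedE oU) //; last by move=> y Uy; apply: (higgs_regular HE); [apply: rmuU|apply: rU].
by case: (cid HL) => Psi [_ _ _ _ higgs] /=; apply: higgs.
Qed.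

(* The product of the [phi - alpha j], [j] in [l], contracted with [mu]. *)
Definition shift_section mu (l : seq 'I_n) s : vsection E :=
  fun y => shift (phi y (mu y)) [seq (mu y (alpha j y) : C) | j <- l] (s y).

Lemma shift_section_regular mu l s x :
  regs (bdual K) x mu -> regs E x s -> regs E x (shift_section mu l s).
Proof.
move=> rmu rs; elim: l => //= j l IHl.
have [e fe] := higgs_bundle HE x.
have /(local_frame_regs _ fe)[a ra sa] := IHl.
have /(local_frame_regs _ fe)[a' ra' sa'] := higgs_regular HE rmu IHl.
apply/(local_frame_regs _ fe).
exists (fun i y => a' i y - (mu y (alpha j y) : C) * a i y) => [i|].
  apply: (regularB HX) => //; apply: (regularM HX) => //.
  exact: (rmu (alpha j) (alpha_global j x)).
apply: (near_and_mono HX) sa sa' => y sy sy'.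
rewrite /shift_section /= -/(shift _ _ _).
have -> : \sum_(i < n) (a' i y - (mu y (alpha j y) : C) * a i y) *: e i y =
    \sum_(i < n) a' i y *: e i y - (mu y (alpha j y) : C) *: \sum_(i < n) a i y *: e i y.
  by rewrite scaler_sumr -sumrB; apply: eq_bigr => i _; rewrite scalerBl scalerA.
by rewrite -sy -sy'.
Qed.

(** On the branch [m] lambda equals [alpha m], so the contracted Higgs field is multiplication by
    [mu (alpha m)] and each factor of the shift acts as a scalar. *)
Lemma pushed_shift mu l s m x :
  regs (bdual K) x mu -> near x (fun y => regs (bdual K) y mu) -> regs E x s ->
  pushed (shift_section mu l s) (branch m x) =
  (\prod_(j <- l) ((mu x (alpha m x) : C) - (mu x (alpha j x) : C))) *:
    pushed s (branch m x).
Proof.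
move=> rmu nmu rs; elim: l => [|j l IHl].
  by rewrite big_nil scale1r; apply: pushed_near_eq => //; apply: (near_true HX).
have rl := shift_section_regular l rmu rs.
have rneg : regf x (fun y => - (mu y (alpha j y) : C)).
  by apply: (regularN HX); apply: (rmu (alpha j) (alpha_global j x)).
have rphi := higgs_regular HE rmu rl.
have := @pushed_linear (shift_section mu l s)
  (fun y => apply_higgs phi (mu y) (shift_section mu l s y)) _ (branch m x) rl rphi rneg.
rewrite (@pushed_higgs (shift_section mu l s) mu (branch m x)) // IHl => pE.
rewrite big_cons; transitivity (pushed (fun y => - (mu y (alpha j y) : C) *: shift_section mu l s y +
    apply_higgs phi (mu y) (shift_section mu l s y)) (branch m x)).
  apply: pushed_near_eq; first exact: (shift_section_regular (j :: l)).
  by apply: (near_true HX) => y; rewrite addrC scaleNr.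
by rewrite pE -[RHS]scalerA scalerBl scaleNr addrC.
Qed.

End SpectralSections.

(** * Functions on a branch near its meeting points *)

Lemma prod_XsubC_factor (R : idomainType) (p : {poly R}) (rs : seq R) :
  uniq rs -> all (root p) rs -> exists q, p = q * \prod_(z <- rs) ('X - z%:P).
Proof.
elim: rs p => [|z rs IHrs] p; first by exists p; rewrite big_nil mulr1.
move=> /= /andP[z_rs urs] /andP[/factor_theorem[p1 ->] rp].
have [|q ->] := IHrs p1 urs; last first.
  by exists q; rewrite big_cons -mulrA; congr (_ * _); rewrite mulrC.
apply/allP => y y_rs; have := allP rp y y_rs; rewrite rootM root_XsubC.
by case: eqP => [ey|]; [rewrite -ey y_rs in z_rs | rewrite orbF].
Qed.

Lemma regular_coef_prod_XsubC (C : fieldType) (X : fspace C) (I : Type)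
    (c : I -> X -> C) (l : seq I) (y : X) t :
  smooth_projective_curve X -> (forall j, regf y (c j)) ->
  regf y (fun z => (\prod_(j <- l) ('X - (c j z)%:P))`_t).
Proof.
move=> HX rc; elim: l t => [|j l IHl] t.
  apply: (regular_near_eq HX) (regular_cst HX y (t == 0%N)%:R) _.
  by apply: (near_true HX) => z; rewrite big_nil coef1.
have rl : regf y (fun z => if t is t'.+1 then (\prod_(j <- l) ('X - (c j z)%:P))`_t' else 0).
  by case: t => [|t]; [apply: regular_cst | apply: IHl].
apply: (regular_near_eq HX) (regularB HX rl (regularM HX (rc j) (IHl t))) _.
apply: (near_true HX) => z; rewrite big_cons mulrBl coefB coefXM coefCM.
by case: t {rl}.
Qed.

Section BranchGerms.
Variables (C : fieldType) (X : fspace C).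
Hypothesis HX : smooth_projective_curve X.
Variable K : vfamily X.
Hypothesis HK : vector_bundle 1 K.
Variables (n : nat) (alpha : 'I_n -> vsection K).
Hypothesis alpha_global : forall i, global_section (alpha i).
Hypothesis alpha_distinct : forall i j, i != j -> exists x, alpha i x <> alpha j x.
Local Notation S := (spectral_curve n (hitchin_point alpha)).
Local Notation branch := (branch HK alpha).

(** The product over [l] of the differences between lambda and [alpha j'], contracted with a local
    covector, is polynomial on the fibres and non-zero at the given point; its non-vanishing locus
    is the neighbourhood. *)
Lemma near_avoid_branches (z : X) (j : 'I_n) (l : seq 'I_n) :
  (forall j', j' \in l -> alpha j z <> alpha j' z) ->
  near (branch j z) (fun q => forall j', j' \in l ->
    projT2 (sval q) <> alpha j' (spectral_proj q)).
Proof.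
move=> ne_j; have [k fk] := canonical_frame HK z.
pose mu : vsection (bdual K) := fun y => hom1 (k y) (1 : C^o).
have nmu : near z (fun y => regs (bdual K) y mu).
  by apply: near_mono (line_frame_near fk) => y /(covector_frame HX)/(line_frame_regular HX).
have [U [oU Uz rmu]] := nmu.
have nzk := (line_frame_spans fk).1.
pose c j' y := (mu y (alpha j' y) : C).
pose Q (p : {x : X & K x}) := \prod_(j' <- l)
  ((mu (projT1 p) (projT2 p) : C) - c j' (projT1 p)).
have fQ : fibre_polynomial U Q.
  exists mu, (size l).+1, (fun t y => (\prod_(j' <- l) ('X - (c j' y)%:P))`_t).
  split=> // [t y Uy|y w Uy].
    by apply: regular_coef_prod_XsubC => // j'; apply: (rmu y Uy); apply: alpha_global.
  rewrite -(horner_coef_wide _ (n := (size l).+1)); last by rewrite size_prod_XsubC.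
  by rewrite horner_prod; apply: eq_bigr => j' _; rewrite !hornerE.
pose W' : set (total_space K) := fun p => U (projT1 p) /\ Q p != 0.
have oW' : opn (total_space K) W'.
  by move=> p [Up Qp]; exists U, Q; split=> // q Uq Qq; split.
exists (fun q : S => W' (sval q)); split; first by exists W'.
  split=> //=; rewrite prodf_seq_neq0; apply/allP => j' lj' /=.
  have [d dk] := (line_frame_spans fk).2 (alpha j z).
  have [d' dk'] := (line_frame_spans fk).2 (alpha j' z).
  rewrite subr_eq0 /c /mu /= dk dk' !hom1_coord //; apply/eqP => edd.
  by apply: (ne_j j' lj'); rewrite dk dk' edd.
move=> q [_ Qq] j' lj' qj'; move: Qq; rewrite prodf_seq_neq0 => /allP/(_ j' lj') /=.
by rewrite /c -[projT1 _]/(spectral_proj q) qj' subrr eqxx.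
Qed.

Variables (x : X) (k : vsection K) (a : 'I_n -> germ_at x HX).
Hypotheses (fk : line_frame x k)
  (aE : near x (fun y => forall j, alpha j y = a j y *: k y)).

Lemma germ_alpha_inj : injective a.
Proof.
move=> i j aij; apply/eqP; apply: contrapT => /negP ij.
apply: (alpha_generic HX HK alpha_global alpha_distinct (x := x) ij).
by apply: near_mono aE => y ay; rewrite !ay aij.
Qed.

Lemma germ_alpha_x i j : (alpha i x = alpha j x) <-> a i x = a j x.
Proof.
have nzk := (line_frame_spans fk).1; rewrite !(near_self aE); split=> [/eqP|-> //].
by rewrite -subr_eq0 -scalerBl scaler_eq0 (negPf nzk) orbF subr_eq0 => /eqP.
Qed.

Lemma near_covector :
  near x (fun y => forall j, hom1 (k y) (1 : C^o) (alpha j y) = a j y).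
Proof.
apply: (near_and_mono HX) aE fk => y ay [[nzk _] _] j.
by rewrite ay hom1_coord.
Qed.

(** A regular function is a quotient of fibre polynomials, and lambda restricts to [a j] on the
    branch [j]. A single numerator [p] serves all the branches through the point, while the
    denominators [Q j], all units, may differ. *)
Lemma total_regular_polynomial (m : 'I_n) (f : total_space K -> C) :
  regf (existT _ x (alpha m x) : total_space K) f ->
  exists (p : {poly germ_at x HX}) (Q : 'I_n -> germ_at x HX), forall j,
    alpha j x = alpha m x -> Q j \is a GRing.unit /\
    near x (fun z => f (existT _ z (alpha j z)) * Q j z = p.[a j] z).
Proof.
move=> [U [P [Q [[oU Ux] fP fQ Qm fE]]]].
have rQ j : regf x (fun z => Q (existT _ z (alpha j z))).
  exact: (fibre_polynomial_regular HX (alpha_global j) oU Ux fQ).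
have [mu [d [c [rmu rc PE]]]] := fP.
have /(line_frame_regs _ (covector_frame HX fk))[b rb muE] := rmu x Ux.
pose bg := germ_of HX rb; pose cg t := germ_of HX (rc t x Ux).
exists (\sum_(t < d) (cg t * bg ^+ t) *: 'X^t), (fun j => germ_of HX (rQ j)).
move=> j ej; have Qj : Q (existT _ x (alpha j x)) != 0 by rewrite ej.
split; first by rewrite germ_unitE (near_self (near_germ_of HX (rQ j))).
rewrite horner_sum.
have nt : near x (fun z => forall t : 'I_d, ((cg t * bg ^+ t) *: 'X^t).[a j] z =
    c t z * (b z * a j z) ^+ t).
  apply: (near_all HX) => t; rewrite hornerZ hornerXn.
  apply: (near_and_mono HX) (near_and HX (near_germM (cg t * bg ^+ t) (a j ^+ t))
      (near_and HX (near_germM (cg t) (bg ^+ t)) (near_germX bg t)))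
    (near_and HX (near_and HX (near_germX (a j) t) (near_germ_of HX rb))
      (near_germ_of HX (rc t x Ux))).
  by move=> z [-> [-> ->]] [[-> ->] ->]; rewrite exprMn mulrA.
apply: (near_and_mono HX) (near_and HX (near_and HX (near_open oU Ux) (near_germ_of HX (rQ j)))
    (near_and HX (near_germ_sum (index_enum _)
      (fun t : 'I_d => ((cg t * bg ^+ t) *: 'X^t).[a j])) nt))
  (near_and HX (near_and HX (near_neq0 HX (rQ j) Qj) muE) near_covector).
move=> z [[Uz ->] [-> tz]] [[Qz muz] az]; rewrite fE // divfK // PE //.
by apply: eq_bigr => t _; rewrite tz muz lfunE /= az.
Qed.

(* On the branch [m], the product of the [a m - a j] is a local equation of the
   intersections with the branches in [l]. *)
Lemma branch_division (f : S -> C) (m : 'I_n) (l : seq 'I_n) :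
  regf (branch m x) f -> uniq l ->
  (forall j, j \in l -> alpha j x = alpha m x -> near x (fun z => f (branch j z) = 0)) ->
  exists p : germ_at x HX, near x (fun z =>
    f (branch m z) = ((\prod_(j <- l) (a m - a j)) * p) z).
Proof.
move=> [g rg fg] ul f0.
have [p [Q pQ]] := total_regular_polynomial rg.
have fgj j : alpha j x = alpha m x ->
    near x (fun z => f (branch j z) = g (existT _ z (alpha j z))).
  move=> ej; have fgj : near (existT _ x (alpha j x) : total_space K)
      (fun q => forall Aq, f (exist _ q Aq) = g q).
    have tr (w w' : K x) (P : total_space K -> Prop) : w = w' ->
      near (existT _ x w : total_space K) P -> near (existT _ x w' : total_space K) P by move=> ->.
    by apply: tr (esym ej) _.
  by apply: near_mono (total_near_section HX (alpha_global j) fgj) => z ->.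
pose B j := `[< alpha j x = alpha m x >].
have rp : all (root p) [seq a j | j <- l & B j].
  apply/allP => _ /mapP[j + ->]; rewrite mem_filter => /andP[/asboolP ej lj].
  have [_ pj] := pQ j ej; apply/eqP/germ_eq.
  apply: (near_and_mono HX) (near_and HX pj (fgj j ej)) (near_and HX (f0 j lj ej) (near_germ0 HX x)).
  by move=> z [<- <-] [-> ->]; rewrite mul0r.
have ua : uniq [seq a j | j <- l & B j].
  by rewrite map_inj_uniq ?filter_uniq //; apply: germ_alpha_inj.
(* The [a j] of the branches in [l] through the point are distinct roots of [p]; evaluating the
   factorization at [a m] produces their differences. *)
have [r pr] := prod_XsubC_factor ua rp.
have [Qu pm] := pQ m erefl.
(* Branches in [l] that avoid the point contribute units, so the full product differs from the one
   just obtained by a unit. *)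
pose D' := \prod_(j <- l | ~~ B j) (a m - a j).
have D'u : D' \is a GRing.unit.
  apply: rpred_prod => j /asboolPn nj.
  rewrite germ_unitE (near_self (near_germB (a m) (a j))) subr_eq0.
  by apply/eqP => eaj; apply: nj; apply/germ_alpha_x.
exists (r.[a m] / (Q m * D')).
have nf : regf x (fun z => f (branch m z)) by apply: (regular_branch HX alpha_global); exists g.
pose fm := germ_of HX nf.
have fmQ : fm * Q m = p.[a m].
  apply: germ_eq; apply: (near_and_mono HX)
    (near_and HX (near_germM fm (Q m)) (near_germ_of HX nf)) (near_and HX pm (fgj m erefl)).
  by move=> z [-> ->] [<- ->].
have fmE : (\prod_(j <- l) (a m - a j)) * (r.[a m] / (Q m * D')) = fm.
  have pm' : p.[a m] = r.[a m] * \prod_(j <- l | B j) (a m - a j).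
    rewrite pr hornerM horner_prod big_map big_filter; congr (_ * _).
    by apply: eq_bigr => j _; rewrite hornerXsubC.
  have QDu : Q m * D' \is a GRing.unit by rewrite unitrM Qu.
  apply: (mulIr QDu); rewrite -mulrA divrK // (bigID B) /= -/D' mulrA fmQ pm'.
  by rewrite -[LHS]mulrA [D' * _]mulrC mulrA [_ * r.[_]]mulrC.
rewrite fmE; apply: near_mono (near_germ_of HX nf) => z ->.
by [].
Qed.

End BranchGerms.

(** * The graded pieces *)

Lemma prodr_scale (R : comNzRingType) (I : Type) (l : seq I) (b : R) (F : I -> R) :
  \prod_(j <- l) (b * F j) = b ^+ size l * \prod_(j <- l) F j.
Proof.
elim: l => [|j l IHl]; first by rewrite !big_nil mulr1.
by rewrite !big_cons IHl exprS mulrACA.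
Qed.

Section GradedPieces.
Variables (C : fieldType) (X : fspace C).
Hypothesis HX : smooth_projective_curve X.
Variable K : vfamily X.
Hypothesis HK : vector_bundle 1 K.
Variables (n : nat) (alpha : 'I_n -> vsection K).
Hypothesis alpha_global : forall i, global_section (alpha i).
Hypothesis alpha_distinct : forall i j, i != j -> exists x, alpha i x <> alpha j x.
Local Notation S := (spectral_curve n (hitchin_point alpha)).
Local Notation branch := (branch HK alpha).

Variables (E : vfamily X) (phi : higgs_field K E).
Hypothesis HE : in_hitchin_fibre n (hitchin_point alpha) phi.
Variable L : vfamily S.
Hypotheses (HL : spectral_datum phi L) (vL : vector_bundle 1 L).
Local Notation pushed := (pushed HL).

Lemma spectral_frame (q : S) : exists eps : vsection L, line_frame q eps.
Proof. by have [e /local_frame1 fe] := vL q; exists (e 0). Qed.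

(* A frame of [L] on the branches through [branch m x], extended by zero to the
   other branches, is a section of [L] near the whole fibre over [x]. *)
Lemma frame_extension (m : 'I_n) (x : X) (eps : vsection L) :
  line_frame (branch m x) eps ->
  exists2 s : vsection E, regs E x s &
    near x (fun z => pushed s (branch m z) = eps (branch m z)).
Proof.
move=> feps; pose B j := `[< alpha j x = alpha m x >].
pose onB (q : S) := exists2 j, B j & projT2 (sval q) = alpha j (spectral_proj q).
pose l : vsection L := fun q => if `[< onB q >] then eps q else 0.
have lE z j : B j -> l (branch j z) = eps (branch j z).
  by move=> Bj; rewrite /l; case: asboolP => // -[]; exists j.
have [s rs sl] : exists2 s, regs E x s &
    near x (fun z => forall j, pushed s (branch j z) = l (branch j z)).
  apply: (pushed_surj HX HE HL); apply: (near_all HX) => j.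
  have [k fk] := canonical_frame HK x.
  have [a aE] := alpha_germs HX alpha_global fk.
  (* Near [x] the branches through [branch m x] stay disjoint from the others, so along each branch
     [l] is locally [eps] or zero. *)
  have nsep : near x (fun z => forall p : 'I_n * 'I_n,
      B p.1 -> ~~ B p.2 -> alpha p.1 z <> alpha p.2 z).
    apply: (near_all HX) => -[j1 j2] /=.
    have [/andP[B1 nB2]|nB] := boolP (B j1 && ~~ B j2); last first.
      by apply: (near_true HX) => z B1 B2; rewrite B1 B2 in nB.
    have ne12 : alpha j1 x <> alpha j2 x.
      by move/asboolP: B1 => ->; move/asboolPn: nB2 => ne /esym/ne.
    have ne_a : a j1 x - a j2 x != 0.
      by rewrite subr_eq0; apply/eqP => /(germ_alpha_x fk aE).
    have ra := regularB HX (germ_regular (a j1)) (germ_regular (a j2)).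
    apply: (near_and_mono HX) (near_neq0 HX ra ne_a) (near_and HX aE fk).
    move=> z nez [az [[nzk _] _]] _ _ e12; move: nez; rewrite subr_eq0 => /eqP; apply.
    move: e12; rewrite !az => /eqP; rewrite -subr_eq0 -scalerBl scaler_eq0 (negPf nzk).
    by rewrite orbF subr_eq0 => /eqP.
  have [Bj|nBj] := boolP (B j).
    have fj : line_frame (branch j x) eps.
      by rewrite (_ : branch j x = branch m x) //; apply: branch_eq; apply/asboolP.
    have nfj := near_branch HX alpha_global (line_frame_near fj).
    apply: (near_and_mono HX) nfj nsep => z fz sepz.
    apply/(line_frame_regs _ fz); exists (fun=> 1); first exact: subspace_regular_cst.
    have avoid := @near_avoid_branches _ _ HX _ HK _ _ alpha_global z j
      [seq j' <- enum 'I_n | ~~ B j'].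
    apply: near_mono (avoid _) => [q qB|j']; last first.
      by rewrite mem_filter => /andP[nB' _]; apply: (sepz (j, j')).
    rewrite scale1r /l; case: asboolP => // -[].
    have [j' qj'] := spectral_root HK (svalP q).
    exists j' => //; apply: contrapT => /negP nB'.
    by apply: (qB j'); rewrite // mem_filter nB' mem_enum.
  apply: near_mono nsep => z sepz; have [eps' fz] := spectral_frame (branch j z).
  apply/(line_frame_regs _ fz); exists (fun=> 0); first exact: subspace_regular_cst.
  have avoid := @near_avoid_branches _ _ HX _ HK _ _ alpha_global z j
    [seq j' <- enum 'I_n | B j'].
  apply: near_mono (avoid _) => [q qB|j']; last first.
    rewrite mem_filter => /andP[B' _] e; apply: (sepz (j', j)) => //=.
  rewrite scale0r /l; case: asboolP => // -[j' B' qj'].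
  by case: (qB j'); rewrite // mem_filter B' mem_enum.
exists s => //; apply: near_mono sl => z ->.
by apply: lE; apply/asboolP.
Qed.

Lemma pushed0 s q : regs E (spectral_proj q) s ->
  near (spectral_proj q) (fun y => s y = 0) -> pushed s q = 0.
Proof.
move=> rs s0; transitivity (pushed (fun y => -1 *: s y + s y) q).
  apply: (pushed_near_eq HX HE HL rs); apply: near_mono s0 => y ->.
  by rewrite scaler0 addr0.
rewrite (pushed_linear HX HE HL rs rs (f := fun=> -1)); last exact: regular_cst.
by rewrite scaleN1r addNr.
Qed.

Lemma pushed_branch_germ (s : vsection E) (x : X) (m : 'I_n) (eps : vsection L) :
  regs E x s -> line_frame (branch m x) eps ->
  exists f : S -> C, regf (branch m x) f /\
    near (branch m x) (fun q => pushed s q = f q *: eps q).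
Proof.
move=> rs feps; have rp : regs L (branch m x) (pushed s) by apply: (pushed_regular HX HE HL).
by have /(line_frame_regs _ feps)[f rf fE] := rp; exists f.
Qed.

Section Local.
Variables (x : X) (k : vsection K) (a : 'I_n -> germ_at x HX).
Hypotheses (fk : line_frame x k)
  (aE : near x (fun y => forall j, alpha j y = a j y *: k y)).
Let mu : vsection (bdual K) := fun y => hom1 (k y) (1 : C^o).

Let nmu : near x (fun y => regs (bdual K) y mu).
Proof.
by apply: near_mono (line_frame_near fk) => y /(covector_frame HX)/(line_frame_regular HX).
Qed.

Lemma near_pushed_shift (l : seq 'I_n) s (m : 'I_n) : regs E x s ->
  near x (fun z => pushed (shift_section alpha phi mu l s) (branch m z) =
    (\prod_(j <- l) (a m - a j)) z *: pushed s (branch m z)).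
Proof.
move=> rs; have nD : near x (fun z => forall j, (a m - a j) z = a m z - a j z).
  by apply: (near_all HX) => j; apply: near_germB.
apply: (near_and_mono HX) (near_and HX (near_near nmu) (near_covector fk aE))
  (near_and HX (regs_near HX HE rs) (near_and HX nD (near_germ_prod l (fun j => a m - a j)))).
move=> z [nmuz az] [rsz [Dz ->]].
rewrite (pushed_shift HX HK alpha_global HE HL l m (near_self nmuz) nmuz rsz).
congr (_ *: _); apply: eq_bigr => j _; rewrite Dz.
by rewrite !az.
Qed.

Lemma prod_germ_neq0 (l : seq 'I_n) m : m \notin l -> \prod_(j <- l) (a m - a j) != 0.
Proof.
move=> ml; rewrite prodf_seq_neq0; apply/allP => j lj /=; rewrite subr_eq0.
by apply: contraNneq ml => /(germ_alpha_inj HK alpha_global alpha_distinct aE) ->.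
Qed.

(** On the branch [m] the shift multiplies by the product of the [a m - a j], a non-zero germ since
    [m] is not in [l]; it can be cancelled in the local ring of [X]. *)
Lemma pushed_vanish (l : seq 'I_n) s (m : 'I_n) : regs E x s -> m \notin l ->
  near x (fun z => shift_section alpha phi mu l s z = 0) ->
  near x (fun z => pushed s (branch m z) = 0).
Proof.
move=> rs ml s0; have [eps feps] := spectral_frame (branch m x).
have [f [rf fE]] := pushed_branch_germ rs feps.
have nf := regular_branch HX alpha_global rf.
have nfE := near_branch HX alpha_global fE; have nfeps := near_branch HX alpha_global feps.
have rsh : near x (fun y => regs E y (shift_section alpha phi mu l s)).
  apply: (regs_near HX HE); apply: (shift_section_regular HX alpha_global HE) => //.
  exact: near_self nmu.
pose D := \prod_(j <- l) (a m - a j); pose fg := germ_of HX nf.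
have Df : D * fg = 0.
  apply: germ_eq; apply: (near_and_mono HX)
    (near_and HX (near_and HX (near_germM D fg) (near_germ0 HX x))
      (near_and HX (near_germ_of HX nf) (near_near s0)))
    (near_and HX (near_and HX rsh nfeps) (near_and HX nfE (near_pushed_shift l m rs))).
  move=> z [[-> ->] [-> s0z]] [[rz [[nze _] _]] [-> pz]].
  have := pushed0 (q := branch m z) rz s0z; rewrite pz scalerA => /eqP.
  by rewrite scaler_eq0 (negPf nze) orbF => /eqP.
have fg0 : fg = 0.
  by move/eqP: Df; rewrite mulf_eq0 (negPf (prod_germ_neq0 ml)) => /eqP.
apply: (near_and_mono HX) nfE (near_and HX (near_germ_of HX nf) (near_germ0 HX x)).
by move=> z -> [<- e0]; rewrite -/fg fg0 e0 scale0r.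
Qed.

Variables (J : 'S_n) (e : 'I_n -> vsection E).
Hypotheses (fe : local_frame x e)
  (tri : near x (fun y => forall mu : 'Hom(K y, C^o),
      triangular_on (frame_at e y) (phi y mu) (fun i => mu (alpha (J i) y))))
  (Fe : near x (fun y => forall i : 'I_n.+1,
      kernel_space phi (order_prefix alpha J i) y = flag (frame_at e y) i)).
Let F i := kernel_space phi (order_prefix alpha J i).

Definition before i := [seq J k | k <- take i (enum 'I_n)].
Definition after i := [seq J k | k <- drop i (enum 'I_n)].

Lemma before_after i : uniq (before i ++ after i) /\ forall j, j \in before i ++ after i.
Proof.
rewrite -map_cat cat_take_drop; split.
  by rewrite (map_inj_uniq perm_inj) enum_uniq.
by move=> j; apply/mapP; exists ((J^-1)%g j); rewrite ?mem_enum ?permKV.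
Qed.

Lemma notin_before (i j : 'I_n) : (j <= i)%N -> J i \notin before j.
Proof.
move=> le_ji; rewrite (mem_map perm_inj) in_take ?mem_enum // index_enum_ord.
by rewrite -leqNgt.
Qed.

Lemma shift_flag0 i s : (i <= n)%N -> near x (fun z => s z \in flag (frame_at e z) i) ->
  near x (fun z => shift_section alpha phi mu (before i) s z = 0).
Proof.
move=> le_in sF; apply: (near_and_mono HX) sF (near_and HX fe tri) => z sz [[be _] triz].
have := shift_prefix0 be (triz (mu z)) le_in sz.
by rewrite /shift_section /before -map_comp.
Qed.

Lemma shift_scale (V : vectType C) (N : 'End(V)) (c : C) (l : seq C) (v : V) :
  shift (c *: N) [seq c * b | b <- l] v = c ^+ size l *: shift N l v.
Proof.
elim: l => [|b l IHl] /=; first by rewrite expr0 scale1r.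
by rewrite IHl lfunE /= linearZ /= exprS -!scalerA -scalerBr [b *: _]scalerA
  mulrC -scalerA -scalerBr.
Qed.

(** The definition of the step tests all covectors, but each is a multiple of [mu] near [x] and the
    shift is homogeneous in the covector. *)
Lemma shift0_kernel i s : (i <= n)%N -> regs E x s ->
  near x (fun z => shift_section alpha phi mu (before i) s z = 0) ->
  near x (fun z => s z \in F i z).
Proof.
move=> le_in rs s0; apply: (near_and_mono HX) (regs_near HX HE rs)
  (near_and HX (near_near s0) (near_near fk)) => z rz [s0z fkz].
apply/(kernel_space_mem HX HK alpha_global alpha_distinct _ _ HE le_in).
exists s; split=> //; apply: (near_and_mono HX) s0z fkz => y s0y [sk _] nu.
have [c nuE] : exists c, nu = c *: mu y.
  exists (nu (k y)); apply: (hom1_eq sk).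
  by rewrite lfunE /= hom1_gen; [rewrite [RHS]mulr1|case: sk].
have -> : [seq (nu (b y) : C) | b <- order_prefix alpha J i] =
    [seq c * b | b <- [seq (mu y (alpha j y) : C) | j <- before i]].
  by rewrite -!map_comp; apply: eq_map => j /=; rewrite nuE lfunE.
have -> : phi y nu = c *: (phi y (mu y) : 'End(E y)) by rewrite nuE linearZ.
by rewrite shift_scale -[shift _ _ _]/(shift_section alpha phi mu (before i) s y) s0y scaler0.
Qed.

Variable i : 'I_n.
Let m := J i.
Let D := \prod_(j <- after i.+1) (a m - a j).

Lemma prod_after_neq0 : D != 0.
Proof.
apply: prod_germ_neq0; rewrite (mem_map perm_inj); have := enum_uniq 'I_n.
rewrite -{1}(cat_take_drop i.+1 (enum 'I_n)) cat_uniq => /and3P[_ /hasPn nh _].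
by apply/negP => /nh; rewrite /= in_take ?mem_enum // index_enum_ord leqnn.
Qed.

(** The coordinates of [s] of index below [i] form a section [t] of the previous step. It is zero in
    the quotient, and it vanishes on the branch [m] because it is killed by factors not involving
    [m]. Both sides thus see the same coefficient of [e i]. *)
Lemma top_coefficient s : regs E x s -> near x (fun z => s z \in F i.+1 z) ->
  exists c : germ_at x HX,
    near x (fun z => gr_proj (F i) (F i.+1) (s z) = c z *: gr_proj (F i) (F i.+1) (e i z)) /\
    near x (fun z => pushed s (branch m z) = c z *: pushed (e i) (branch m z)).
Proof.
move=> rs sF; have /(local_frame_regs _ fe)[c rc sc] := rs.
pose t z := \sum_(j < n | (j < i)%N) c j z *: e j z.
have stc : near x (fun z => s z = c i z *: e i z + t z /\ t z \in flag (frame_at e z) i).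
  apply: (near_and_mono HX) (near_and HX sc sF) (near_and HX fe Fe) => z [sz szF] [[be _] Fz].
  have FzE : F i.+1 z = flag (frame_at e z) i.+1 := Fz (lift ord0 i).
  rewrite FzE in szF.
  have c0 (j : 'I_n) : (i < j)%N -> c j z = 0.
    by move=> lt_ij; rewrite -(coord_frame (c^~ z) j be) -sz; apply: (flagP be _ _ szF).
  split.
    rewrite sz (bigD1 i) //=; congr (_ + _); rewrite /t big_mkcond [RHS]big_mkcond /=.
    apply: eq_bigr => j _; rewrite -val_eqE /=; case: ltngtP => // lt_ij.
    by rewrite c0 ?scale0r.
  apply: memv_suml => j lt_ji; rewrite memvZ // -frame_atE.
  exact: flag_gen.
have rt : regs E x t.
  apply/(local_frame_regs _ fe).
  exists (fun (j : 'I_n) z => if (j < i)%N then c j z else 0) => [j|].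
    by case: (j < i)%N => //; apply: regular_cst.
  apply: (near_true HX) => z; rewrite /t big_mkcond; apply: eq_bigr => j _.
  by case: (j < i)%N; rewrite ?scale0r.
have t0 : near x (fun z => pushed t (branch m z) = 0).
  apply: (pushed_vanish rt (notin_before (leqnn i))).
  by apply: shift_flag0 => //; [exact: ltnW | apply: near_mono stc => z []].
exists (germ_of HX (rc i)); split.
  apply: (near_and_mono HX) (near_and HX stc (near_germ_of HX (rc i))) Fe.
  move=> z [[-> tz] ->] Fz; have FzE : F i z = flag (frame_at e z) i := Fz (widen_ord (leqnSn n) i).
  have tF : t z \in F i z by rewrite FzE.
  by rewrite gr_projD gr_projZ (gr_proj0 _ tF) addr0.
apply: (near_and_mono HX) (near_and HX (near_near stc) (near_and HX t0 (near_germ_of HX (rc i))))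
  (near_and HX (near_and HX (regs_near HX HE rs) (regs_near HX HE rt))
    (near_and HX (local_frame_near fe) (regular_near HX (rc i)))).
move=> z [sz [tz ->]] [[rsz rtz] [fez rcz]].
rewrite (pushed_near_eq HX HE HL (q := branch m z) (s' := fun y => c i y *: e i y + t y) rsz); last first.
  by apply: near_mono sz => y [].
rewrite (@pushed_linear _ _ HX _ _ _ _ _ HE _ HL (e i) t (c i) (branch m z)) //.
  by rewrite tz addr0.
exact: (local_frame_regular HX).
Qed.

Let P z := \prod_(j <- after i.+1) ((mu z (alpha m z) : C) - (mu z (alpha j z) : C)).

Let nP : near x (fun z => P z = D z).
Proof.
have nD : near x (fun z => forall j, (a m - a j) z = a m z - a j z).
  by apply: (near_all HX) => j; apply: near_germB.
apply: (near_and_mono HX) (near_covector fk aE)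
  (near_and HX nD (near_germ_prod (after i.+1) (fun j => a m - a j))).
move=> z az [Dz ->]; apply: eq_bigr => j _; rewrite Dz.
by rewrite /mu !az.
Qed.

Lemma near_prod_germ0 (l : seq 'I_n) j : j \in l ->
  near x (fun z => (\prod_(j' <- l) (a j - a j')) z = 0).
Proof.
move=> lj; have -> : \prod_(j' <- l) (a j - a j') = 0.
  by apply/eqP; rewrite prodf_seq_eq0; apply/hasP; exists j => //=; rewrite subrr.
exact: near_germ0.
Qed.

Lemma regs0 y : regs E y (fun=> 0).
Proof.
have [e' fe'] := higgs_bundle HE y; apply/(local_frame_regs _ fe').
exists (fun _ _ => 0) => [j|]; first exact: regular_cst.
by apply: (near_true HX) => z; rewrite big1 // => j _; rewrite scale0r.
Qed.

(* [pushed (e i)] is divisible by [P], because it vanishes on the branches in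
   [after i.+1]; conversely [P] times a frame of [L], extended to the fibre over
   [x], lies in [F i.+1] and so is a multiple of [pushed (e i)]. *)
Lemma graded_frame : exists l : vsection (restriction HK m L),
  line_frame x l /\ near x (fun z => pushed (e i) (branch m z) = P z *: l z).
Proof.
have [eps feps] := spectral_frame (branch m x).
have rei : regs E x (e i) := local_frame_regular HX i fe.
have [f [rf fE]] := pushed_branch_germ rei feps.
have ei0 : near x (fun z => shift_section alpha phi mu (before i.+1) (e i) z = 0).
  apply: shift_flag0; first exact: ltn_ord.
  by apply: (near_true HX) => z; rewrite -frame_atE flag_gen.
have [uba allj] := before_after i.+1.
have ub : uniq (after i.+1) by move: uba; rewrite cat_uniq => /and3P[].
have nb j : j \in after i.+1 -> j \notin before i.+1.
  by move: uba; rewrite cat_uniq => /and3P[_ /hasPn + _]; apply.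
have f0 j : j \in after i.+1 -> alpha j x = alpha m x ->
    near x (fun z => f (branch j z) = 0).
  move=> lj ej; have bE : branch j x = branch m x by apply: branch_eq.
  have p0 := pushed_vanish rei (nb j lj) ei0.
  have fEj : near x (fun z => pushed (e i) (branch j z) = f (branch j z) *: eps (branch j z)).
    by apply: (near_branch HX alpha_global (P := fun q => pushed (e i) q = f q *: eps q));
      rewrite bE.
  have fepsj : near x (fun z => line_frame (branch j z) eps).
    apply: (near_branch HX alpha_global (P := fun q => line_frame q eps)).
    by rewrite bE; apply: line_frame_near.
  apply: (near_and_mono HX) p0 (near_and HX fEj fepsj) => z -> [/esym/eqP + fz].
  by rewrite scaler_eq0 (negPf (line_frame_spans fz).1) orbF => /eqP.
have [p pE] := branch_division alpha_global alpha_distinct fk aE rf ub f0.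
have [t0 rt0 t0E] := frame_extension feps.
(* On the branch [m] this section is [D] times [eps]. *)
pose t := shift_section alpha phi mu (after i.+1) t0.
have rt : regs E x t.
  by apply: (shift_section_regular HX alpha_global HE) => //; apply: (near_self nmu).
have rbt : regs E x (shift_section alpha phi mu (before i.+1) t).
  by apply: (shift_section_regular HX alpha_global HE) => //; apply: (near_self nmu).
(* Every branch occurs in [before] or in [after], so the product of all factors vanishes on all
   branches and kills [t0]. *)
have bt0 : near x (fun z => shift_section alpha phi mu (before i.+1) t z = 0).
  apply: (pushed_inj HX HE (HL := HL) (s' := fun=> 0) rbt (regs0 x)).
  apply: (near_all HX) => j.
  have p0 z : pushed (fun=> 0) (branch j z) = 0.
    by apply: pushed0; [apply: regs0 | apply: near_true].
  have /orP[jb|ja] : (j \in before i.+1) || (j \in after i.+1) by rewrite -mem_cat.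
    apply: (near_and_mono HX) (near_pushed_shift (before i.+1) j rt) (near_prod_germ0 jb).
    by move=> z -> ->; rewrite scale0r p0.
  apply: (near_and_mono HX) (near_pushed_shift (before i.+1) j rt)
    (near_and HX (near_pushed_shift (after i.+1) j rt0) (near_prod_germ0 ja)).
  by move=> z -> [-> ->]; rewrite scale0r scaler0 p0.
have tF := shift0_kernel (ltn_ord i) rt bt0.
have [c [_ cE]] := top_coefficient rt tF.
have fE' := near_branch HX alpha_global fE.
have nfeps := near_branch HX alpha_global (line_frame_near feps).
(* On the branch [m], [t] is [D] times [eps] and also [c] times [pushed (e i)], that is [c * D * p]
   times [eps]; the non-zero germ [D] cancels. *)
have cp : c * p = 1.
  apply: (mulfI prod_after_neq0); rewrite mulr1; apply: germ_eq.
  have nM := near_and HX (near_germM D (c * p)) (near_and HX (near_germM c p) (near_germM D p)).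
  apply: (near_and_mono HX) (near_and HX nM (near_and HX cE fE'))
    (near_and HX (near_and HX pE t0E) (near_and HX (near_pushed_shift (after i.+1) m rt0) nfeps)).
  move=> z [[-> [-> Dp]] [cz fz]] [[pz t0z] [tz nz]].
  move: cz; rewrite tz t0z fz pz -/D Dp scalerA => /eqP.
  rewrite -subr_eq0 -scalerBl scaler_eq0 (negPf (line_frame_spans nz).1) orbF subr_eq0.
  move=> /eqP e1. by rewrite [RHS]e1 mulrCA.
have pu : p x != 0.
  by rewrite -germ_unitE; apply/unitrPr; exists c; rewrite mulrC.
exists (fun z => p z *: eps (branch m z)); split.
  apply: (line_frame_scale HX (germ_regular p) pu).
  exact: (restriction_frame HX alpha_global feps).
apply: (near_and_mono HX) (near_and HX fE' pE) (near_and HX (near_germM D p) nP).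
by move=> z [-> ->] [Dp ->]; rewrite -/D Dp scalerA.
Qed.

Variables (N : vfamily X) (kap : forall y, 'Hom(K y, C^o) -> N y).
Hypothesis kapZ : forall y (c : C) (nu : 'Hom(K y, C^o)),
  kap (c *: nu) = c ^+ (n - i.+1) *: kap nu.

(* [h] maps the class of [s] to [l (x) mu ^ (i + 1 - n)] whenever [s], as a
   section of [L] on the branch [m], is the product of [l] and of the
   [mu (alpha m - alpha j)], [j] in [after i.+1]. *)
Definition graded_spec y
    (h : 'Hom(gr (F i) (F i.+1) y, btens (restriction HK m L) N y)) :=
  forall (s : vsection E) (l : vsection (restriction HK m L)) (nu : vsection (bdual K)),
  regs E y s -> near y (fun z => s z \in F i.+1 z) ->
  regs (restriction HK m L) y l -> regs (bdual K) y nu ->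
  near y (fun z => pushed s (branch m z) =
    (\prod_(j <- after i.+1) ((nu z (alpha m z) : C) - (nu z (alpha j z) : C))) *: l z) ->
  h (gr_proj (F i) (F i.+1) (s y)) = tensv (l y) (kap (nu y)).

Lemma size_after : size (after i.+1) = (n - i.+1)%N.
Proof. by rewrite size_map size_drop size_enum_ord. Qed.

(** If [l'] is [g] times [l] and [nu] is [b] times [mu], the coefficient of [s] on [e i] is
    [b ^+ (n - i.+1) * g]: the power of [b] produced by the differences is the one produced by
    [kap]. Uniqueness is the case of [e i], [l] and [mu]. *)
Lemma graded_specP (l : vsection (restriction HK m L)) :
  line_frame x l -> near x (fun z => pushed (e i) (branch m z) = P z *: l z) ->
  gr_proj (F i) (F i.+1) (e i x) != 0 ->
  graded_spec (hom1 (gr_proj (F i) (F i.+1) (e i x)) (tensv (l x) (kap (mu x)))) /\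
  forall h, graded_spec h ->
    h (gr_proj (F i) (F i.+1) (e i x)) = tensv (l x) (kap (mu x)).
Proof.
move=> fl lE nzv; have rei : regs E x (e i) := local_frame_regular HX i fe.
split=> [s l' nu rs sF rl' rnu sE|h hP]; last first.
  apply: (hP (e i) l mu) => //.
  - apply: near_mono Fe => z Fz.
    have FzE : F i.+1 z = flag (frame_at e z) i.+1 := Fz (lift ord0 i).
    by rewrite FzE -frame_atE flag_gen.
  - exact: (line_frame_regular HX fl).
  - exact: near_self nmu.
have [c [grs cE]] := top_coefficient rs sF.
have /(line_frame_regs _ fl)[g rg lg] := rl'.
have /(line_frame_regs _ (covector_frame HX fk))[b rb nub] := rnu.
pose gg := germ_of HX rg; pose bg := germ_of HX rb.
(* Two expressions of [s] on the branch [m] are compared, and the common factor [D] is cancelled. *)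
have cbg : c = bg ^+ (n - i.+1) * gg.
  apply: (mulfI prod_after_neq0); apply: germ_eq.
  have nM := near_and HX (near_germM D c) (near_and HX
    (near_germM D (bg ^+ (n - i.+1) * gg)) (near_germM (bg ^+ (n - i.+1)) gg)).
  have nb := near_and HX (near_germX bg (n - i.+1)) (near_and HX (near_germ_of HX rb)
    (near_germ_of HX rg)).
  apply: (near_and_mono HX) (near_and HX nM nb)
    (near_and HX (near_and HX (near_and HX cE lE) (near_and HX lg nub))
      (near_and HX (near_and HX sE nP) (line_frame_near fl))).
  move=> z [[-> [-> ->]] [-> [-> ->]]] [[[cz lz] [l'z nuz]] [[sz Pz] flz]].
  have nuP : \prod_(j <- after i.+1) ((nu z (alpha m z) : C) - (nu z (alpha j z) : C)) =
      b z ^+ (n - i.+1) * P z.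
    rewrite -size_after /P -prodr_scale.
    by apply: eq_bigr => j _; rewrite nuz !lfunE mulrBr.
  move: cz; rewrite sz lz l'z nuP !scalerA => /eqP; rewrite -subr_eq0 -scalerBl.
  rewrite scaler_eq0 (negPf (line_frame_spans flz).1) orbF subr_eq0 Pz => /eqP e1.
  by rewrite mulrC -e1 mulrCA mulrA.
rewrite (near_self grs) hom1E // cbg (near_self lg) (near_self nub) kapZ.
rewrite tensvZl tensvZr scalerA (near_self (near_germM _ gg)) (near_self (near_germX bg _)).
rewrite (near_self (near_germ_of HX rb)) (near_self (near_germ_of HX rg)).
by rewrite mulrC.
Qed.

End Local.
End GradedPieces.

(** * Gluing the local isomorphisms *)

(** Since [Q] determines a map at each point, the one picked by [xget] coincides with every local
    [hom1] satisfying [Q]; it therefore matches frames, without any comparison of transition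
    functions. *)
Lemma isomorphic_local (C : fieldType) (X : fspace C) (E F : vfamily X)
    (Q : forall y, 'Hom(E y, F y) -> Prop) :
  smooth_projective_curve X ->
  (forall x, exists (v : vsection E) (w : vsection F), [/\ line_frame x v, line_frame x w &
    near x (fun y => Q y (hom1 (v y) (w y)) /\ forall h, Q y h -> h (v y) = w y)]) ->
  isomorphic E F.
Proof.
move=> HX loc; pose f y : 'Hom(E y, F y) := xget 0 (Q y).
have fE x : exists (v : vsection E) (w : vsection F), [/\ line_frame x v, line_frame x w &
    near x (fun y => f y = hom1 (v y) (w y))].
  have [v [w [fv fw vw]]] := loc x; exists v, w; split=> //.
  apply: (near_and_mono HX) vw fv => y [Qvw Qu] [sv _]; apply: (hom1_eq sv).
  by rewrite hom1_gen ?sv.1 //; apply: Qu; apply: xgetPex; exists (hom1 (v y) (w y)).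
exists f; split=> [x|x s]; have [v [w [fv fw fvw]]] := fE x.
  have [nzv sv] := line_frame_spans fv; have [nzw sw] := line_frame_spans fw.
  rewrite (near_self fvw); exists (hom1 (w x) (v x)) => u.
    by have [c ->] := sv u; rewrite !hom1E.
  by have [c ->] := sw u; rewrite !hom1E.
split=> [/(line_frame_regs _ fv)[a ra sa]|/(line_frame_regs _ fw)[a ra sa]].
  apply/(line_frame_regs _ fw); exists a => //.
  apply: (near_and_mono HX) (near_and HX sa fvw) fv => z [-> ->] [[nzv _] _].
  exact: hom1E.
apply/(line_frame_regs _ fv); exists a => //.
apply: (near_and_mono HX) (near_and HX sa fvw) (near_and HX fv fw).
move=> z [saz fz] [[[nzv sv] _] [[nzw _] _]]; have [c sc] := sv (s z).
move: saz; rewrite fz sc hom1E // => /eqP; rewrite -subr_eq0 -scalerBl scaler_eq0.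
by rewrite (negPf nzw) orbF subr_eq0 => /eqP ->.
Qed.

Lemma graded_isomorphic (C : fieldType) (X : fspace C) (K : vfamily X)
    (HK : vector_bundle 1 K) (n : nat) (alpha : 'I_n -> vsection K)
    (E : vfamily X) (phi : higgs_field K E)
    (L : vfamily (spectral_curve n (hitchin_point alpha))) (J : 'S_n) (i : 'I_n) :
  smooth_projective_curve X -> (forall i, global_section (alpha i)) ->
  (forall i j, i != j -> exists x, alpha i x <> alpha j x) ->
  in_hitchin_fibre n (hitchin_point alpha) phi ->
  spectral_datum phi L -> vector_bundle 1 L ->
  let F j := kernel_space phi (order_prefix alpha J j) in
  isomorphic (gr (F i) (F i.+1))
    (btens (restriction HK (J i) L) (bzpow K (i.+1%:Z - n%:Z))).
Proof.
move=> HX Hglob Hdist HE HL vL F.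
(* Ordinals start at 0: the quotient of index [i] is the one numbered [i + 1] in the usual
   convention. The exponent is non-positive, and [n - i.+1] counts the branches after it. *)
have -> : i.+1%:Z - n%:Z = - (n - i.+1)%N%:Z by rewrite -subzn ?opprB.
have [kap [kapZ kapF]] := negative_power_frame HX K (n - i.+1).
apply: (isomorphic_local (Q := fun y h => graded_spec HL (J := J) (i := i) kap h) HX) => x.
have [k fk] := canonical_frame HK x; have [a aE] := alpha_germs HX Hglob fk.
have [e [fe tri Fe]] := filtration_frame HX HK Hglob Hdist HE J x.
have [l [fl lE]] := graded_frame HK Hglob Hdist HE HL vL fk aE fe tri Fe i.
have fgr : line_frame x ((fun y => gr_proj (F i) (F i.+1) (e i y)) : vsection (gr (F i) (F i.+1))).
  apply: (gr_line_frame HX fe); apply: near_mono Fe => y Fy; split.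
    exact: (Fy (widen_ord (leqnSn n) i)).
  exact: (Fy (lift ord0 i)).
exists (fun y => gr_proj (F i) (F i.+1) (e i y)),
  (fun y => tensv (l y) (kap y (hom1 (k y) (1 : C^o)))); split=> //.
  exact: (line_frame_tens HX fl (kapF x k fk)).
apply: (near_and_mono HX) (near_and HX (near_and HX (line_frame_near fk) (near_near tri))
    (near_and HX (near_near Fe) (local_frame_near fe)))
  (near_and HX (near_and HX (line_frame_near fl) (near_near lE)) fgr).
move=> y [[fky triy] [Fey fey]] [[fly lEy] [[nzv _] _]].
(* Germs belong to a fixed point, so the coordinates of the [alpha j] are chosen anew at [y];
   [graded_spec] does not depend on them. *)
have [a' aE'] := alpha_germs HX Hglob fky.
exact: (graded_specP Hglob Hdist HE vL fky aE' fey triy Fey kapZ fly lEy nzv).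
Qed.

Theorem proposition3p7 (R : realType) (X : fspace R[i])
    (HX : smooth_projective_curve X)
    (K : vfamily X) (HK : canonical_bundle K)
    (g : nat) (Hg : genus K g)
    (n : nat) (alpha : 'I_n -> vsection K) (Hv : in_Vnod alpha) :
  exists Fil : forall (J : 'S_n) (E : vfamily X),
                 higgs_field K E -> filtration_type E,
    (forall (J : 'S_n) (E : vfamily X) (phi : higgs_field K E),
       in_hitchin_fibre n (hitchin_point alpha) phi ->
       [/\ higgs_filtration n phi (Fil J E phi),
           forall i : 'I_n,
             induced_higgs phi
               (scalar_higgs (gr (Fil J E phi i) (Fil J E phi i.+1))
                             (alpha (J i))) &
           forall L : vfamily (spectral_curve n (hitchin_point alpha)),
             in_Jac (proj1 HK)
               (n%:Z * (n%:Z - 1) * (g%:Z - 1)) L ->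
             spectral_datum phi L ->
             forall i : 'I_n,
               isomorphic
                 (gr (Fil J E phi i) (Fil J E phi i.+1))
                 (btens (restriction (proj1 HK) (J i) L)
                        (bzpow K (i.+1%:Z - n%:Z)))]) /\
    (forall (J : 'S_n) (E E' : vfamily X)
            (phi : higgs_field K E) (phi' : higgs_field K E')
            (f : forall x, 'Hom(E x, E' x)),
       in_hitchin_fibre n (hitchin_point alpha) phi ->
       in_hitchin_fibre n (hitchin_point alpha) phi' ->
       higgs_iso phi phi' f ->
       forall (i : nat) (x : X), (i <= n)%N ->
         (f x @: Fil J E phi i x)%VS = Fil J E' phi' i x).
Proof.
have [vK _] := HK; have [Hglob Hdist _ _] := Hv.
exists (fun J E phi i => kernel_space phi (order_prefix alpha J i)); split.
  move=> J E phi HE; split.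
  - exact: higgs_filtration_kernel.
  - by move=> i; apply: induced_higgs_kernel.
  - by move=> L [vL _] HL i; apply: graded_isomorphic.
move=> J E E' phi phi' f HE HE' Hf i x le_in.
exact: (kernel_space_iso HX vK Hglob Hdist).
Qed.
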